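(* For every admissible transport cost $\tau:[0,\infty)\to[0,\infty)$ there exists a phase field cost $c:[0,\infty)\to[0,\infty)$ such that for all $w\geq0$ $$\tau(w)=\inf\left\{F^c[\psi]\,\middle|\,\psi:\mathbb{R}\to\mathbb{R},\ \int_{\mathbb{R}}\psi\,dy=w\right\}.$$ Furthermore, $c$ can be chosen such that the mass-specific phase field cost $\phi\mapsto z(\phi)=c(\phi)/\phi$ is lower semi-continuous and nonincreasing.
   Context: A transport cost $\tau:[0,\infty)\to[0,\infty)$ is admissible if it is nondecreasing, concave and continuous with $\tau(0)=0$. For $c:[0,\infty)\to[0,\infty)$ and $\psi:\mathbb{R}\to\mathbb{R}$ (with locally integrable weak derivative; otherwise the energy is $+\infty$), $F^c[\psi]=\int_{\mathbb{R}}\frac12|\psi'(y)|^2+c(|\psi(y)|)\,dy$. *)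

(* Defs.v *)
From HB Require Import structures.
From mathcomp Require Import all_boot all_order all_algebra.
From mathcomp Require Import all_classical all_reals all_analysis.
Set Implicit Arguments. Unset Strict Implicit. Unset Printing Implicit Defensive.
Import Order.TTheory GRing.Theory Num.Theory.
Import numFieldNormedType.Exports.
Local Open Scope classical_set_scope.
Local Open Scope ring_scope.

Definition admissible_cost {R : realType} (tau : R -> R) : Prop :=
  [/\ tau 0 = 0,
      (forall x, 0 <= x -> 0 <= tau x),
      (forall x y, 0 <= x -> x <= y -> tau x <= tau y),
      (forall x y t, 0 <= x -> 0 <= y -> 0 <= t -> t <= 1 ->
          (1 - t) * tau x + t * tau y <= tau ((1 - t) * x + t * y)) &
      {within `[0, +oo[, continuous tau}].

Definition test_function {R : realType} (phi : R -> R) : Prop :=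
  (forall (n : nat) (x : R), derivable (derive1n n phi) x 1) /\
  (exists M : R, forall x, M < `|x| -> phi x = 0).

Definition weak_derivative {R : realType} (psi g : R -> R) : Prop :=
  [/\ locally_integrable setT psi, locally_integrable setT g &
      forall phi : R -> R, test_function phi ->
        (\int[lebesgue_measure]_x (psi x * derive1 phi x)%:E
         = - \int[lebesgue_measure]_x (g x * phi x)%:E)%E].

(* F^c[psi] = int 1/2 |psi'|^2 + c(|psi|) dy, and +oo if psi has no
   locally integrable weak derivative (inf over the empty set is +oo;
   all weak derivatives agree a.e., so the inf is the value). *)
Definition energy {R : realType} (c : R -> R) (psi : R -> R) : \bar R :=
  ereal_inf [set (\int[lebesgue_measure]_y
                    ((2^-1 * (g y) ^+ 2 + c `|psi y|)%:E))%E
            | g in [set g | weak_derivative psi g]].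

Definition lsc_pos {R : realType} (z : R -> R) : Prop :=
  forall x, 0 < x -> forall a, a < z x ->
    \forall y \near x, 0 < y -> a < z y.

Definition nonincreasing_pos {R : realType} (z : R -> R) : Prop :=
  forall x y, 0 < x -> x <= y -> z y <= z x.

(* Main.v *)
(* The cost is c(p) = p z(p), where the nonincreasing function z is determined by
   Abel's integral equation
     2 int sqrt(2 p (z(p) - l)_+) dp = int (tau'(v) - l)_+ dv   for all l >= 0.
   Since tau(w) = inf_l (l w + int (tau' - l)_+), attained at l = tau'(w), it
   suffices to compare the energy with l w plus the left-hand side.

   Lower bound: replace psi by its continuous representative, put
   l = z(sup |psi|) and split c(|psi|) = l |psi| + |psi| (z(|psi|) - l). Young's
   inequality bounds the energy from below by l w plus the integral of
   |psi'| sqrt(2 |psi| (z(|psi|) - l)), and |psi| crosses each value below its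
   supremum at least twice.

   Upper bound: for l = tau'(w), solve psi' = -sqrt(2 psi (z(psi) - l)_+) - e from
   a height M with z(M) close to l, reflect the solution, and insert a plateau at
   height M that fills up the mass to w. *)

Require Import Defs.
From HB Require Import structures.
From mathcomp Require Import all_boot all_order all_algebra.
From mathcomp Require Import all_classical all_reals all_analysis.
From mathcomp Require Import measurable_realfun ring lra.
Import Order.TTheory GRing.Theory Num.Theory.
Import numFieldNormedType.Exports.
Local Open Scope classical_set_scope.
Local Open Scope ring_scope.

Set Implicit Arguments.
Unset Strict Implicit.
Unset Printing Implicit Defensive.

Local Notation mu := lebesgue_measure.

(** * One-sided slopes of a concave cost *)

(** Abel's equation is solved without differentiating an inverse transform. The length of {r : r^2 <
    x} is 2 sqrt x, and the half disc of radius sqrt x has area proportional to x; so both sides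
    become integrals over r of functions of l + r^2, and it suffices to match these integrands. This
    prescribes the superlevel sets of z, and z is recovered from them as a generalised inverse. The
    obstacle throughout is missing regularity: tau' may jump, vanish or blow up at 0, and z is
    merely monotone and lower semicontinuous. Hence tau' is the left derivative and is integrated by
    a squeeze. The crossing estimate is proved for intervals of heights and carried over to the
    excess by layer cakes. The profile does not come from an existence theorem for differential
    equations: it is the generalised inverse of the travel time int dp / s. The summand e keeps this
    time finite where the square root vanishes, and its cost e M is made small. *)

Lemma admissible_cost_three_slopes (R : realType) (tau : R -> R) (a b c : R) :
  admissible_cost tau -> 0 <= a -> a < b -> b < c ->
  (tau c - tau b) * (b - a) <= (tau b - tau a) * (c - b).
Proof.
move=> [_ _ _ conc _] a0 ab bc.
have ca : 0 < c - a by lra.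
have := conc a c ((b - a) / (c - a)) a0.
have -> : (1 - (b - a) / (c - a)) * a + (b - a) / (c - a) * c = b.
  by field; rewrite gt_eqF.
move=> H.
have {}H : (1 - (b - a) / (c - a)) * tau a + (b - a) / (c - a) * tau c <= tau b.
  apply: H; [lra| |].
    by rewrite divr_ge0//; lra.
  by rewrite ler_pdivrMr//; lra.
have := ler_wpM2r (ltW ca) H.
rewrite [X in X <= _ -> _](_ : _ = (c - b) * tau a + (b - a) * tau c).
  by lra.
by field; rewrite gt_eqF.
Qed.

(** By concavity the chord slopes decrease as [a] increases to [v], so the infimum is the left
    derivative, which is finite at every [v > 0]. The value 0 for [v <= 0] lets integrals over the
    whole line see only positive masses. *)
Definition left_slope {R : realType} (tau : R -> R) (v : R) : R :=
  if 0 < v then inf [set (tau v - tau a) / (v - a) | a in `[0, v[] else 0.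

Lemma left_slope_le (R : realType) (tau : R -> R) (a b : R) :
  admissible_cost tau -> 0 <= a -> a < b ->
  left_slope tau b * (b - a) <= tau b - tau a.
Proof.
move=> [_ _ nd _ _] a0 ab; rewrite /left_slope (le_lt_trans a0 ab).
rewrite -ler_pdivlMr ?subr_gt0//; apply: ge_inf.
  exists 0 => r [x /=]; rewrite in_itv/= => /andP[x0 xb] <-.
  by rewrite divr_ge0 ?subr_ge0 ?nd// ltW.
by exists a => //=; rewrite in_itv/= a0.
Qed.

(** Each chord slope to the left of [a] dominates the chord slope from [a] to [b], hence so does
    their infimum. *)
Lemma left_slope_ge (R : realType) (tau : R -> R) (a b : R) :
  admissible_cost tau -> 0 < a -> a < b ->
  tau b - tau a <= left_slope tau a * (b - a).
Proof.
move=> adm a0 ab; rewrite /left_slope a0.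
rewrite -ler_pdivrMr ?subr_gt0//; apply: lb_le_inf.
  by exists ((tau a - tau 0) / (a - 0)); exists 0 => //=; rewrite in_itv/= lexx.
move=> r [x /=]; rewrite in_itv/= => /andP[x0 xa] <-.
rewrite ler_pdivrMr ?subr_gt0// mulrAC ler_pdivlMr ?subr_gt0//.
exact: admissible_cost_three_slopes.
Qed.

Lemma left_slope_ge0 (R : realType) (tau : R -> R) (v : R) :
  admissible_cost tau -> 0 <= left_slope tau v.
Proof.
move=> [_ _ nd _ _]; rewrite /left_slope; case: ifPn => // v0.
apply: lb_le_inf.
  by exists ((tau v - tau 0) / (v - 0)); exists 0 => //=; rewrite in_itv/= lexx.
move=> r [x /=]; rewrite in_itv/= => /andP[x0 xa] <-.
by rewrite divr_ge0 ?subr_ge0 ?nd// ltW.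
Qed.

Lemma left_slope_npos (R : realType) (tau : R -> R) (v : R) :
  v <= 0 -> left_slope tau v = 0.
Proof. by move=> v0; rewrite /left_slope ltNge v0. Qed.

Lemma left_slope_nonincreasing (R : realType) (tau : R -> R) (a b : R) :
  admissible_cost tau -> 0 < a -> a <= b -> left_slope tau b <= left_slope tau a.
Proof.
move=> adm a0; rewrite le_eqVlt => /predU1P[->//|ab].
have ba : 0 < b - a by rewrite subr_gt0.
rewrite -(ler_pM2r ba).
by rewrite (le_trans (left_slope_le adm (ltW a0) ab)) ?left_slope_ge.
Qed.

(** Such a function is not monotone on the whole line, because it jumps up at 0; restricted to the
    positive half line, its superlevel sets are intervals. *)
Lemma measurable_nonincreasing_pos (R : realType) (f : R -> R) :
  (forall a b, 0 < a -> a <= b -> f b <= f a) ->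
  (forall a, a <= 0 -> f a = 0) -> measurable_fun [set: R] f.
Proof.
move=> f_ni f0.
have -> : f = f \_ `]0, +oo[.
  apply/funext => x; rewrite patchE; case: ifPn => //.
  by rewrite notin_setE/= in_itv/= andbT => /negP; rewrite -leNgt => /f0.
apply/(measurable_restrictT _ _).1 => //.
apply: (measurability (@RGenCInfty.G R)) => [|/= _ [_] [r] -> <-].
  exact: RGenCInfty.measurableE.
apply: is_interval_measurable => s t/= [].
rewrite !in_itv/= !andbT => s0 fs [t0 ft] u /andP[su ut].
have u0 : 0 < u by exact: lt_le_trans su.
by split; rewrite in_itv/= andbT// (le_trans ft)// f_ni.
Qed.

Lemma measurable_left_slope (R : realType) (tau : R -> R) :
  admissible_cost tau -> measurable_fun [set: R] (left_slope tau).
Proof.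
move=> adm; apply: measurable_nonincreasing_pos.
  by move=> a b; exact: left_slope_nonincreasing.
exact: left_slope_npos.
Qed.

(* Halving the interval halves the bound, and additivity lets one iterate. *)
Lemma additive_interval_eq0 (R : realType) (D : R -> R -> R) (f : R -> R) (a0 : R) :
  (forall a b c, a0 < a -> a <= b -> b <= c -> D a c = D a b + D b c) ->
  (forall a b, a0 < a -> a <= b -> `|D a b| <= (f a - f b) * (b - a)) ->
  forall a b, a0 < a -> a <= b -> D a b = 0.
Proof.
move=> add bnd a b aa0 ab.
have H n : forall x y, a0 < x -> x <= y ->
    `|D x y| <= (f x - f y) * (y - x) / 2 ^+ n.
  elim: n => [|n IH] {aa0 ab}{}a {}b aa0 ab; first by rewrite expr0 divr1 bnd.
  have am : a <= (a + b) / 2 by lra.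
  have mb : (a + b) / 2 <= b by lra.
  rewrite (add a ((a + b) / 2) b)//.
  apply: (le_trans (ler_normD _ _)).
  apply: (le_trans (lerD (IH _ _ aa0 am) (IH _ _ (lt_le_trans aa0 am) mb))).
  have n0 : (2 : R) ^+ n != 0 by rewrite expf_neq0.
  rewrite exprS le_eqVlt; apply/orP; left; apply/eqP; field.
  by rewrite n0.
apply/eqP; rewrite -normr_eq0; apply/eqP/le_anti; rewrite normr_ge0 andbT.
apply/ler_addgt0Pr => e e0; rewrite add0r.
set K := (f a - f b) * (b - a).
have K0 : 0 <= K by apply: le_trans (bnd _ _ aa0 ab).
(* With [n] the integer part of [K / e], one has [K / e <= n + 1 <= 2 ^ n]. *)
apply: (le_trans (H (Num.Def.truncn (K / e)) _ _ aa0 ab)).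
rewrite ler_pdivrMr ?exprn_gt0// -ler_pdivrMl// mulrC.
have /andP[_ /ltW] : (Num.Def.truncn (K / e))%:R <= K / e < (Num.Def.truncn (K / e)).+1%:R.
  by apply: truncn_itv; rewrite divr_ge0// ltW.
move=> /le_trans; apply.
by rewrite -natrX ler_nat ltn_expl.
Qed.

(** By monotonicity and the two chord bounds, the integral over []x, y]] and [tau y - tau x] both
    lie between [t y * (y - x)] and [t x * (y - x)]. Their difference is additive over intervals and
    small on short ones, so it vanishes. *)
Lemma integral_left_slope_oc (R : realType) (tau : R -> R) (a b : R) :
  admissible_cost tau -> 0 < a -> a <= b ->
  (\int[mu]_(v in `]a, b]) (left_slope tau v)%:E = (tau b - tau a)%:E)%E.
Proof.
move=> adm a0 ab; set t := left_slope tau.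
have mt := measurable_left_slope adm.
have tE D : measurable D -> measurable_fun D (EFin \o t).
  by move=> mD; apply/measurable_EFinP; apply: measurable_funTS.
pose I x y := (\int[mu]_(v in `]x, y]) (t v)%:E)%E.
have I0 x y : (0 <= I x y)%E.
  by apply: integral_ge0 => v _; rewrite lee_fin left_slope_ge0.
have cst x y (k : R) : x <= y ->
    (\int[mu]_(v in `]x, y]) k%:E = (k * (y - x))%:E)%E.
  move=> xy; rewrite integral_cst//= lebesgue_measure_itv/= lte_fin EFinM.
  case: ltP => // yx.
  have -> : y = x by apply: le_anti; rewrite xy yx.
  by rewrite subrr mule0.
have Iub x y : 0 < x -> x <= y -> (I x y <= (t x * (y - x))%:E)%E.
  move=> x0 xy; rewrite -cst//; apply: ge0_le_integral => //.
  - by move=> v _; rewrite lee_fin left_slope_ge0.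
  - exact: tE.
  - move=> v /=; rewrite in_itv/= => /andP[xv _].
    by rewrite lee_fin left_slope_nonincreasing// ltW.
have Ilb x y : 0 < x -> x <= y -> ((t y * (y - x))%:E <= I x y)%E.
  move=> x0 xy; rewrite -cst//; apply: ge0_le_integral => //.
  - by move=> v _; rewrite lee_fin left_slope_ge0.
  - exact: tE.
  - move=> v /=; rewrite in_itv/= => /andP[xv vy].
    by rewrite lee_fin left_slope_nonincreasing// (lt_trans x0).
have If x y : 0 < x -> x <= y -> I x y \is a fin_num.
  by move=> x0 xy; rewrite ge0_fin_numE// (le_lt_trans (Iub _ _ x0 xy))// ltry.
have Iadd x y w : 0 < x -> x <= y -> y <= w -> (I x w = I x y + I y w)%E.
  move=> x0 xy yw; rewrite /I -ge0_integral_setU//=.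
  - by congr (integral _ _ _); rewrite -itv_bndbnd_setU.
  - exact: tE (measurableU _ _ _ _).
  - by move=> v _; rewrite lee_fin left_slope_ge0.
  - apply/disj_setPS => v [/=]; rewrite !in_itv/= => /andP[_ vy] /andP[yv _].
    by move: (le_lt_trans vy yv); rewrite ltxx.
have := @additive_interval_eq0 R (fun x y => tau y - tau x - fine (I x y)) t 0.
move=> /(_ _ _ a b a0 ab) H.
rewrite -/(I a b) -(fineK (If _ _ a0 ab)); congr EFin; apply/esym/eqP.
rewrite -subr_eq0; apply/eqP/H.
  move=> x y w x0 xy yw; rewrite (Iadd x y w)// fineD ?If//; first lra.
  exact: lt_le_trans xy.
move=> x y x0; rewrite le_eqVlt => /predU1P[->|xy].
  by rewrite !subrr sub0r normrN /I set_itvoc0// integral_set0 normr0 mulr0.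
have xy' := ltW xy.
have := Iub _ _ x0 xy'; have := Ilb _ _ x0 xy'.
rewrite -(fineK (If _ _ x0 xy')) !lee_fin.
have := left_slope_le adm (ltW x0) xy; have := left_slope_ge adm x0 xy.
rewrite -/t ler_norml; move: (fine (I x y)) => q H1 H2 H3 H4.
by apply/andP; split; rewrite /=; lra.
Qed.

(** The slope may be unbounded near 0, so []0, w]] is exhausted by []w / (n + 1), w]]; the
    continuity of [tau] at 0 identifies the limit. *)
Lemma integral_left_slope (R : realType) (tau : R -> R) (w : R) :
  admissible_cost tau -> 0 <= w ->
  (\int[mu]_(v in `]0%R, w]) (left_slope tau v)%:E = (tau w)%:E)%E.
Proof.
move=> adm; rewrite le_eqVlt => /predU1P[<-|w0].
  by rewrite set_itvoc0// integral_set0; case: adm => ->.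
have mt := measurable_left_slope adm.
pose F (n : nat) : set R := `]w / n.+1%:R, w]%classic.
have FU : \bigcup_n F n = `]0, w]%classic.
  apply/seteqP; split => x.
    move=> [n _]; rewrite /F/= !in_itv/= => /andP[+ ->]; rewrite andbT.
    by apply: le_lt_trans; rewrite divr_ge0// ltW.
  rewrite /= in_itv/= => /andP[x0 xw].
  exists (Num.Def.truncn (w / x)) => //; rewrite /F/= in_itv/= xw andbT.
  rewrite ltr_pdivrMr// -ltr_pdivrMl// mulrC.
  have wx : 0 <= w / x by rewrite divr_ge0// ltW.
  by have /andP[] := truncn_itv wx.
have cv : (\int[mu]_(v in F n) (left_slope tau v)%:E @[n --> \oo] -->
   \int[mu]_(v in `]0%R, w]) (left_slope tau v)%:E)%E.
  rewrite -FU; apply: ge0_nondecreasing_set_cvg_integral.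
  - apply/nondecreasing_seqP => n; rewrite subsetEset => x.
    rewrite /F/= !in_itv/= => /andP[+ ->]; rewrite andbT; apply: le_lt_trans.
    by rewrite ler_pM2l// lef_pV2 ?posrE// ler_nat.
  - by move=> n; exact: measurable_itv.
  - by move=> n; apply/measurable_EFinP; apply: measurable_funTS.
  - by move=> n x _; rewrite lee_fin left_slope_ge0.
rewrite -(cvg_lim _ cv)//.
have E n : (\int[mu]_(v in F n) (left_slope tau v)%:E = (tau w - tau (w / n.+1%:R))%:E)%E.
  rewrite integral_left_slope_oc ?divr_gt0// ler_pdivrMr//.
  by rewrite -[leLHS]mulr1 ler_pM2l// ler1n.
under eq_fun do rewrite E.
apply/cvg_lim => //; apply/cvg_EFin; first exact: nearW.
rewrite [X in _ --> X](_ : _ = tau w - tau 0); last first.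
  by case: adm => -> *; rewrite subr0.
apply: cvgB; first exact: cvg_cst.
have [_ _ _ _ cont] := adm.
move/continuous_within_itvcyP : cont => [_ c0].
apply: (cvg_at_rightP _ _ _).1 c0 _ _ => //.
split; first by move=> n; rewrite divr_gt0.
rewrite -[X in _ --> X](mulr0 w); apply: cvgM; first exact: cvg_cst.
exact: cvg_harmonic.
Qed.

(** * Abel inversion *)

Lemma set_sqr_lt (R : realType) (x : R) :
  [set r : R | r ^+ 2 < x] = `]- Num.sqrt x, Num.sqrt x[%classic.
Proof.
apply/seteqP; split => r /=; rewrite in_itv/= -ltr_norml.
  move=> rx; rewrite -sqrtr_sqr ltr_sqrt//.
  by apply: le_lt_trans rx; exact: sqr_ge0.
rewrite -sqrtr_sqr => h; rewrite -ltr_sqrt//.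
by rewrite -sqrtr_gt0; apply: le_lt_trans h; exact: sqrtr_ge0.
Qed.

(** Valid for negative [x] too: the set is then empty and [Num.sqrt] vanishes. This convention
    encodes every positive part under a square root below. *)
Lemma layer_cake_sqrt (R : realType) (x : R) :
  (\int[mu]_r (\1_[set r : R | (r ^+ 2 < x)%R] r)%:E = (2 * Num.sqrt x)%:E)%E.
Proof.
rewrite integral_indic//; last by rewrite set_sqr_lt; exact: measurable_itv.
rewrite setIT set_sqr_lt/= lebesgue_measure_itv/= lte_fin.
have s0 := sqrtr_ge0 x.
case: ltP => h; first by rewrite -EFinD; congr EFin; lra.
by congr EFin; lra.
Qed.

(** The number pi / 2. It normalises [abel_level], hence the positivity shown below. *)
Definition semicircle_area {R : realType} : R :=
  fine (\int[mu]_(r in `[(-1)%R, 1%R]) (Num.sqrt (1 - r ^+ 2) : R)%:E)%E.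

Lemma continuous_sqrt_sub_sqr (R : realType) (X : R) :
  continuous (fun r : R => Num.sqrt (X - r ^+ 2)).
Proof.
move=> r; apply: (@continuous_comp R R R (fun r => X - r ^+ 2) (@Num.sqrt R)).
  by apply: cvgB; [exact: cvg_cst|exact: exprn_continuous].
exact: sqrt_continuous.
Qed.

Lemma measurable_EFin_sqrt (R : realType) (D : set R) :
  measurable_fun D (fun r : R => (Num.sqrt r)%:E).
Proof.
apply/measurable_EFinP; apply: measurable_funTS; apply: continuous_measurable_fun.
exact: sqrt_continuous.
Qed.

Lemma measurable_EFin_sqrt_sub_sqr (R : realType) (X : R) (D : set R) :
  measurable_fun D (fun r : R => (Num.sqrt (X - r ^+ 2))%:E).
Proof.
apply/measurable_EFinP; apply: measurable_funTS; apply: continuous_measurable_fun.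
exact: continuous_sqrt_sub_sqr.
Qed.

Lemma semicircle_areaE (R : realType) :
  (\int[mu]_(r in `[(-1)%R, 1%R]) (Num.sqrt (1 - r ^+ 2) : R)%:E =
   (@semicircle_area R)%:E)%E.
Proof.
rewrite /semicircle_area fineK//; apply: integrable_fin_num => //.
apply: continuous_compact_integrable; first exact: segment_compact.
apply: continuous_subspaceT; exact: continuous_sqrt_sub_sqr.
Qed.

Lemma semicircle_area_gt0 (R : realType) : 0 < @semicircle_area R.
Proof.
(* The square of side 1/2 over [[0, 1/2]] fits under the half circle. *)
have h : (((2^-1)%R * (2^-1)%R)%:E <= \int[mu]_(r in `[(-1)%R, 1%R]) (Num.sqrt (1 - r ^+ 2) : R)%:E)%E.
  apply: (@le_trans _ _ (\int[mu]_(r in `[0%R, 2^-1%R]) (2^-1 : R)%:E)%E).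
    rewrite integral_cst//= lebesgue_measure_itv/= lte_fin ifT ?invr_gt0//.
    by rewrite -EFinD subr0 -EFinM.
  apply: (@le_trans _ _ (\int[mu]_(r in `[0%R, 2^-1%R]) (Num.sqrt (1 - r ^+ 2) : R)%:E)%E).
    apply: ge0_le_integral => //.
    - exact: measurable_EFin_sqrt_sub_sqr.
    - move=> r /=; rewrite in_itv/= => /andP[r0 r1]; rewrite lee_fin.
      rewrite -[leLHS]ger0_norm ?invr_ge0// -sqrtr_sqr ler_wsqrtr//.
      have : r ^+ 2 <= 2^-1 ^+ 2 by rewrite ler_pXn2r ?nnegrE.
      by rewrite !expr2; lra.
  apply: ge0_subset_integral => //.
  - exact: measurable_EFin_sqrt_sub_sqr.
  - move=> r /=; rewrite !in_itv/= => /andP[r0 r1]; apply/andP; split; lra.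
by move: h; rewrite semicircle_areaE lee_fin; apply: lt_le_trans; lra.
Qed.

(** Scaling by [sqrt X] stretches both width and height of the unit half disc, so its area is
    multiplied by [X]. *)
Lemma integral_semicircle (R : realType) (X : R) :
  (\int[mu]_r (Num.sqrt (X - r ^+ 2))%:E = (semicircle_area * Num.max X 0)%:E)%E.
Proof.
have [X0|X0] := leP X 0.
  rewrite mulr0; apply: integral0_eq => r _.
  by rewrite ler0_sqrtr// lerBlDr add0r (le_trans X0) ?sqr_ge0.
set s := Num.sqrt X; have s0 : 0 < s by rewrite sqrtr_gt0.
have sX : s ^+ 2 = X by rewrite sqr_sqrtr// ltW.
have -> : (\int[mu]_r (Num.sqrt (X - r ^+ 2))%:E =
    \int[mu]_(r in `[(s * (-1))%R, (s * 1)%R]) (Num.sqrt (X - r ^+ 2))%:E)%E.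
  rewrite [RHS]integral_mkcond; apply: eq_integral => r _.
  rewrite patchE; case: ifPn => //; rewrite notin_setE/= in_itv/= mulrN1 mulr1 -ler_norml.
  move=> /negP; rewrite -ltNge => sr; rewrite ler0_sqrtr//.
  rewrite subr_le0 -sX -[r ^+ 2]real_normK ?num_real//.
  by rewrite ler_pXn2r ?nnegrE ?(ltW s0)// ltW.
have D (x : R) : is_derive x 1 (fun x : R => s * x) s.
  by apply: is_derive_eq; rewrite /GRing.scale/= mulr1.
have DE : derive1 (fun x : R => s * x) = cst s.
  by apply/funext => x; rewrite derive1E; exact: derive_val.
have cs : continuous (fun x : R => s * x).
  by move=> x; apply: cvgM; [exact: cvg_cst|exact: cvg_id].
rewrite (@integration_by_substitution_increasing R (fun x => s * x)); first last.
- apply: continuous_subspaceT; exact: continuous_sqrt_sub_sqr.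
- split; first by move=> x _; exact: ex_derive.
  + by apply: cvg_at_right_filter; exact: cs.
  + by apply: cvg_at_left_filter; exact: cs.
- by rewrite DE; apply: is_cvg_cst.
- by rewrite DE; apply: is_cvg_cst.
- by rewrite DE => x _; exact: cvg_cst.
- by move=> x y _ _ xy; rewrite ltr_pM2l.
- lra.
rewrite [semicircle_area * X]mulrC EFinM -semicircle_areaE -ge0_integralZl//; first last.
- by rewrite lee_fin ltW.
- exact: measurable_EFin_sqrt_sub_sqr.
apply: eq_integral => r _; rewrite -EFinM; congr EFin.
rewrite !fctE/= DE/= -sX exprMn -[X in X - _]mulr1 -mulrBr sqrtrM ?sqr_ge0//.
by rewrite sqrtr_sqr gtr0_norm// expr2; ring.
Qed.

Definition sqrt_primitive {R : realType} (x : R) : R := 2 / 3 * (x * Num.sqrt x).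

Lemma continuous_sqrt_primitive (R : realType) : continuous (@sqrt_primitive R).
Proof.
move=> x; apply: cvgM; first exact: cvg_cst.
by apply: cvgM; [exact: cvg_id|exact: sqrt_continuous].
Qed.

Lemma sqrt_primitive_gt0 (R : realType) (x : R) : 0 < x -> 0 < sqrt_primitive x.
Proof. by move=> x0; rewrite /sqrt_primitive !mulr_gt0 ?sqrtr_gt0 ?invr_gt0. Qed.

Lemma ltr_sqrt_primitive (R : realType) (x y : R) :
  0 <= x -> x < y -> sqrt_primitive x < sqrt_primitive y.
Proof.
move=> x0 xy; have y0 := le_lt_trans x0 xy.
rewrite /sqrt_primitive ltr_pM2l; last by lra.
apply: (@le_lt_trans _ _ (x * Num.sqrt y)); last by rewrite ltr_pM2r ?sqrtr_gt0.
by rewrite ler_wpM2l// ler_wsqrtr// ltW.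
Qed.

Lemma integral_sqrt (R : realType) (b : R) : 0 <= b ->
  (\int[mu]_(x in `]0%R, b[) (Num.sqrt x)%:E = (sqrt_primitive b)%:E)%E.
Proof.
rewrite le_eqVlt => /predU1P[<-|b0].
  by rewrite set_itvoo0// integral_set0 /sqrt_primitive mul0r mulr0.
have mS : measurable_fun `]0, b[ (EFin \o @Num.sqrt R).
  exact: measurable_EFin_sqrt.
rewrite integral_itv_bndo_bndc//.
rewrite integral_itv_obnd_cbnd//; last first.
  exact: measurable_EFin_sqrt.
rewrite (@continuous_FTC2 R _ sqrt_primitive)//.
- by rewrite {2}/sqrt_primitive mul0r mulr0 sube0.
- by apply: continuous_subspaceT; exact: sqrt_continuous.
- split.
  + move=> x; rewrite in_itv/= => /andP[x0 xb]; apply: derivableM => //.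
    by apply: derivableM => //; apply: ex_derive; exact: is_derive1_sqrt.
  + by apply: cvg_at_right_filter; exact: continuous_sqrt_primitive.
  + by apply: cvg_at_left_filter; exact: continuous_sqrt_primitive.
- move=> x; rewrite in_itv/= => /andP[x0 xb].
  have h := is_derive1_sqrt x0.
  have h2 : is_derive x 1 (@sqrt_primitive R) (2 / 3 * (x * (2 * Num.sqrt x)^-1 + Num.sqrt x)).
    have h1 : is_derive x 1 (fun x : R => x * Num.sqrt x) (x * (2 * Num.sqrt x)^-1 + Num.sqrt x).
      by apply: is_derive_eq; rewrite /GRing.scale/= mulr1.
    exact: (is_deriveZ (f := fun x : R => x * Num.sqrt x) (2 / 3)).
  rewrite derive1E (derive_val (is_derive := h2)).
  have sx : 0 < Num.sqrt x by rewrite sqrtr_gt0.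
  rewrite -{1}[x]sqr_sqrtr ?ltW//; field.
  by rewrite gt_eqF.
Qed.

Lemma sqrt_primitive_surj (R : realType) (y : R) : 0 <= y ->
  exists2 b : R, 0 <= b & sqrt_primitive b = y.
Proof.
move=> y0.
have h1 : 1 <= y * 2 + 1 by lra.
(* At [2 y + 1 >= 1] the square root is at least 1, so the primitive is at least
   [2 / 3 * (2 y + 1) >= y]. *)
have h : y <= sqrt_primitive (y * 2 + 1).
  rewrite /sqrt_primitive.
  have s1 : 1 <= Num.sqrt (y * 2 + 1) by rewrite -[leLHS]sqrtr1 ler_wsqrtr.
  nra.
have [|||b] := @IVT R sqrt_primitive 0 (y * 2 + 1) y.
- lra.
- by apply: continuous_subspaceT; exact: continuous_sqrt_primitive.
- rewrite {1 2}/sqrt_primitive mul0r mulr0.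
  by rewrite ge_min y0/= le_max h orbT.
- by rewrite in_itv/= => /andP[b0 _] <-; exists b.
Qed.

(** The substitution u = [sqrt_primitive x] turns sqrt x dx into du. The value [+oo] of [Y] is
    included because [abel_level] can be infinite, for instance below the slope of a linear cost. *)
Lemma integral_sqrt_sublevel (R : realType) (Y : \bar R) : (0 <= Y)%E ->
  (\int[mu]_(x in [set x : R | (0 < x)%R /\ (sqrt_primitive x)%:E < Y]) (Num.sqrt x)%:E
   = Y)%E.
Proof.
have sub0 (r : R) : 0 <= r ->
   (\int[mu]_(x in [set x : R | (0 < x)%R /\ (sqrt_primitive x < r)%R]) (Num.sqrt x)%:E = r%:E)%E.
  move=> /sqrt_primitive_surj[b b0 <-]; rewrite -integral_sqrt//.
  congr (integral _ _ _); apply/seteqP; split => x /=; rewrite in_itv/=.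
    move=> [x0 xb]; rewrite x0/= ltNge; apply/negP.
    rewrite le_eqVlt => /predU1P[bx|bx]; first by rewrite bx ltxx in xb.
    by move: (lt_trans xb (ltr_sqrt_primitive b0 bx)); rewrite ltxx.
  by move=> /andP[x0 xb]; split=> //; apply: ltr_sqrt_primitive => //; exact: ltW.
case: Y => [r|_|//].
  rewrite lee_fin => r0; rewrite -[RHS]sub0//.
apply/eqyP => M M0.
rewrite -(sub0 M (ltW M0)); apply: ge0_subset_integral => //.
- rewrite (_ : mkset _ = `]0, +oo[ `&` (@sqrt_primitive R @^-1` `]-oo, M[)).
    apply: measurableI => //; rewrite -[X in measurable X]setTI.
    by apply: (continuous_measurable_fun (@continuous_sqrt_primitive R)).
  by apply/seteqP; split => x /=; rewrite !in_itv/= andbT.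
- rewrite (_ : mkset _ = `]0, +oo[%classic)//.
  by apply/seteqP; split => x /=; rewrite !in_itv/= andbT ?ltry// => -[].
- exact: measurable_EFin_sqrt.
- by move=> x /= [x0 _]; rewrite ltry.
Qed.

(* The p-length of {z > x} is read off from abel_level tau x = 2/3 p^(3/2), the
   inverse Abel transform of tau'; the half discs contribute the constant. *)
Definition abel_level {R : realType} (tau : R -> R) (x : R) : \bar R :=
  (((Num.sqrt 2 * semicircle_area)^-1)%:E *
     \int[mu]_v (Num.sqrt (left_slope tau v - x))%:E)%E.

Lemma abel_level_const_gt0 (R : realType) :
  0 < (Num.sqrt 2 * semicircle_area)^-1 :> R.
Proof. by rewrite invr_gt0 mulr_gt0 ?semicircle_area_gt0 ?sqrtr_gt0. Qed.

Lemma measurable_sqrt_left_slope (R : realType) (tau : R -> R) (x : R) (D : set R) :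
  admissible_cost tau ->
  measurable_fun D (fun v => (Num.sqrt (left_slope tau v - x))%:E).
Proof.
move=> adm; apply/measurable_EFinP; apply: measurable_funTS.
apply: (@measurableT_comp _ _ _ _ _ _ (@Num.sqrt R)).
  by apply: continuous_measurable_fun; exact: sqrt_continuous.
by apply: measurable_funB => //; exact: measurable_left_slope.
Qed.

Lemma abel_level_ge0 (R : realType) (tau : R -> R) (x : R) : (0 <= abel_level tau x)%E.
Proof.
apply: mule_ge0; first by rewrite lee_fin ltW// abel_level_const_gt0.
by apply: integral_ge0 => v _; rewrite lee_fin sqrtr_ge0.
Qed.

Lemma abel_level_nonincreasing (R : realType) (tau : R -> R) (x y : R) :
  admissible_cost tau -> x <= y -> (abel_level tau y <= abel_level tau x)%E.
Proof.
move=> adm xy; apply: lee_wpmul2l; first by rewrite lee_fin ltW// abel_level_const_gt0.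
apply: ge0_le_integral => //.
- exact: measurable_sqrt_left_slope.
- exact: measurable_sqrt_left_slope.
- by move=> v _; rewrite lee_fin ler_wsqrtr// lerB.
Qed.

(** Monotone convergence along [a + 1 / (n + 1)]. This is what makes the infimum in [specific_cost]
    attained. *)
Lemma abel_level_right_continuous (R : realType) (tau : R -> R) (a : R) (y : \bar R) :
  admissible_cost tau -> (forall x, a < x -> (abel_level tau x <= y)%E) ->
  (abel_level tau a <= y)%E.
Proof.
move=> adm ub.
have cv : (\int[mu]_v (Num.sqrt (left_slope tau v - (a + n.+1%:R^-1)))%:E @[n --> \oo] -->
    \int[mu]_v (Num.sqrt (left_slope tau v - a))%:E)%E.
  under [X in _ --> X]eq_integral => v _.
    rewrite (_ : (Num.sqrt (left_slope tau v - a))%:E =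
       limn (fun n => (Num.sqrt (left_slope tau v - (a + n.+1%:R^-1)))%:E)).
      over.
    apply/esym/cvg_lim => //; apply/cvg_EFin; first exact: nearW.
    apply: (@continuous_cvg _ _ _ _ _ _ (@Num.sqrt R)); first exact: sqrt_continuous.
    apply: cvgB; first exact: cvg_cst.
    rewrite -[X in _ --> X]addr0; apply: cvgD; first exact: cvg_cst.
    exact: cvg_harmonic.
  apply: cvg_monotone_convergence => //.
  - by move=> n; exact: measurable_sqrt_left_slope.
  - move=> v _ m n mn; rewrite lee_fin ler_wsqrtr// lerB// lerD2l.
    by rewrite lef_pV2 ?posrE// ler_nat.
have cv' := cvgeZl (erefl (((Num.sqrt 2 * semicircle_area)^-1)%:E \is a fin_num)) cv.
apply: (cvge_le _ cv'); apply: nearW => n.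
by apply: ub; rewrite ltrDl invr_gt0.
Qed.

(** Guarantees that [specific_cost] takes the infimum of a nonempty set. For [x = left_slope tau s]
    the integrand lives on []0, s]], and [sqrt y <= 1 + y] bounds its integral by [s + tau s], which
    tends to 0 with [s]. *)
Lemma abel_level_small (R : realType) (tau : R -> R) (e : R) :
  admissible_cost tau -> 0 < e -> exists2 x, 0 <= x & (abel_level tau x <= e%:E)%E.
Proof.
move=> adm e0; set C : R := (Num.sqrt 2 * semicircle_area)^-1.
have C0 : 0 < C by exact: abel_level_const_gt0.
have [s s0 sE] : exists2 s, 0 < s & s + tau s <= e / C.
  have [t0 _ _ _ cont] := adm.
  move/continuous_within_itvcyP : cont => [_ c0].
  have : (fun s => s + tau s) x @[x --> 0^'+] --> (0 + tau 0).
    by apply: cvgD => //; apply: cvg_at_right_filter; exact: cvg_id.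
  rewrite t0 addr0 => /cvgr_le /(_ (e / C)).
  rewrite divr_gt0// => /(_ isT) H.
  near (0 : R)^'+ => s; exists s => //.
  by near: s.
exists (left_slope tau s); first exact: left_slope_ge0.
rewrite /abel_level -/C.
have mt := measurable_left_slope adm.
apply: (@le_trans _ _ (C%:E * \int[mu]_(v in `]0%R, s]) (1 + left_slope tau v)%:E)%E).
  rewrite lee_wpmul2l ?lee_fin ?(ltW C0)// [leRHS]integral_mkcond.
  apply: ge0_le_integral => //.
  - exact: measurable_sqrt_left_slope.
  - apply/(measurable_restrictT _ _).1 => //.
    by apply/measurable_EFinP; apply: measurable_funD => //; apply: measurable_funTS.
  - move=> v _; rewrite patchE; case: ifPn.
      rewrite inE/= in_itv/= => /andP[v0 vs]; rewrite lee_fin.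
      have h : 0 <= left_slope tau v - left_slope tau s.
        by rewrite subr_ge0 left_slope_nonincreasing.
      have := left_slope_ge0 s adm.
      have := sqr_sqrtr h; have := sqrtr_ge0 (left_slope tau v - left_slope tau s).
      move: (Num.sqrt _) => q; nra.
    rewrite notin_setE/= in_itv/= => /negP; rewrite negb_and -leNgt -ltNge => /orP[v0|sv].
      by rewrite left_slope_npos// ler0_sqrtr// sub0r oppr_le0 left_slope_ge0.
    rewrite ler0_sqrtr// subr_le0; apply: left_slope_nonincreasing => //.
    exact: ltW.
have -> : (\int[mu]_(v in `]0%R, s]) (1 + left_slope tau v)%:E = (s + tau s)%:E)%E.
  under eq_integral do rewrite EFinD.
  rewrite ge0_integralD//.
  - rewrite integral_left_slope// ?ltW// integral_cst//= lebesgue_measure_itv/= lte_fin s0.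
    by rewrite mul1e -EFinD subr0.
  - by move=> v _; rewrite lee_fin left_slope_ge0.
  - by apply/measurable_EFinP; apply: measurable_funTS.
by rewrite -EFinM lee_fin -ler_pdivlMl// mulrC.
Unshelve. all: by end_near. Qed.

(** The generalised inverse of the level lengths: the least [x] for which the superlevel set of
    height [x] does not reach beyond [p]. Taking an infimum copes with jumps, flat pieces and
    infinite values of [abel_level]. *)
Definition specific_cost {R : realType} (tau : R -> R) (p : R) : R :=
  if 0 < p then inf [set x | 0 <= x /\ (abel_level tau x <= (sqrt_primitive p)%:E)%E]
  else 0.

Lemma specific_cost_npos (R : realType) (tau : R -> R) (p : R) :
  p <= 0 -> specific_cost tau p = 0.
Proof. by move=> p0; rewrite /specific_cost ltNge p0. Qed.

Lemma specific_cost_ge0 (R : realType) (tau : R -> R) (p : R) :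
  admissible_cost tau -> 0 <= specific_cost tau p.
Proof.
move=> adm; rewrite /specific_cost; case: ifPn => // p0.
have [x x0 xp] := abel_level_small adm (sqrt_primitive_gt0 p0).
by apply: lb_le_inf; [exists x|move=> y []].
Qed.

(** A Galois connection: right continuity of [abel_level] puts the infimum itself into the set.
    Monotonicity, lower semicontinuity and the superlevel sets of the specific cost are all read off
    from it. *)
Lemma specific_cost_le (R : realType) (tau : R -> R) (p a : R) :
  admissible_cost tau -> 0 < p -> 0 <= a ->
  (specific_cost tau p <= a) = (abel_level tau a <= (sqrt_primitive p)%:E)%E.
Proof.
move=> adm p0 a0; rewrite /specific_cost p0.
have [x x0 xp] := abel_level_small adm (sqrt_primitive_gt0 p0).
apply/idP/idP => [za|h]; last by apply: ge_inf => //; exists 0 => y [].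
apply: abel_level_right_continuous => // y ay.
have [|w [w0 wp] wy] := @inf_lt R _ y _ (le_lt_trans za ay).
  by exists x.
by apply: le_trans wp; apply: abel_level_nonincreasing => //; exact: ltW.
Qed.

Lemma specific_cost_gt (R : realType) (tau : R -> R) (p a : R) :
  admissible_cost tau -> 0 < p -> 0 <= a ->
  (a < specific_cost tau p) = ((sqrt_primitive p)%:E < abel_level tau a)%E.
Proof. by move=> adm p0 a0; rewrite ltNge specific_cost_le// -ltNge. Qed.

Lemma specific_cost_nonincreasing (R : realType) (tau : R -> R) (p q : R) :
  admissible_cost tau -> 0 < p -> p <= q -> specific_cost tau q <= specific_cost tau p.
Proof.
move=> adm p0; rewrite le_eqVlt => /predU1P[->//|pq].
rewrite specific_cost_le ?specific_cost_ge0 ?(lt_trans p0)//.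
apply: (@le_trans _ _ (sqrt_primitive p)%:E).
  by rewrite -specific_cost_le ?specific_cost_ge0.
by rewrite lee_fin ltW// ltr_sqrt_primitive// ltW.
Qed.

Lemma measurable_specific_cost (R : realType) (tau : R -> R) :
  admissible_cost tau -> measurable_fun [set: R] (specific_cost tau).
Proof.
move=> adm; apply: measurable_nonincreasing_pos.
  by move=> a b; exact: specific_cost_nonincreasing.
exact: specific_cost_npos.
Qed.

(** For [a >= 0] the superlevel set consists of the [p > 0] with [sqrt_primitive p] strictly below
    the constant [abel_level tau a], which is an open condition. *)
Lemma specific_cost_lsc (R : realType) (tau : R -> R) :
  admissible_cost tau -> lsc_pos (specific_cost tau).
Proof.
move=> adm x x0 a ax; have [a0|a0] := ltP a 0.
  by near=> y => _; rewrite (lt_le_trans a0)// specific_cost_ge0.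
move: ax; rewrite specific_cost_gt// => h.
have H : \forall y \near x, ((sqrt_primitive y)%:E < abel_level tau a)%E.
  case: (abel_level tau a) h => [r| |//].
    rewrite lte_fin => xr; near=> y; rewrite lte_fin; near: y.
    by apply: (cvgr_lt (sqrt_primitive x)) => //; exact: continuous_sqrt_primitive.
  by move=> _; near=> y; rewrite ltry.
by near=> y => y0; rewrite specific_cost_gt//; near: y.
Unshelve. all: by end_near. Qed.

Lemma lebesgue_tonelli (R : realType) (f : R * R -> \bar R) :
  measurable_fun setT f -> (forall x, (0 <= f x)%E) ->
  (\int[mu]_x \int[mu]_y f (x, y) = \int[mu]_y \int[mu]_x f (x, y))%E.
Proof. by move=> mf f0; exact: fubini_tonelli. Qed.

Lemma measurable_fun_lebesgue_integral (R : realType) (f : R * R -> \bar R) :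
  measurable_fun setT f -> (forall x, (0 <= f x)%E) ->
  measurable_fun setT (fun x => \int[mu]_y f (x, y))%E.
Proof. by move=> mf f0; apply: measurable_fun_fubini_tonelli_F. Qed.

(* Abel's integral equation: both sides are mixtures of half discs, which are
   exchanged by Tonelli's theorem. *)
Lemma abel_inversion (R : realType) (tau : R -> R) (l : R) :
  admissible_cost tau -> 0 <= l ->
  (2%:E * \int[mu]_p (Num.sqrt p * Num.sqrt (2 * (specific_cost tau p - l)))%:E =
   \int[mu]_v (Num.max (left_slope tau v - l) 0)%:E)%E.
Proof.
move=> adm l0; set z := specific_cost tau; set t := left_slope tau.
have mz : measurable_fun setT z := measurable_specific_cost adm.
have mt : measurable_fun setT t := measurable_left_slope adm.
have msqrt : measurable_fun setT (@Num.sqrt R).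
  by apply: continuous_measurable_fun; exact: sqrt_continuous.
pose A := [set x : R * R | x.2 ^+ 2 < z x.1 - l].
have mA : measurable A.
  rewrite (_ : A = setT `&` (fun x : R * R => z x.1 - l - x.2 ^+ 2) @^-1` `]0, +oo[).
    have mf : measurable_fun setT (fun x : R * R => z x.1 - l - x.2 ^+ 2).
      apply: measurable_funB.
        by apply: measurable_funB => //; apply: measurableT_comp.
      by apply: measurable_funX; exact: measurable_snd.
    by apply: mf => //; exact: measurable_itv.
  by apply/seteqP; split => x /=; rewrite in_itv/= andbT subr_gt0// => -[].
pose f (x : R * R) := (Num.sqrt x.1 * \1_A x)%:E.
have mf : measurable_fun setT f.
  apply/measurable_EFinP; apply: measurable_funM.
    by apply: measurableT_comp => //; exact: measurable_fst.
  exact: measurable_indic.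
have f0 x : (0 <= f x)%E by rewrite lee_fin mulr_ge0 ?sqrtr_ge0.
have inner1 p : (\int[mu]_r f (p, r) = (Num.sqrt p * (2 * Num.sqrt (z p - l)))%:E)%E.
  rewrite EFinM -layer_cake_sqrt -ge0_integralZl//.
  apply/measurable_EFinP; apply: measurable_indic.
  by rewrite set_sqr_lt; exact: measurable_itv.
(* For fixed [r] the slice in [p] is the superlevel set of the specific cost at [l + r ^+ 2], whose
   length weighted by the square root is the Abel level by construction. *)
have inner2 r : (\int[mu]_p f (p, r) = abel_level tau (l + r ^+ 2))%E.
  have lr : 0 <= l + r ^+ 2 by rewrite addr_ge0 ?sqr_ge0.
  rewrite -[RHS]integral_sqrt_sublevel ?abel_level_ge0//.
  rewrite [RHS]integral_mkcond; apply: eq_integral => p _.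
  rewrite patchE /f /=; case: ifPn.
    rewrite inE/= => -[p0]; rewrite -specific_cost_gt// => h.
    by rewrite indicE mem_set ?mulr1//= /A/=; rewrite ltrBrDl.
  rewrite notin_setE/= => h; have [p0|p0] := leP p 0; first by rewrite ler0_sqrtr// mul0r.
  rewrite indicE memNset ?mulr0//= /A/= => h2; apply: h; split=> //.
  by rewrite -specific_cost_gt//; move: h2; rewrite ltrBrDl.
have step1 : (\int[mu]_p (Num.sqrt p * Num.sqrt (2 * (z p - l)))%:E =
    (Num.sqrt 2 / 2)%:E * \int[mu]_r abel_level tau (l + r ^+ 2))%E.
  transitivity ((Num.sqrt 2 / 2)%:E * \int[mu]_p \int[mu]_r f (p, r))%E; last first.
    by rewrite lebesgue_tonelli//; congr (_ * _)%E; apply: eq_integral => r _; exact: inner2.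
  under [X in (_ * X)%E]eq_integral do rewrite inner1.
  rewrite -ge0_integralZl//.
  - apply: eq_integral => p _; rewrite -EFinM; congr EFin.
    by rewrite sqrtrM//; field.
  - apply/measurable_EFinP; apply: measurable_funM => //.
    apply: measurable_funM => //; apply: measurableT_comp => //.
    exact: measurable_funB.
pose g (x : R * R) := (Num.sqrt (t x.2 - (l + x.1 ^+ 2)))%:E.
have mg : measurable_fun setT g.
  apply/measurable_EFinP; apply: measurableT_comp => //.
  apply: measurable_funB; first by apply: measurableT_comp.
  apply: measurable_funD => //.
  by apply: measurable_funX; exact: measurable_fst.
have g0 x : (0 <= g x)%E by rewrite lee_fin sqrtr_ge0.
have C0 := abel_level_const_gt0 R.
have mmax : measurable_fun setT (fun v => (Num.max (t v - l) 0)%:E).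
  apply/measurable_EFinP; apply: measurable_maxr => //.
  exact: measurable_funB.
have step2 : (\int[mu]_r abel_level tau (l + r ^+ 2) =
    (((Num.sqrt 2 * semicircle_area)^-1) * semicircle_area)%:E *
      \int[mu]_v (Num.max (t v - l) 0)%:E)%E.
  rewrite /abel_level ge0_integralZl//; first last.
  - by rewrite lee_fin ltW.
  - by move=> r _; apply: integral_ge0 => v _; exact: (g0 (r, v)).
  - exact: (measurable_fun_lebesgue_integral mg g0).
  rewrite (lebesgue_tonelli mg)// EFinM -muleA; congr (_ * _)%E.
  rewrite -ge0_integralZl//; first last.
  - by rewrite lee_fin ltW// semicircle_area_gt0.
  - by move=> v _; rewrite lee_fin le_max lexx orbT.
  apply: eq_integral => v _; rewrite -EFinM -integral_semicircle.
  by apply: eq_integral => r _; rewrite /g/= opprD addrA.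
(* Here the constant in [abel_level] is fixed: [2 * (sqrt 2 / 2) * (sqrt 2 * semicircle_area)^-1 *
   semicircle_area = 1]. *)
rewrite step1 step2 !muleA -!EFinM [X in X%:E](_ : _ = 1) ?mul1e//.
have k0 := semicircle_area_gt0 R; have s0 : 0 < Num.sqrt (2 : R) by rewrite sqrtr_gt0.
by field; rewrite !gt_eqF.
Qed.

(** * Bounds of the transport cost by the excess integral *)

(** The speed sqrt(2 p (z(p) - l)_+) at which an optimal profile with Lagrange multiplier [l] passes
    height [p]. The two separate roots make it vanish for [p <= 0] and allow one layer cake per
    factor. *)
Definition excess {R : realType} (tau : R -> R) (l p : R) : R :=
  Num.sqrt p * Num.sqrt (2 * (specific_cost tau p - l)).

Lemma excess_ge0 (R : realType) (tau : R -> R) (l p : R) : 0 <= excess tau l p.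
Proof. by rewrite /excess mulr_ge0 ?sqrtr_ge0. Qed.

Lemma measurable_excess (R : realType) (tau : R -> R) (l : R) :
  admissible_cost tau -> measurable_fun setT (excess tau l).
Proof.
move=> adm; have mz := measurable_specific_cost adm.
have msqrt : measurable_fun setT (@Num.sqrt R).
  by apply: continuous_measurable_fun; exact: sqrt_continuous.
apply: measurable_funM => //; apply: measurableT_comp => //.
by apply: measurable_funM => //; exact: measurable_funB.
Qed.

(** Integrate [t <= l + max (t - l) 0] over []0, w]], for t the left slope, and enlarge the domain
    of the last term to the whole line. *)
Lemma cost_le_excess (R : realType) (tau : R -> R) (l w : R) :
  admissible_cost tau -> 0 <= l -> 0 <= w ->
  ((tau w)%:E <= (l * w)%:E + 2%:E * \int[mu]_p (excess tau l p)%:E)%E.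
Proof.
move=> adm l0 w0; rewrite /excess abel_inversion// -integral_left_slope//.
have mt := measurable_left_slope adm.
have mm : measurable_fun setT (fun v => Num.max (left_slope tau v - l) 0).
  by apply: measurable_maxr => //; exact: measurable_funB.
apply: (@le_trans _ _ (\int[mu]_(v in `]0%R, w]) (l%:E + (Num.max (left_slope tau v - l) 0)%:E))%E).
  apply: ge0_le_integral => //.
  - by move=> v _; rewrite lee_fin left_slope_ge0.
  - by apply/measurable_EFinP; apply: measurable_funTS.
  - apply/measurable_EFinP; apply: measurable_funD => //.
    exact: measurable_funTS.
  - move=> v _; by rewrite -EFinD lee_fin -lerBlDl le_max lexx.
rewrite ge0_integralD//; first last.
- by apply/measurable_EFinP; apply: measurable_funTS.
- by move=> v _; rewrite lee_fin le_max lexx orbT.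
apply: leeD.
  rewrite integral_cst//= lebesgue_measure_itv/= lte_fin.
  case: ifPn => [_|]; first by rewrite -EFinD subr0.
  by rewrite -leNgt => w0'; rewrite mule0 lee_fin mulr_ge0.
apply: ge0_subset_integral => //.
- exact/measurable_EFinP.
- by move=> v _; rewrite lee_fin le_max lexx orbT.
Qed.

(** At [l = left_slope tau w] nothing is lost: by monotonicity the slope is at least [l] on []0, w]]
    and at most [l] elsewhere. As a by-product the excess integral is finite. *)
Lemma cost_ge_excess (R : realType) (tau : R -> R) (w : R) :
  admissible_cost tau -> 0 < w ->
  ((left_slope tau w * w)%:E + 2%:E * \int[mu]_p (excess tau (left_slope tau w) p)%:E
    <= (tau w)%:E)%E.
Proof.
move=> adm w0; have l0 := left_slope_ge0 w adm.
rewrite /excess abel_inversion// -(integral_left_slope adm (ltW w0)).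
have mt := measurable_left_slope adm; set l := left_slope tau w.
have mm : measurable_fun setT (fun v => Num.max (left_slope tau v - l) 0).
  by apply: measurable_maxr => //; exact: measurable_funB.
have -> : (\int[mu]_v (Num.max (left_slope tau v - l) 0)%:E =
    \int[mu]_(v in `]0%R, w]) (Num.max (left_slope tau v - l) 0)%:E)%E.
  rewrite [RHS]integral_mkcond; apply: eq_integral => v _; rewrite patchE.
  case: ifPn => //; rewrite notin_setE/= in_itv/= => /negP.
  rewrite negb_and -leNgt -ltNge => /orP[v0|wv].
    by rewrite left_slope_npos// max_r// sub0r oppr_le0.
  by rewrite max_r// subr_le0 left_slope_nonincreasing// ltW.
have -> : ((l * w)%:E = \int[mu]_(v in `]0%R, w]) l%:E)%E.
  by rewrite integral_cst//= lebesgue_measure_itv/= lte_fin w0 -EFinD subr0.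
rewrite -ge0_integralD//.
- apply: ge0_le_integral => //.
  + by move=> v _; rewrite -EFinD lee_fin addr_ge0// le_max lexx orbT.
  + apply/measurable_EFinP; apply: measurable_funD => //.
    exact: measurable_funTS.
  + by apply/measurable_EFinP; apply: measurable_funTS.
  + move=> v /=; rewrite in_itv/= => /andP[v0 vw]; rewrite -EFinD lee_fin max_l; first lra.
    by rewrite subr_ge0 left_slope_nonincreasing.
- by move=> v _; rewrite lee_fin le_max lexx orbT.
- by apply/measurable_EFinP; apply: measurable_funTS.
Qed.

(** * Smooth test functions and weak derivatives *)

(** Differentiates the function first and recurses on its derivative, so that the sum, product,
    quotient and chain rules go through by induction on [n] for all functions at once. *)
Fixpoint n_derivable {R : realType} (n : nat) (f : R -> R) : Prop :=
  if n is m.+1 then (forall x, derivable f x 1) /\ n_derivable m (derive1 f) else True.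

Lemma n_derivableS (R : realType) (n : nat) (f : R -> R) :
  n_derivable n.+1 f -> n_derivable n f.
Proof.
elim: n f => [//|n IH] f [df dnf]; split=> //.
exact: IH.
Qed.

Lemma n_derivable_derive1n (R : realType) (f : R -> R) :
  (forall n, n_derivable n f) -> forall n x, derivable (derive1n n f) x 1.
Proof.
move=> + n; elim: n f => [|n IH] f df x.
  by rewrite derive1n0; apply: (df 1%N).1.
by rewrite derive1Sn; apply: IH => m; exact: (df m.+1).2.
Qed.

Lemma n_derivableD (R : realType) (n : nat) (f g : R -> R) :
  n_derivable n f -> n_derivable n g -> n_derivable n (fun x => f x + g x).
Proof.
elim: n f g => [//|n IH] f g [df nf] [dg ng]; split.
  by move=> x; apply: derivableD.
rewrite [X in n_derivable _ X](_ : _ = fun x => (derive1 f) x + (derive1 g) x); first exact: IH.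
by apply/funext => x; rewrite !derive1E deriveD.
Qed.

Lemma n_derivableM (R : realType) (n : nat) (f g : R -> R) :
  n_derivable n f -> n_derivable n g -> n_derivable n (fun x => f x * g x).
Proof.
elim: n f g => [//|n IH] f g fn gn.
have fn1 := n_derivableS fn; have gn1 := n_derivableS gn.
move: fn gn => [df nf] [dg ng]; split.
  by move=> x; apply: derivableM.
rewrite [X in n_derivable _ X](_ : _ = fun x => f x * (derive1 g) x + g x * (derive1 f) x).
  by apply: n_derivableD; apply: IH.
by apply/funext => x; rewrite !derive1E deriveM.
Qed.

Lemma n_derivable_cst (R : realType) (n : nat) (k : R) : n_derivable n (fun=> k : R).
Proof.
elim: n k => [//|n IH] k; split; first by move=> x; exact: derivable_cst.
rewrite [X in n_derivable _ X](_ : _ = fun=> 0)//.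
by apply/funext => x; rewrite derive1E derive_cst.
Qed.

Lemma n_derivable_affine (R : realType) (n : nat) (f : R -> R) (a b : R) :
  n_derivable n f -> n_derivable n (fun x => f (a * x + b)).
Proof.
elim: n f => [//|n IH] f [df nf].
have D (x : R) : is_derive x 1 (fun x => f (a * x + b)) ((derive1 f) (a * x + b) * a).
  have h : is_derive x 1 (fun x => a * x + b) a.
    apply: is_derive_eq; by rewrite addr0 /GRing.scale/= mulr1.
  have h' : is_derive (a * x + b) 1 f ((derive1 f) (a * x + b)).
    by apply: DeriveDef => //; rewrite derive1E.
  exact: (is_derive1_comp (f := f) (g := fun x => a * x + b)).
split; first by move=> x; exact: ex_derive.
rewrite [X in n_derivable _ X](_ : _ = fun x => (derive1 f) (a * x + b) * a).
  by apply: n_derivableM; [exact: IH|exact: n_derivable_cst].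
by apply/funext => x; rewrite derive1E; exact: derive_val.
Qed.

Lemma n_derivableV (R : realType) (n : nat) (f : R -> R) :
  (forall x, f x != 0) -> n_derivable n f -> n_derivable n (fun x => (f x)^-1).
Proof.
move=> f0; elim: n => [//|n IH] fn.
have fn1 := n_derivableS fn; move: fn => [df nf]; split.
  by move=> x; exact: derivableV.
rewrite [X in n_derivable _ X](_ : _ =
   fun x => (-1) * ((derive1 f) x * ((f x)^-1 * (f x)^-1))).
  apply: n_derivableM; first exact: n_derivable_cst.
  by apply: n_derivableM => //; apply: n_derivableM; apply: IH.
apply/funext => x; rewrite !derive1E deriveV//.
by rewrite /GRing.scale/= mulN1r mulNr mulrC expr2 invfM.
Qed.

(* The powers of 1/x make the family stable under differentiation. *)
Definition flat {R : realType} (k : nat) (x : R) : R :=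
  if 0 < x then x^-1 ^+ k * expR (- x^-1) else 0.

Lemma flat_ge0 (R : realType) (k : nat) (x : R) : 0 <= flat k x.
Proof.
rewrite /flat; case: ifPn => // x0.
by rewrite mulr_ge0 ?expR_ge0 ?exprn_ge0// invr_ge0 ltW.
Qed.

Lemma flat_gt0 (R : realType) (k : nat) (x : R) : 0 < x -> 0 < flat k x.
Proof. by move=> x0; rewrite /flat x0 mulr_gt0 ?expR_gt0 ?exprn_gt0 ?invr_gt0. Qed.

(** The exponential of 1 / x dominates the term of order k + 2 of its series. The quadratic decay
    gives the derivative 0 at the origin. *)
Lemma flat_le (R : realType) (k : nat) (x : R) :
  0 < x -> flat k x <= k.+2`!%:R * x ^+ 2.
Proof.
move=> x0; rewrite /flat x0 expRN.
have y0 : 0 <= x^-1 by rewrite invr_ge0 ltW.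
have H : x^-1 ^+ k.+2 / k.+2`!%:R <= expR x^-1.
  by apply: le_trans (expR_ge1Dxn k.+1 y0); rewrite lerDr.
rewrite ler_pdivrMr ?expR_gt0//.
have n0 : (0 : R) < k.+2`!%:R by rewrite ltr0n fact_gt0.
have c0 : 0 <= k.+2`!%:R * x ^+ 2 by rewrite mulr_ge0// ltW// exprn_gt0.
apply: le_trans (ler_wpM2l c0 H); rewrite le_eqVlt; apply/orP; left; apply/eqP.
have -> : x^-1 ^+ k.+2 = x^-1 ^+ k * x^-1 ^+ 2 by rewrite -exprD addn2.
move: (x^-1 ^+ k) (k.+2`!%:R : R) n0 => q m m0; field.
by rewrite !gt_eqF.
Qed.

Lemma is_derive_flat (R : realType) (k : nat) (x : R) :
  is_derive x 1 (flat k) (flat k.+2 x - k%:R * flat k.+1 x).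
Proof.
have [x0|x0|->] := ltgtP x 0.
- rewrite [X in is_derive _ _ _ X](_ : _ = 0); last first.
    by rewrite /flat ltNge (ltW x0)/= mulr0 subr0.
  apply: (near_eq_is_derive (f := cst 0)) => //=.
  near=> y; rewrite /flat ltNge ltW//.
  by near: y; exact: lt_nbhsl.
- rewrite {2 3}/flat x0.
  have ? : x != 0 by rewrite gt_eqF.
  have H : is_derive x 1 (fun y : R => y^-1 ^+ k * expR (- y^-1))
      (x^-1 ^+ k.+2 * expR (- x^-1) - k%:R * (x^-1 ^+ k.+1 * expR (- x^-1))).
    have hV : is_derive x 1 (fun y : R => y^-1) (- x^-1 ^+ 2).
      apply: DeriveDef; first exact: derivableV.
      by rewrite deriveV// derive_id /GRing.scale/= mulr1 exprVn.
    have hE : is_derive x 1 (fun y : R => expR (- y^-1)) (expR (- x^-1) * x^-1 ^+ 2).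
      rewrite -[X in _ * X]opprK.
      exact: (is_derive1_comp (f := expR) (g := fun y : R => - y^-1)).
    have hX := is_deriveX k hV.
    have hM := is_deriveM hX hE.
    rewrite [X in is_derive _ _ X _](_ : _ =
        (fun y : R => y^-1) ^+ k * (fun y : R => expR (- y^-1))); last first.
      by apply/funext => y; rewrite !fctE.
    apply: (is_derive_eq hM).
    rewrite /GRing.scale/= !fctE.
    case: k {hX hM} => [|k]; rewrite /= ?mulr0n ?mul0r ?mulr0 ?expr0 ?addr0 ?subr0.
      by ring.
    by rewrite !exprS -mulr_natl; ring.
  apply: (near_eq_is_derive (f := fun y : R => y^-1 ^+ k * expR (- y^-1))) => //=.
  by near=> y; rewrite /flat ifT//; near: y; exact: lt_nbhsr.
(* At the origin the difference quotient is 0 for [h <= 0] and at most [(k + 2)! * h] for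
   [h > 0]. *)
- have C : (h^-1 *: ((flat k \o shift 0) (h *: 1) - flat k 0) @[h --> 0^'] --> (0 : R)).
    apply/cvgr0Pnorm_lt => e e0.
    near=> h => /=.
    rewrite /= addr0 /GRing.scale/= mulr1 {2}/flat ltxx subr0.
    have [hp|hn] := ltP 0 h; last first.
      have -> : flat k h = 0 by rewrite /flat ifF//; apply/negbTE; rewrite -leNgt.
      by rewrite mulr0 normr0.
    rewrite ger0_norm ?mulr_ge0 ?flat_ge0 ?invr_ge0 ?ltW// ltr_pdivrMl//.
    apply: (le_lt_trans (flat_le _ hp)).
    rewrite expr2 mulrCA ltr_pM2l// -ltr_pdivlMl ?ltr0n ?fact_gt0//.
    rewrite -[ltLHS]gtr0_norm//; near: h.
    apply: dnbhs0_lt; by rewrite mulr_gt0 ?invr_gt0 ?ltr0n ?fact_gt0.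
  rewrite [X in is_derive _ _ _ X](_ : _ = 0); last first.
    by rewrite /flat ltxx mulr0 subr0.
  by apply: DeriveDef; [apply/cvg_ex; exists 0|exact/cvg_lim].
Unshelve. all: by end_near. Qed.

Lemma n_derivable_flat (R : realType) (n k : nat) : n_derivable n (@flat R k).
Proof.
elim: n k => [//|n IH] k; split.
  by move=> x; apply: ex_derive; exact: is_derive_flat.
rewrite [X in n_derivable _ X](_ : _ =
  fun x => flat k.+2 x + (- k%:R) * flat k.+1 x).
  by apply: n_derivableD => //; apply: n_derivableM => //; exact: n_derivable_cst.
apply/funext => x; rewrite derive1E mulNr.
by apply: derive_val; exact: is_derive_flat.
Qed.

Definition smooth_step {R : realType} (x : R) : R :=
  flat 0 x / (flat 0 x + flat 0 (1 - x)).

Lemma smooth_step_den_gt0 (R : realType) (x : R) : 0 < flat 0 x + flat 0 (1 - x).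
Proof.
have [x0|x0] := ltP 0 x; first by rewrite ltr_pwDl ?flat_gt0 ?flat_ge0.
by rewrite ltr_pwDr ?flat_ge0// flat_gt0//; lra.
Qed.

Lemma smooth_step_itv (R : realType) (x : R) : 0 <= smooth_step x <= 1.
Proof.
have d0 := smooth_step_den_gt0 x.
rewrite /smooth_step divr_ge0 ?flat_ge0 ?(ltW d0)//=.
by rewrite ler_pdivrMr ?smooth_step_den_gt0// mul1r lerDl flat_ge0.
Qed.

Lemma smooth_step0 (R : realType) (x : R) : x <= 0 -> smooth_step x = 0.
Proof. by move=> x0; rewrite /smooth_step /flat ltNge x0 mul0r. Qed.

Lemma smooth_step1 (R : realType) (x : R) : 1 <= x -> smooth_step x = 1.
Proof.
move=> x1; have d0 := smooth_step_den_gt0 x; rewrite /smooth_step.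
have E : flat 0 (1 - x) = 0 by rewrite /flat ltNge subr_le0 x1.
by move: d0; rewrite E addr0 => d0; rewrite divff// gt_eqF.
Qed.

Lemma n_derivable_smooth_step (R : realType) (n : nat) :
  n_derivable n (@smooth_step R).
Proof.
apply: n_derivableM; first exact: n_derivable_flat.
apply: n_derivableV; first by move=> x; rewrite gt_eqF// smooth_step_den_gt0.
apply: n_derivableD; first exact: n_derivable_flat.
rewrite [X in n_derivable _ X](_ : _ = fun x => flat 0 (-1 * x + 1)).
  by apply: n_derivable_affine; exact: n_derivable_flat.
by apply/funext => x; congr flat; lra.
Qed.

Lemma derive1_smooth_step_bounded (R : realType) :
  exists2 B : R, 0 <= B & forall x : R, `|derive1 smooth_step x| <= B.
Proof.
have d2 : forall x, derivable (derive1 (@smooth_step R)) x 1.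
  exact: (n_derivable_smooth_step R 2).2.1.
have cn : {within `[(-1 : R), 2], continuous (fun x => `|derive1 smooth_step x|)}.
  apply: continuous_subspaceT => x; apply: continuous_comp; last exact: norm_continuous.
  exact/differentiable_continuous/derivable1_diffP.
have [|c _ cm] := EVT_max _ cn; first by lra.
exists `|derive1 smooth_step c|; [exact: normr_ge0|move=> x].
have [xI|] := boolP (x \in `[(-1 : R), 2]); first exact: cm.
rewrite in_itv/= negb_and -!ltNge => /orP[xl|xr].
- rewrite [X in `|X|](_ : _ = 0) ?normr0//.
  rewrite derive1E (near_eq_derive (g := cst (0 : R))) ?derive_cst//.
  near=> y; rewrite smooth_step0// ltW//.
  by near: y; apply: lt_nbhsl; lra.
- rewrite [X in `|X|](_ : _ = 0) ?normr0//.
  rewrite derive1E (near_eq_derive (g := cst (1 : R))) ?derive_cst//.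
  near=> y; rewrite smooth_step1// ltW//.
  by near: y; apply: lt_nbhsr; lra.
Unshelve. all: by end_near. Qed.

Lemma derive1_smooth_step_eq0 (R : realType) (x : R) :
  x < 0 \/ 1 < x -> derive1 smooth_step x = 0.
Proof.
move=> [x0|x1]; rewrite derive1E.
- rewrite (near_eq_derive (g := cst (0 : R))) ?derive_cst//.
  near=> y; rewrite smooth_step0// ltW//.
  by near: y; exact: lt_nbhsl.
- rewrite (near_eq_derive (g := cst (1 : R))) ?derive_cst//.
  near=> y; rewrite smooth_step1// ltW//.
  by near: y; exact: lt_nbhsr.
Unshelve. all: by end_near. Qed.

(** The derivative of a smooth step of width [e] starting at [c]: a bump of mass one that sits on
    [[c, c + e]], to the right of [c]. *)
Definition mollifier {R : realType} (c e x : R) : R :=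
  e^-1 * derive1 smooth_step ((x - c) / e).

Lemma is_derive_smooth_step (R : realType) (c e x : R) :
  is_derive x 1 (fun x => smooth_step ((x - c) / e)) (mollifier c e x).
Proof.
have h : is_derive x 1 (fun x : R => (x - c) / e) e^-1.
  rewrite [X in is_derive _ _ X _](_ : _ = fun x => e^-1 * x + (- c / e)).
    by apply: is_derive_eq; rewrite addr0 /GRing.scale/= mulr1.
  by apply/funext => y; ring.
have d := (n_derivable_smooth_step R 1).1 ((x - c) / e).
have h' : is_derive ((x - c) / e) 1 (@smooth_step R) (derive1 smooth_step ((x - c) / e)).
  by apply: DeriveDef => //; rewrite derive1E.
rewrite /mollifier mulrC.
exact: (is_derive1_comp (f := @smooth_step R) (g := fun x => (x - c) / e)).
Qed.

Lemma continuous_mollifier (R : realType) (c e : R) : continuous (mollifier c e).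
Proof.
move=> x; apply: cvgM; first exact: cvg_cst.
apply: (@continuous_comp R R R (fun x => (x - c) / e) (derive1 smooth_step)).
  by apply: cvgM; [apply: cvgB; [exact: cvg_id|exact: cvg_cst]|exact: cvg_cst].
apply/differentiable_continuous/derivable1_diffP.
exact: (n_derivable_smooth_step R 2).2.1.
Qed.

Lemma mollifier_eq0 (R : realType) (c e x : R) : 0 < e ->
  x < c \/ c + e < x -> mollifier c e x = 0.
Proof.
move=> e0 h; rewrite /mollifier derive1_smooth_step_eq0 ?mulr0//.
case: h => h; [left|right].
  by rewrite pmulr_llt0 ?invr_gt0// subr_lt0.
by rewrite ltr_pdivlMr// mul1r; lra.
Qed.

Lemma integral_mollifier (R : realType) (c e : R) : 0 < e ->
  (\int[mu]_(x in `[c, (c + e)%R]) (mollifier c e x)%:E = 1)%E.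
Proof.
move=> e0; have cF : continuous (fun x => smooth_step ((x - c) / e)).
  move=> x; apply/differentiable_continuous/derivable1_diffP.
  by apply: ex_derive; exact: is_derive_smooth_step.
rewrite (@continuous_FTC2 R _ (fun x => smooth_step ((x - c) / e))).
- rewrite smooth_step1; last by rewrite addrAC subrr add0r divff// gt_eqF.
  by rewrite smooth_step0 ?sube0// subrr mul0r.
- by rewrite ltrDl.
- by apply: continuous_subspaceT; exact: continuous_mollifier.
- split.
  + by move=> x _; apply: ex_derive; exact: is_derive_smooth_step.
  + by apply: cvg_at_right_filter; exact: cF.
  + by apply: cvg_at_left_filter; exact: cF.
- by move=> x _; rewrite derive1E; apply: derive_val; exact: is_derive_smooth_step.
Qed.

(** A test function that tends to the indicator of []a, b]] as [e] decreases to 0: both steps rise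
    to the right of their base points, which settles the end points. Its derivative is a bump at [a]
    minus a bump at [b]. *)
Definition smooth_plateau {R : realType} (a b e x : R) : R :=
  smooth_step ((x - a) / e) - smooth_step ((x - b) / e).

Lemma derive1_smooth_plateau (R : realType) (a b e x : R) :
  derive1 (smooth_plateau a b e) x = mollifier a e x - mollifier b e x.
Proof.
rewrite derive1E; apply: derive_val.
exact: (is_deriveB (is_derive_smooth_step a e x) (is_derive_smooth_step b e x)).
Qed.

Lemma smooth_plateau_eq0 (R : realType) (a b e x : R) : 0 < e -> a <= b ->
  x < a \/ b + e < x -> smooth_plateau a b e x = 0.
Proof.
move=> e0 ab [xa|bx]; rewrite /smooth_plateau.
  by rewrite !smooth_step0 ?subrr// pmulr_lle0 ?invr_gt0//; lra.
by rewrite !smooth_step1 ?subrr// ler_pdivlMr// mul1r; lra.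
Qed.

Lemma smooth_plateau_le1 (R : realType) (a b e x : R) : `|smooth_plateau a b e x| <= 1.
Proof.
rewrite /smooth_plateau ler_norml.
have /andP[? ?] := smooth_step_itv ((x - a) / e).
have /andP[? ?] := smooth_step_itv ((x - b) / e).
by apply/andP; split; lra.
Qed.

Lemma test_function_smooth_plateau (R : realType) (a b e : R) :
  0 < e -> a <= b -> test_function (smooth_plateau a b e).
Proof.
move=> e0 ab; split.
  apply: n_derivable_derive1n => n.
  rewrite (_ : smooth_plateau a b e = fun x =>
    smooth_step (e^-1 * x + (- a / e)) + (-1) * smooth_step (e^-1 * x + (- b / e))).
    apply: n_derivableD; first by apply: n_derivable_affine; exact: n_derivable_smooth_step.
    apply: n_derivableM; first exact: n_derivable_cst.
    by apply: n_derivable_affine; exact: n_derivable_smooth_step.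
  apply/funext => x; rewrite /smooth_plateau mulN1r.
  by congr (smooth_step _ - smooth_step _); ring.
exists (`|a| + `|b| + e) => x h; apply: smooth_plateau_eq0 => //.
have ? := ler_norm b; have := ler_norm (- a); rewrite normrN => ?.
have ? := normr_ge0 a; have ? := normr_ge0 b.
have [x0|x0] := leP 0 x; first by rewrite (ger0_norm x0) in h; right; lra.
by rewrite (ltr0_norm x0) in h; left; lra.
Qed.

(** * Lebesgue points and the continuous representative *)

Lemma locally_integrable_itv (R : realType) (f : R -> R) (a b : R) :
  locally_integrable setT f -> mu.-integrable `[a, b] (EFin \o f).
Proof.
move=> [mf _ fK]; apply/integrableP; split.
  by apply/measurable_EFinP; apply: measurable_funTS.
by apply: fK => //; exact: segment_compact.
Qed.

Lemma integrable_mul_bounded (R : realType) (D : set R) (f h : R -> R) (B : R) :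
  measurable D -> mu.-integrable D (EFin \o f) -> measurable_fun D h ->
  (forall x, D x -> `|h x| <= B) ->
  mu.-integrable D (fun x => (f x * h x)%:E).
Proof.
move=> mD fi mh hB.
rewrite (_ : (fun x => _) = ((EFin \o f) \* (EFin \o h))%E); last by apply/funext => x /=.
apply: integrableMl => //.
exists B; split; first exact: num_real.
by move=> M BM x Dx; apply: (le_trans (hB _ Dx)); exact: ltW.
Qed.

(** The bump has mass one and is at most [B / e], so the error is at most [4 * B] times the mean of
    [|f - f c|] over the ball of radius [2 e], whose length is [4 e]. This mean tends to 0 at a
    Lebesgue point. The doubled radius lets the open ball contain [[c, c + e]]. *)
Lemma mollifier_integral_cvg (R : realType) (f : R -> R) (c : R) :
  locally_integrable setT f -> lebesgue_pt f c ->
  (fun n => \int[mu]_(x in `[c, c + n.+1%:R^-1]) (f x * mollifier c n.+1%:R^-1 x))%R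
    @ \oo --> f c.
Proof.
move=> lf lc; have [B B0 bB] := derive1_smooth_step_bounded R.
have scale4 (e : R) : 0 < e -> e^-1 * B = 4 * B / (e *+ 2 *+ 2).
  by move=> e0; field; rewrite gt_eqF.
have key (e : R) : 0 < e ->
    ((`|f c - \int[mu]_(x in `[c, c + e]) (f x * mollifier c e x)|)%:E
      <= (4 * B)%:E * davg f c (e *+ 2))%E.
  move=> e0; set D : set R := `[c, c + e]%classic.
  have mD : measurable D by exact: measurable_itv.
  have mB x : `|mollifier c e x| <= e^-1 * B.
    by rewrite /mollifier normrM gtr0_norm ?invr_gt0// ler_pM2l ?invr_gt0.
  have mm A : measurable_fun A (mollifier c e).
    apply: measurable_funTS; apply: continuous_measurable_fun.
    exact: continuous_mollifier.
  have fi : mu.-integrable D (EFin \o f) by exact: locally_integrable_itv.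
  have cfi : mu.-integrable D (EFin \o (fun=> f c)).
    apply: continuous_compact_integrable; first exact: segment_compact.
    by apply: continuous_subspaceT => x; exact: cvg_cst.
  have gi : mu.-integrable D (EFin \o (fun x => f c - f x)).
    by rewrite (_ : _ \o _ = ((EFin \o (fun=> f c)) \- (EFin \o f))%E)//; exact: integrableB.
  have i1 := integrable_mul_bounded mD fi (mm _) (fun x _ => mB x).
  have i2 := integrable_mul_bounded mD gi (mm _) (fun x _ => mB x).
  have i3 := integrable_mul_bounded mD cfi (mm _) (fun x _ => mB x).
  have E : f c - \int[mu]_(x in D) (f x * mollifier c e x) =
      \int[mu]_(x in D) ((f c - f x) * mollifier c e x).
    have E1 : f c = \int[mu]_(x in D) (f c * mollifier c e x).
      rewrite RintegralZl//; last first.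
        apply: continuous_compact_integrable; first exact: segment_compact.
        by apply: continuous_subspaceT; exact: continuous_mollifier.
      by rewrite /Rintegral integral_mollifier//= mulr1.
    rewrite {1}E1 -RintegralB//; apply: eq_Rintegral => x _.
    by rewrite mulrBl.
  rewrite E; apply: (@le_trans _ _ (\int[mu]_(x in D) (`|(f c - f x) * mollifier c e x|%R)%:E)%E).
    rewrite /Rintegral -abse_EFin fineK; last exact: integrable_fin_num.
    apply: (le_trans (le_abse_integral _ _ _)) => //.
    by move/integrableP : i2 => [].
  have mf : measurable_fun setT f by case: lf.
  have mfc A : measurable_fun A (fun x => (`|f x - f c|)%:E).
    apply/measurable_EFinP; apply: measurableT_comp => //; apply: measurable_funTS.
    exact: measurable_funB.
  apply: (@le_trans _ _ (\int[mu]_(x in ball c (e *+ 2)) ((e^-1 * B)%:E * (`|f x - f c|)%:E))%E).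
    apply: (@le_trans _ _ (\int[mu]_(x in D) ((e^-1 * B)%:E * (`|f x - f c|)%:E))%E).
      apply: ge0_le_integral => //.
      - apply/measurable_EFinP; apply: measurableT_comp => //.
        by move/integrableP : i2 => [/measurable_EFinP].
      - by apply: emeasurable_funM => //; exact: mfc.
      - move=> x _; rewrite -EFinM lee_fin normrM distrC mulrC.
        by rewrite ler_wpM2r.
    apply: ge0_subset_integral => //.
    - exact: measurable_ball.
    - by apply: emeasurable_funM => //; exact: mfc.
    - by move=> x _; rewrite -EFinM lee_fin !mulr_ge0// invr_ge0 ltW.
    - move=> x; rewrite /D/= in_itv/= => /andP[cx xc].
      by rewrite /ball/= ler0_norm; lra.
  rewrite ge0_integralZl//; first last.
  - by rewrite lee_fin mulr_ge0// invr_ge0 ltW.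
  - exact: mfc.
  - exact: measurable_ball.
  rewrite /davg /iavg lebesgue_measure_ball; last by rewrite mulrn_wge0// ltW.
  rewrite muleA inver; case: eqP => [/eqP|_].
    by rewrite mulrn_eq0 mulrn_eq0/= gt_eqF.
  rewrite -EFinM le_eqVlt; apply/orP; left; apply/eqP; congr (_ * _)%E.
  by rewrite -scale4.
apply/cvgrPdist_le => eps eps0.
have B1 : 0 < 4 * B + 1 by lra.
have H : \forall r \near 0^'+, (davg f c r <= (eps / (4 * B + 1))%:E)%E.
  have := lc => /fine_cvgP[fn] /cvgr_le /(_ (eps / (4 * B + 1))).
  rewrite divr_gt0// => /(_ isT) le1.
  near=> r; have fr : davg f c r \is a fin_num by near: r.
  by rewrite -(fineK fr) lee_fin; near: r.
have : (fun n => n.+1%:R^-1 *+ 2) @ \oo --> (0 : R).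
  rewrite -(mul0rn R 2); apply: cvgMn; exact: cvg_harmonic.
move=> cv0.
have {}H : \forall n \near \oo, (davg f c (n.+1%:R^-1 *+ 2) <= (eps / (4 * B + 1))%:E)%E.
  move: H => [d /= d0 H].
  move/cvgr0Pnorm_lt : cv0 => /(_ d d0) nd.
  near=> n; apply: H; last by rewrite mulrn_wgt0// invr_gt0.
  by rewrite /= sub0r normrN; near: n.
near=> n.
rewrite -lee_fin; apply: (le_trans (key _ _)); first by rewrite invr_gt0.
apply: (@le_trans _ _ ((4 * B)%:E * (eps / (4 * B + 1))%:E)%E).
  rewrite lee_wpmul2l ?lee_fin ?mulr_ge0//; by near: n.
rewrite -EFinM lee_fin mulrA ler_pdivrMr//; nra.
Unshelve. all: by end_near. Qed.

(** Test with smooth plateaus of width [1 / (n + 1)]. The side of [psi] tends to [psi a - psi b]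
    because [a] and [b] are Lebesgue points, and the side of [g] converges by domination with
    [|g|]. *)
Lemma weak_derivative_increment (R : realType) (psi g : R -> R) (a b : R) :
  weak_derivative psi g -> a <= b -> lebesgue_pt psi a -> lebesgue_pt psi b ->
  psi b - psi a = \int[mu]_(x in `]a, b]) g x.
Proof.
move=> [lpsi lg wd] ab la lb.
(* All plateaus have width at most 1, so this interval contains all supports. *)
pose K : set R := `[a, b + 1]%classic.
have mK : measurable K by exact: measurable_itv.
have gK : mu.-integrable K (EFin \o g) by exact: locally_integrable_itv.
have pK : mu.-integrable K (EFin \o psi) by exact: locally_integrable_itv.
pose e (n : nat) : R := n.+1%:R^-1.
have e0 n : 0 < e n by rewrite invr_gt0.
have e1 n : e n <= 1 by rewrite invf_le1// ler1n.
have [B B0 bB] := derive1_smooth_step_bounded R.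
have mollB c n x : `|mollifier c (e n) x| <= (e n)^-1 * B.
  by rewrite /mollifier normrM gtr0_norm ?invr_gt0// ler_pM2l ?invr_gt0.
have mm c n A : measurable_fun A (mollifier c (e n)).
  apply: measurable_funTS; apply: continuous_measurable_fun.
  exact: continuous_mollifier.
have sub c n : a <= c <= b -> \int[mu]_(x in K) (psi x * mollifier c (e n) x) =
    \int[mu]_(x in `[c, c + e n]) (psi x * mollifier c (e n) x).
  move=> /andP[ac cb]; rewrite Rintegral_mkcond [RHS]Rintegral_mkcond.
  apply: eq_Rintegral => x _; rewrite !patchE.
  case: ifPn => xK; case: ifPn => xc //.
  - rewrite mollifier_eq0 ?mulr0//; move: xc; rewrite notin_setE/= in_itv/= => /negP.
    by rewrite negb_and -!ltNge => /orP.
  - move: xK xc; rewrite notin_setE inE /K/= !in_itv/= => h /andP[h1 h2]; exfalso; apply: h.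
    by have := e1 n => h3; apply/andP; split; lra.
have lhs : (fun n => \int[mu]_(x in K) (psi x * derive1 (smooth_plateau a b (e n)) x)) @ \oo
    --> psi a - psi b.
  under eq_fun => n.
    rewrite (_ : \int[mu]_(x in K) _ = \int[mu]_(x in `[a, a + e n]) (psi x * mollifier a (e n) x)
       - \int[mu]_(x in `[b, b + e n]) (psi x * mollifier b (e n) x)); first over.
    rewrite -!sub ?lexx ?ab// -RintegralB//.
    - by apply: eq_Rintegral => x _; rewrite derive1_smooth_plateau mulrBr.
    - exact: (integrable_mul_bounded mK pK (mm _ _ _) (fun x _ => mollB _ _ _)).
    - exact: (integrable_mul_bounded mK pK (mm _ _ _) (fun x _ => mollB _ _ _)).
  by apply: cvgB; exact: mollifier_integral_cvg.
have mplat n : measurable_fun setT (smooth_plateau a b (e n)).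
  apply: continuous_measurable_fun => x.
  apply/differentiable_continuous/derivable1_diffP.
  apply: derivableB; apply: ex_derive; exact: is_derive_smooth_step.
have mg : measurable_fun setT g by case: lg.
have rhs : (fun n => \int[mu]_(x in K) (g x * smooth_plateau a b (e n) x)%:E)%E @ \oo
    --> (\int[mu]_(x in K) (g x * \1_(`]a, b]) x)%:E)%E.
  have mE A h : measurable_fun setT h -> measurable_fun A (fun x => (g x * h x)%:E).
    move=> mh; apply/measurable_EFinP; apply: measurable_funM; exact: measurable_funTS.
  have [] := @dominated_convergence _ _ R mu K mK
    (fun n x => (g x * smooth_plateau a b (e n) x)%:E)
    (fun x => (g x * \1_(`]a, b]) x)%:E) (fun x => (`|g x|)%:E); last by [].
  - by move=> n; exact: mE.
  - by apply: mE; exact: measurable_indic.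
  - apply: aeW => x Kx; apply/cvg_EFin; first exact: nearW.
    apply: cvgM; first exact: cvg_cst.
    have ce c : c < x -> \forall n \near \oo, smooth_step ((x - c) / e n) = 1.
      move=> cx; have h : (fun n => e n) @ \oo --> (0 : R) by exact: cvg_harmonic.
      have xc : 0 < x - c by rewrite subr_gt0.
      move/cvgr0Pnorm_lt : h => /(_ _ xc) h; near=> n.
      rewrite smooth_step1// ler_pdivlMr// mul1r ltW// -[ltLHS]gtr0_norm//.
      by near: n.
    have cs c : (fun n => smooth_step ((x - c) / e n)) @ \oo --> ((c < x)%R%:R : R).
      have [cx|xc] := ltP c x.
        by apply: cvg_near_cst; exact: ce.
      rewrite [X in X @ _ --> _](_ : _ = cst 0); first exact: cvg_cst.
      by apply/funext => n; rewrite smooth_step0// pmulr_lle0 ?invr_gt0// subr_le0.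
    rewrite [X in _ --> X](_ : _ = (a < x)%R%:R - (b < x)%R%:R); first exact: cvgB.
    rewrite indicE; have [xi|] := boolP (x \in `]a, b]).
      rewrite mem_set//; move: xi; rewrite in_itv/= => /andP[-> xb].
      by rewrite ltNge xb subr0.
    rewrite in_itv/= negb_and -leNgt -ltNge => xi; rewrite memNset/=; last first.
      rewrite in_itv/= => /andP[ax xb]; case/orP : xi => h.
        by move: (lt_le_trans ax h); rewrite ltxx.
      by move: (lt_le_trans h xb); rewrite ltxx.
    case/orP : xi => h.
      by rewrite !ltNge h (le_trans h ab) subrr.
    by rewrite h (le_lt_trans ab h) subrr.
  - exact: integrable_norm.
  - apply: aeW => x n Kx; rewrite abse_EFin lee_fin normrM.
    by rewrite -[leRHS]mulr1 ler_wpM2l// smooth_plateau_le1.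
have supp n (h k : R -> R) : (forall x, x < a \/ b + e n < x -> k x = 0) ->
    (\int[mu]_x (h x * k x)%:E = \int[mu]_(x in K) (h x * k x)%:E)%E.
  move=> k0; rewrite [RHS]integral_mkcond; apply: eq_integral => x _.
  rewrite patchE; case: ifPn => //; rewrite notin_setE /K/= in_itv/= => /negP.
  rewrite negb_and -!ltNge => xi; rewrite k0 ?mulr0//.
  by case/orP : xi => xi; [left|right; have := e1 n; lra].
have eq n : (\int[mu]_(x in K) (g x * smooth_plateau a b (e n) x)%:E =
    (- \int[mu]_(x in K) (psi x * derive1 (smooth_plateau a b (e n)) x)%R)%:E)%E.
  have := wd _ (test_function_smooth_plateau (e0 n) ab).
  rewrite (@supp n g); last by move=> x; exact: smooth_plateau_eq0.
  rewrite (@supp n psi); last first.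
    move=> x h; rewrite derive1_smooth_plateau !mollifier_eq0 ?subrr//; case: h => h; try by [left|right].
    - by left; lra.
    - by right; lra.
  move=> h; rewrite -[LHS]oppeK -h EFinN /Rintegral fineK//.
  apply: integrable_fin_num => //.
  under eq_fun do rewrite derive1_smooth_plateau mulrBr EFinB.
  by apply: integrableB => //; exact: (integrable_mul_bounded mK pK (mm _ _ _) (fun x _ => mollB _ _ _)).
have cv2 : (fun n => (- \int[mu]_(x in K) (psi x * derive1 (smooth_plateau a b (e n)) x))%:E)
    @ \oo --> (psi b - psi a)%:E.
  apply/cvg_EFin; first exact: nearW.
  by rewrite -opprB; exact: cvgN.
have E : (\int[mu]_(x in K) (g x * \1_(`]a, b]) x)%:E = (psi b - psi a)%:E)%E.
  rewrite (_ : (fun n => _) = (fun n =>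
      (- \int[mu]_(x in K) (psi x * derive1 (smooth_plateau a b (e n)) x))%:E)) in rhs.
    exact: (cvg_unique _ rhs cv2).
  exact/funext.
rewrite /Rintegral; suff -> : (\int[mu]_(x in `]a, b]) (g x)%:E =
    \int[mu]_(x in K) (g x * \1_(`]a, b]) x)%:E)%E by rewrite E.
rewrite integral_mkcond [RHS]integral_mkcond; apply: eq_integral => x _.
rewrite !patchE indicE; case: ifPn => xi; last first.
  by rewrite mulr0; case: ifPn.
rewrite mulr1 ifT//; move: xi; rewrite !inE /K/= !in_itv/= => /andP[h1 h2].
by apply/andP; split; lra.
Unshelve. all: by end_near. Qed.

Lemma ae_lebesgue_exists (R : realType) (P : R -> Prop) :
  {ae mu, forall x, P x} -> exists x, P x.
Proof.
move=> [N [mN N0 PN]]; apply: contrapT => /forallNP h.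
have : (mu (`[0%R, 1%R] : set R) <= mu N)%E.
  by apply: le_measure; rewrite ?inE// => x _; apply: PN; exact: h.
by rewrite N0 lebesgue_measure_itv/= lte_fin ltr01 oppr0 adde0 lee_fin ler10.
Qed.

Lemma weak_derivative_continuous_representative (R : realType) (psi g : R -> R) :
  weak_derivative psi g ->
  exists f : R -> R, [/\ {ae mu, forall x, psi x = f x},
    (forall a b, a <= b -> f b - f a = \int[mu]_(x in `]a, b]) g x) &
    (forall a b, a <= b -> {within `[a, b], continuous f})].
Proof.
move=> wd; have [lpsi lg _] := wd.
have ae := lebesgue_differentiation lpsi.
have [x0 lx0] := ae_lebesgue_exists ae.
(* One of the two domains is always empty, so this is the signed integral of [g] from the Lebesgue
   point [x0] to [x]. *)
pose f x := psi x0 + (\int[mu]_(y in `]x0, x]) g y - \int[mu]_(y in `]x, x0]) g y).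
have gi a b : mu.-integrable `]a, b] (EFin \o g).
  apply: (@integrableS _ _ _ mu `[a, b]) => //.
    by apply: subset_itv; rewrite bnd_simp.
  exact: locally_integrable_itv.
have add a b c : a <= b -> b <= c ->
    \int[mu]_(y in `]a, c]) g y = \int[mu]_(y in `]a, b]) g y + \int[mu]_(y in `]b, c]) g y.
  move=> ab bc; rewrite -Rintegral_setU//.
  - by rewrite -itv_bndbnd_setU// bnd_simp.
  - by rewrite -itv_bndbnd_setU// bnd_simp.
  - apply/disj_setPS => v [/=]; rewrite !in_itv/= => /andP[_ vy] /andP[yv _].
    by move: (le_lt_trans vy yv); rewrite ltxx.
have emp a b : b <= a -> \int[mu]_(y in `]a, b]) g y = 0.
  by move=> ba; rewrite set_itv_ge ?Rintegral_set0// bnd_simp -leNgt.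
have fE a b : a <= b -> f b - f a = \int[mu]_(x in `]a, b]) g x.
  move=> ab; rewrite /f; have [xa|ax] := leP x0 a.
    rewrite (emp b x0) ?(le_trans xa)// (emp a x0)// (add _ _ _ xa ab); ring.
  have [xb|bx] := leP x0 b.
    rewrite (emp x0 a) ?(ltW ax)// (emp b x0)// (add _ _ _ (ltW ax) xb); ring.
  rewrite (emp x0 a) ?(ltW ax)// (emp x0 b) ?(ltW bx)// (add _ _ _ ab (ltW bx)); ring.
exists f; split => //.
- move: ae; apply: filterS; first exact: (ae_filter_ringOfSetsType mu).
  move=> x lx; rewrite /f.
  have [xx|xx] := leP x0 x.
    by rewrite (emp x x0)// -(weak_derivative_increment wd xx lx0 lx); ring.
  by rewrite (emp x0 x) ?ltW// -(weak_derivative_increment wd (ltW xx) lx lx0); ring.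
- move=> a b ab.
  have gab : mu.-integrable `[a, b] (EFin \o g) by exact: locally_integrable_itv.
  have c := parameterized_integral_continuous ab gab.
  apply: (@subspace_eq_continuous _ _ _ (fun x => f a + parameterized_integral mu a x g)).
    move=> x; rewrite inE/= in_itv/= => /andP[ax xb].
    rewrite /parameterized_integral -Rintegral_itv_obnd_cbnd// -fE//.
    by rewrite addrC subrK.
  move=> x; apply: cvgD; first exact: cvg_cst.
  exact: c.
Qed.

(** * Lower bound *)

Lemma measurable_sqr_lt (R : realType) (A : R -> R) (r : R) :
  measurable_fun setT A -> measurable [set y | r ^+ 2 < A y].
Proof.
move=> mA; rewrite (_ : mkset _ = setT `&` A @^-1` `]r ^+ 2, +oo[).
  by apply: mA => //; exact: measurable_itv.
by apply/seteqP; split => x /=; rewrite in_itv/= andbT// => -[].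
Qed.

Lemma measurable_prod_sqr_lt (R : realType) (A : R -> R) :
  measurable_fun setT A -> measurable [set x : R * R | x.1 ^+ 2 < A x.2].
Proof.
move=> mA; rewrite (_ : mkset _ =
    setT `&` (fun x : R * R => A x.2 - x.1 ^+ 2) @^-1` `]0, +oo[).
  have mf : measurable_fun setT (fun x : R * R => A x.2 - x.1 ^+ 2).
    apply: measurable_funB; first by apply: measurableT_comp.
    by apply: measurable_funX; exact: measurable_fst.
  by apply: mf => //; exact: measurable_itv.
by apply/seteqP; split => x /=; rewrite in_itv/= andbT subr_gt0// => -[].
Qed.

Lemma layer_cake_mul_sqrt (R : realType) (k A : R -> R) :
  measurable_fun setT k -> measurable_fun setT A -> (forall y, 0 <= k y) ->
  measurable_fun setT (fun r : R => \int[mu]_y (k y * \1_[set x | r ^+ 2 < A x]%R y)%:E)%E /\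
  (\int[mu]_r \int[mu]_y (k y * \1_[set x | r ^+ 2 < A x]%R y)%:E =
   2%:E * \int[mu]_y (k y * Num.sqrt (A y))%:E)%E.
Proof.
move=> mk mA k0.
pose S := [set x : R * R | x.1 ^+ 2 < A x.2].
pose F (x : R * R) := (k x.2 * \1_S x)%:E.
have mF : measurable_fun setT F.
  apply/measurable_EFinP; apply: measurable_funM; first exact: measurableT_comp.
  by apply: measurable_indic; exact: measurable_prod_sqr_lt.
have F0 x : (0 <= F x)%E by rewrite lee_fin mulr_ge0.
split; first exact: (measurable_fun_lebesgue_integral mF F0).
rewrite -[LHS]/(\int[mu]_r \int[mu]_y F (r, y))%E lebesgue_tonelli//.
rewrite -ge0_integralZl//; first last.
- by move=> y _; rewrite lee_fin mulr_ge0 ?sqrtr_ge0.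
- apply/measurable_EFinP; apply: measurable_funM => //.
  apply: measurableT_comp => //.
  by apply: continuous_measurable_fun; exact: sqrt_continuous.
apply: eq_integral => y _; rewrite -EFinM mulrCA EFinM -layer_cake_sqrt.
rewrite -ge0_integralZl//; last by rewrite lee_fin.
apply/measurable_EFinP; apply: measurable_indic.
by rewrite set_sqr_lt; exact: measurable_itv.
Qed.

(** By the weighted layer cake, an inequality for all superlevel sets integrates to one for the
    square roots. The factor 2 in the conclusion is the one in the hypothesis. *)
Lemma le_integral_mul_sqrt (R : realType) (k1 A1 k2 A2 : R -> R) :
  measurable_fun setT k1 -> measurable_fun setT A1 -> (forall y, 0 <= k1 y) ->
  measurable_fun setT k2 -> measurable_fun setT A2 -> (forall y, 0 <= k2 y) ->
  (forall r : R, (2%:E * \int[mu]_y (k2 y * \1_[set x | r ^+ 2 < A2 x]%R y)%:E <=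
     \int[mu]_y (k1 y * \1_[set x | r ^+ 2 < A1 x]%R y)%:E)%E) ->
  (2%:E * \int[mu]_y (k2 y * Num.sqrt (A2 y))%:E <=
     \int[mu]_y (k1 y * Num.sqrt (A1 y))%:E)%E.
Proof.
move=> mk1 mA1 k10 mk2 mA2 k20 h.
have [m1 e1] := layer_cake_mul_sqrt mk1 mA1 k10.
have [m2 e2] := layer_cake_mul_sqrt mk2 mA2 k20.
have i0 (k A : R -> R) (r : R) : (forall y, 0 <= k y) ->
    (0 <= \int[mu]_y (k y * \1_[set x | r ^+ 2 < A x]%R y)%:E)%E.
  by move=> kk; apply: integral_ge0 => y _; rewrite lee_fin mulr_ge0.
rewrite -(@lee_pmul2l _ 2%:E)// -e1 -e2 -ge0_integralZl//; last first.
  by move=> r _; exact: i0.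
apply: ge0_le_integral => //.
- by move=> r _; rewrite mule_ge0// i0.
- exact: measurable_funeM.
Qed.

(** Take for [t] the first point where [h] reaches [beta], and for [s] the last point before [t]
    where [h] is at most [alpha]. In between, [h] stays in the band. *)
Lemma level_crossing (R : realType) (h : R -> R) (a b alpha beta : R) :
  continuous h -> a <= b -> alpha < beta -> h a <= alpha -> beta <= h b ->
  exists s t, [/\ a <= s <= t, t <= b, h s = alpha, h t = beta &
    forall x, s <= x <= t -> alpha <= h x <= beta].
Proof.
move=> ch ab albe ha hb.
have cpt (P : set R) c d : closed P -> compact (`[c, d] `&` h @^-1` P).
  move=> cP; apply: (@subclosed_compact _ _ `[c, d]).
  - apply: closedI; first exact: itv_closed.
    by apply: closed_comp => // x _; exact: ch.
  - exact: segment_compact.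
  - by move=> x [].
have cid A : {within A, continuous (@idfun R)}.
  by apply: continuous_subspaceT => x; exact: cvg_id.
have [t [[/= tab ht] tmin]] : exists t, (`[a, b] `&` h @^-1` `[beta, +oo[) t /\
    forall x, (`[a, b] `&` h @^-1` `[beta, +oo[) x -> t <= x.
  have [|||t] := @compact_EVT_min _ R (@idfun R) (`[a, b] `&` h @^-1` `[beta, +oo[).
  - by exists b; split => /=; rewrite in_itv/= ?ab ?lexx ?hb.
  - by apply: cpt; exact: interval_closed.
  - exact: cid.
  by rewrite inE => tA m; exists t; split => // x xA; apply: m; rewrite inE.
move: tab ht; rewrite !in_itv/= andbT => /andP[at_ tb] ht.
have htE : h t = beta.
  apply: le_anti; rewrite ht andbT leNgt; apply/negP => h1.
  have [||x] := @IVT R h a t beta at_.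
  - exact: continuous_subspaceT.
  - rewrite ge_min le_max (ltW (le_lt_trans ha albe))/=.
    by rewrite (ltW h1) orbT.
  rewrite in_itv/= => /andP[ax xt] hx.
  have : t <= x by apply: tmin; split => /=; rewrite in_itv/= ?hx ?lexx// ax (le_trans xt).
  by move=> tx; move: h1; rewrite -hx (le_anti (introT andP (conj tx xt))) ltxx.
have [s [[/= sat hs] smax]] : exists s, (`[a, t] `&` h @^-1` `]-oo, alpha]) s /\
    forall x, (`[a, t] `&` h @^-1` `]-oo, alpha]) x -> x <= s.
  have [|||s] := @compact_EVT_max _ R (@idfun R) (`[a, t] `&` h @^-1` `]-oo, alpha]).
  - by exists a; split => /=; rewrite in_itv/= ?at_ ?lexx ?ha.
  - by apply: cpt; exact: interval_closed.
  - exact: cid.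
  by rewrite inE => tA m; exists s; split => // x xA; apply: m; rewrite inE.
move: sat hs; rewrite !in_itv/= => /andP[as_ st] hs.
have hsE : h s = alpha.
  apply: le_anti; rewrite hs leNgt; apply/negP => h1.
  have [||x] := @IVT R h s t alpha st.
  - exact: continuous_subspaceT.
  - by rewrite ge_min le_max (ltW h1)/= htE (ltW albe) orbT.
  rewrite in_itv/= => /andP[sx xt] hx.
  have : x <= s by apply: smax; split => /=; rewrite in_itv/= ?hx ?lexx// (le_trans as_).
  by move=> xs; move: h1; rewrite -hx (le_anti (introT andP (conj xs sx))) ltxx.
exists s, t; split => //; first by rewrite as_.
move=> x /andP[sx xt]; apply/andP; split.
- rewrite leNgt; apply/negP => h1.
  have xs : x <= s by apply: smax; split => /=; rewrite in_itv/= ?(ltW h1)// xt (le_trans as_).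
  by move: h1; rewrite (le_anti (introT andP (conj xs sx))) hsE ltxx.
- rewrite leNgt; apply/negP => h1.
  have tx : t <= x.
    apply: tmin; split => /=; rewrite in_itv/= ?(ltW h1)//.
    by rewrite (le_trans as_)// (le_trans xt).
  by move: h1; rewrite -(le_anti (introT andP (conj tx xt))) htE ltxx.
Qed.

Lemma norm_increment_le (R : realType) (f g : R -> R) (a b : R) :
  locally_integrable setT g ->
  (forall a b, a <= b -> f b - f a = \int[mu]_(x in `]a, b]) g x) -> a <= b ->
  ((`|f b - f a|)%:E <= \int[mu]_(x in `]a, b]) (`|g x|)%:E)%E.
Proof.
move=> lg fE ab.
have gi : mu.-integrable `]a, b] (EFin \o g).
  apply: (@integrableS _ _ _ mu `[a, b]) => //.
    by apply: subset_itv; rewrite bnd_simp.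
  exact: locally_integrable_itv.
rewrite fE// /Rintegral -abse_EFin fineK; last exact: integrable_fin_num.
apply: (le_trans (le_abse_integral _ _ _)) => //.
by move/integrableP : gi => [].
Qed.

Lemma integrable_small_right (R : realType) (f : R -> R) (x e : R) :
  measurable_fun setT f -> (\int[mu]_y (`|f y|)%:E < +oo)%E -> 0 < e ->
  exists2 y, x < y & `|f y| < e.
Proof.
move=> mf fi e0; apply: contrapT => h.
have {}h y : x < y -> e <= `|f y|.
  by move=> xy; rewrite leNgt; apply/negP => fy; apply: h; exists y.
have := fi; rewrite ltNge => /negP; apply.
apply: (@le_trans _ _ (\int[mu]_(y in `]x, +oo[) e%:E)%E).
  by rewrite integral_cst//= lebesgue_measure_itv/= ltry gt0_muley ?lte_fin.
have mn : measurable_fun setT (fun y => (`|f y|)%:E).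
  by apply/measurable_EFinP; exact: measurableT_comp.
apply: (@le_trans _ _ (\int[mu]_(y in `]x, +oo[) (`|f y|)%:E)%E).
  apply: ge0_le_integral => //.
  - by move=> y _; rewrite lee_fin ltW.
  - exact: measurable_funTS.
  - by move=> y /=; rewrite in_itv/= andbT => xy; rewrite lee_fin h.
exact: ge0_subset_integral.
Qed.

Lemma integrable_small_left (R : realType) (f : R -> R) (x e : R) :
  measurable_fun setT f -> (\int[mu]_y (`|f y|)%:E < +oo)%E -> 0 < e ->
  exists2 y, y < x & `|f y| < e.
Proof.
move=> mf fi e0; apply: contrapT => h.
have {}h y : y < x -> e <= `|f y|.
  by move=> xy; rewrite leNgt; apply/negP => fy; apply: h; exists y.
have := fi; rewrite ltNge => /negP; apply.
apply: (@le_trans _ _ (\int[mu]_(y in `]-oo, x[) e%:E)%E).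
  by rewrite integral_cst//= lebesgue_measure_itv/= ltNyr gt0_muley ?lte_fin.
have mn : measurable_fun setT (fun y => (`|f y|)%:E).
  by apply/measurable_EFinP; exact: measurableT_comp.
apply: (@le_trans _ _ (\int[mu]_(y in `]-oo, x[) (`|f y|)%:E)%E).
  apply: ge0_le_integral => //.
  - by move=> y _; rewrite lee_fin ltW.
  - exact: measurable_funTS.
exact: ge0_subset_integral.
Qed.

(* The graph of |f| climbs through the band [alpha, beta] and comes down again. *)
Lemma band_crossing (R : realType) (f g : R -> R) (alpha beta xs : R) :
  continuous f -> locally_integrable setT g ->
  (forall a b, a <= b -> f b - f a = \int[mu]_(x in `]a, b]) g x) ->
  (\int[mu]_y (`|f y|)%:E < +oo)%E ->
  0 < alpha -> alpha < beta -> beta < `|f xs| ->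
  ((2 * (beta - alpha))%:E <=
    \int[mu]_(y in [set y | (alpha <= `|f y| <= beta)%R]) (`|g y|)%:E)%E.
Proof.
move=> cf lg fE fi al0 albe bex.
have mf : measurable_fun setT f by exact: continuous_measurable_fun.
have ch : continuous (fun x => `|f x|).
  by move=> x; apply: continuous_comp; [exact: cf|exact: norm_continuous].
have chN : continuous (fun x => - `|f x|).
  by move=> x; apply: cvgN; exact: ch.
have [y1 y1x fy1] := integrable_small_left xs mf fi al0.
have [y2 xy2 fy2] := integrable_small_right xs mf fi al0.
have [s1 [t1 [/andP[ys1 st1] tx1 hs1 ht1 band1]]] :=
  level_crossing ch (ltW y1x) albe (ltW fy1) (ltW bex).
have albeN : - beta < - alpha by rewrite ltrN2.
have [||s2 [t2 [/andP[xs2 st2] ty2 hs2 ht2 band2]]] := level_crossing chN (ltW xy2) albeN.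
- by rewrite lerN2 ltW.
- by rewrite lerN2 ltW.
have mg : measurable_fun setT g by case: lg.
have mng A : measurable_fun A (fun y => (`|g y|)%:E).
  by apply: measurable_funTS; apply/measurable_EFinP; exact: measurableT_comp.
have up : ((beta - alpha)%:E <= \int[mu]_(y in `]s1, t1]) (`|g y|)%:E)%E.
  apply: le_trans (norm_increment_le lg fE st1).
  by rewrite lee_fin -hs1 -ht1 (le_trans (ler_norm _))// ler_dist_dist.
have dn : ((beta - alpha)%:E <= \int[mu]_(y in `]s2, t2]) (`|g y|)%:E)%E.
  apply: le_trans (norm_increment_le lg fE st2).
  rewrite lee_fin -[beta]opprK -[alpha]opprK -hs2 -ht2 !opprK distrC.
  by rewrite (le_trans (ler_norm _))// ler_dist_dist.
rewrite mulr_natl mulr2n EFinD; apply: (le_trans (leeD up dn)).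
rewrite -ge0_integral_setU//.
- apply: ge0_subset_integral => //.
  + exact: measurableU.
  + rewrite (_ : mkset _ = setT `&` (fun x => `|f x|) @^-1` `[alpha, beta]).
      by apply: (continuous_measurable_fun ch) => //; exact: measurable_itv.
    by apply/seteqP; split => x /=; rewrite in_itv/=// => -[].
  + exact: mng.
  + move=> x [] /=; rewrite in_itv/= => /andP[sx xt].
      by apply: band1; rewrite (ltW sx).
    by have := band2 x; rewrite (ltW sx) xt !lerN2 => /(_ isT) /andP[-> ->].
- exact: mng.
- apply/disj_setPS => x [/=]; rewrite !in_itv/= => /andP[_ h1] /andP[h2 _].
  have := le_lt_trans h1 (le_lt_trans tx1 (le_lt_trans xs2 h2)).
  by rewrite ltxx.
Qed.

(** The end points of [I] need not belong to [I], and [|f|] need not attain [M]. So the crossing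
    estimate is used on a closed band inside [I] that misses less than [e / 4] at either end;
    counted twice, the loss is at most [e]. *)
Lemma interval_band_crossing (R : realType) (f g : R -> R) (I : set R) (M : R) :
  continuous f -> locally_integrable setT g ->
  (forall a b, a <= b -> f b - f a = \int[mu]_(x in `]a, b]) g x) ->
  (\int[mu]_y (`|f y|)%:E < +oo)%E ->
  (forall b, b < M -> exists x, b < `|f x|) ->
  is_interval I -> (forall p, I p -> 0 < p < M) ->
  (2%:E * mu I <= \int[mu]_(y in [set y | I (`|f y|)%R]) (`|g y|)%:E)%E.
Proof.
move=> cf lg fE fi supM itvI IM.
have ch : continuous (fun x => `|f x|).
  by move=> x; apply: continuous_comp; [exact: cf|exact: norm_continuous].
have mI : measurable I by exact: is_interval_measurable.
have mfI : measurable [set y | I `|f y|].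
  rewrite (_ : mkset _ = setT `&` (fun x => `|f x|) @^-1` I).
    exact: (continuous_measurable_fun ch).
  by apply/seteqP; split => x //= [].
have mg : measurable_fun setT g by case: lg.
have mng A : measurable_fun A (fun y => (`|g y|)%:E).
  by apply: measurable_funTS; apply/measurable_EFinP; exact: measurableT_comp.
have [->|/set0P I0] := eqVneq I set0.
  by rewrite measure0 mule0 integral_ge0.
have lbI : has_lbound I by exists 0 => p /IM /andP[/ltW].
have ubI : has_ubound I by exists M => p /IM /andP[_ /ltW].
have hi : inf I <= sup I.
  have [p Ip] := I0; apply: (@le_trans _ _ p).
    exact: ge_inf.
  exact: ub_le_sup.
have le1 : (mu I <= (sup I - inf I)%:E)%E.
  apply: (@le_trans _ _ (mu (`[inf I, sup I] : set R))).
    apply: le_measure; rewrite ?inE//.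
    move=> p Ip; rewrite /= in_itv/=; apply/andP; split.
      exact: ge_inf.
    exact: ub_le_sup.
  rewrite lebesgue_measure_itv/= lte_fin; case: ifPn => // _.
  by rewrite lee_fin subr_ge0.
apply: (@le_trans _ _ (2%:E * (sup I - inf I)%:E)%E).
  by rewrite lee_pmul2l.
apply/lee_addgt0Pr => e e0; have e40 : 0 < e / 4 by rewrite divr_gt0.
have [al Ial hal] : exists2 al, I al & al < inf I + e / 4.
  by apply: inf_adherent => //; split.
have [be Ibe hbe] : exists2 be, I be & sup I - e / 4 < be.
  by apply: sup_adherent => //; split.
have i0 : (0 <= \int[mu]_(y in [set y | I (`|f y|)%R]) (`|g y|)%:E)%E by exact: integral_ge0.
rewrite -EFinM; have [albe|beal] := ltP al be; last first.
  by rewrite -[leLHS]add0e leeD// lee_fin; lra.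
have /andP[al0 _] := IM _ Ial; have /andP[_ beM] := IM _ Ibe.
have [x bex] := supM _ beM.
apply: (@le_trans _ _ ((2 * (be - al))%:E + e%:E)%E); first by rewrite -EFinD lee_fin; lra.
apply: leeD => //; apply: (le_trans (band_crossing cf lg fE fi al0 albe bex)).
apply: ge0_subset_integral => //.
- rewrite (_ : mkset _ = setT `&` (fun x => `|f x|) @^-1` `[al, be]).
    by apply: (continuous_measurable_fun ch) => //; exact: measurable_itv.
  by apply/seteqP; split => y /=; rewrite in_itv/=// => -[].
- exact: mng.
- by move=> y /= h; apply: (itvI al be).
Qed.

(** Ensures a finite supremum, from which the lower bound takes its multiplier. On [[x, x + 1]] the
    bound [|g| <= 1 / 2 + g ^+ 2 / 2] gives [|f x| <= |f y| + 1 / 2 + e], and averaging over [y]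
    replaces [|f y|] by [n]. *)
Lemma integral_gradient_bounded (R : realType) (f g : R -> R) (n e x : R) :
  continuous f -> locally_integrable setT g ->
  (forall a b, a <= b -> f b - f a = \int[mu]_(x in `]a, b]) g x) ->
  (\int[mu]_y (`|f y|)%:E <= n%:E)%E ->
  (\int[mu]_y (2^-1 * g y ^+ 2)%:E <= e%:E)%E ->
  `|f x| <= n + (2^-1 + e).
Proof.
move=> cf lg fE fn ge.
have mf : measurable_fun setT f by exact: continuous_measurable_fun.
have mg : measurable_fun setT g by case: lg.
have mnf : measurable_fun setT (fun y => (`|f y|)%:E).
  by apply/measurable_EFinP; exact: measurableT_comp.
have mg2 : measurable_fun setT (fun y => (2^-1 * g y ^+ 2)%:E).
  apply/measurable_EFinP; apply: measurable_funM => //.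
  exact: measurable_funX.
have g20 y : (0 <= (2^-1 * g y ^+ 2)%:E)%E by rewrite lee_fin mulr_ge0 ?sqr_ge0 ?invr_ge0.
have inc y : x <= y <= x + 1 -> `|f x| <= `|f y| + (2^-1 + e).
  move=> /andP[xy yx1].
  have : ((`|f y - f x|)%:E <= (2^-1 + e)%:E)%E.
    apply: (le_trans (norm_increment_le lg fE xy)).
    apply: (@le_trans _ _ (\int[mu]_(z in `]x, y]) ((2^-1)%:E + (2^-1 * g z ^+ 2)%:E))%E).
      apply: ge0_le_integral => //.
      - by apply/measurable_EFinP; apply: measurable_funTS; exact: measurableT_comp.
      - by apply: emeasurable_funD => //; exact: measurable_funTS.
      - move=> z _; rewrite -EFinD lee_fin.
        have -> : g z ^+ 2 = `|g z| ^+ 2 by rewrite real_normK ?num_real.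
        have := sqr_ge0 (`|g z| - 1); rewrite !expr2; lra.
    rewrite ge0_integralD//; last exact: measurable_funTS.
    rewrite EFinD; apply: leeD.
      rewrite integral_cst//= lebesgue_measure_itv/= lte_fin; case: ifPn => _.
        by rewrite -EFinD -EFinM lee_fin; lra.
      by rewrite mule0 lee_fin invr_ge0.
    by apply: le_trans ge; apply: ge0_subset_integral.
  rewrite lee_fin => h; rewrite distrC in h.
  by have := ler_normD (f x - f y) (f y); rewrite subrK; lra.
rewrite -lee_fin.
have -> : ((`|f x|)%:E = \int[mu]_(y in `[x, (x + 1)%R]) (`|f x|)%:E)%E.
  rewrite integral_cst//= lebesgue_measure_itv/= lte_fin ltrDl ltr01.
  by rewrite -EFinD addrAC subrr add0r mule1.
have e0 : 0 <= 2^-1 + e.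
  have : (0 <= e%:E)%E by apply: le_trans ge; exact: integral_ge0.
  by rewrite lee_fin => ?; rewrite addr_ge0 ?invr_ge0.
apply: (@le_trans _ _ (\int[mu]_(y in `[x, (x + 1)%R]) ((`|f y|)%:E + (2^-1 + e)%:E))%E).
  apply: ge0_le_integral => //.
  by apply: emeasurable_funD => //; exact: measurable_funTS.
rewrite ge0_integralD//; last exact: measurable_funTS.
rewrite [leRHS]EFinD; apply: leeD.
  by apply: le_trans fn; apply: ge0_subset_integral.
rewrite integral_cst//= lebesgue_measure_itv/= lte_fin ltrDl ltr01.
by rewrite -EFinD addrAC subrr add0r mule1.
Qed.

(** A coarea inequality with multiplicity two. Applying the layer cake to both roots in the excess
    leaves the heights with [r ^+ 2 < A2 p] and [q ^+ 2 < p]. As the specific cost is nonincreasing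
    they form an interval, for which the crossing estimate is known. *)
Lemma coarea_excess (R : realType) (tau f g : R -> R) (M : R) :
  admissible_cost tau -> continuous f -> locally_integrable setT g ->
  (forall a b, a <= b -> f b - f a = \int[mu]_(x in `]a, b]) g x) ->
  (\int[mu]_y (`|f y|)%:E < +oo)%E -> 0 < M ->
  (forall b, b < M -> exists x, b < `|f x|) ->
  (2%:E * \int[mu]_p (excess tau (specific_cost tau M) p)%:E <=
   \int[mu]_y (`|g y| * excess tau (specific_cost tau M) `|f y|)%:E)%E.
Proof.
move=> adm cf lg fE fi M0 supM; set l := specific_cost tau M.
have mz := measurable_specific_cost adm.
have mf : measurable_fun setT f by exact: continuous_measurable_fun.
have mg : measurable_fun setT g by case: lg.
have mnf : measurable_fun setT (fun y => `|f y|) by exact: measurableT_comp.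
have mng : measurable_fun setT (fun y => `|g y|) by exact: measurableT_comp.
have msqrt : measurable_fun setT (@Num.sqrt R).
  by apply: continuous_measurable_fun; exact: sqrt_continuous.
pose A2 p := 2 * (specific_cost tau p - l).
have mA2 : measurable_fun setT A2.
  by apply: measurable_funM => //; exact: measurable_funB.
have mA1 : measurable_fun setT (fun y => A2 `|f y|) by exact: measurableT_comp.
rewrite /excess; under [leRHS]eq_integral do rewrite mulrA.
apply: (@le_integral_mul_sqrt R (fun y => `|g y| * Num.sqrt `|f y|) (fun y => A2 `|f y|)
  (@Num.sqrt R) A2) => //.
- by apply: measurable_funM => //; exact: measurableT_comp.
move=> r.
under [X in (_ * X <= _)%E]eq_integral do rewrite mulrC.
under [leRHS]eq_integral do rewrite mulrAC.
have m2 : measurable [set x | r ^+ 2 < A2 x] by exact: measurable_sqr_lt.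
have m1 : measurable [set x | r ^+ 2 < A2 `|f x|].
  exact: (measurable_sqr_lt r mA1).
apply: (@le_integral_mul_sqrt R (fun y => `|g y| * \1_[set x | r ^+ 2 < A2 `|f x|] y)
  (fun y => `|f y|) (\1_[set x | r ^+ 2 < A2 x]) idfun) => //.
- by apply: measurable_funM => //; exact: measurable_indic.
- exact: measurable_id.
move=> q; pose I := [set p | r ^+ 2 < A2 p /\ q ^+ 2 < p].
have Ipos p : I p -> 0 < p.
  by move=> [_]; apply: le_lt_trans; exact: sqr_ge0.
have := @interval_band_crossing R f g I M cf lg fE fi supM.
have hI : is_interval I.
  move=> p1 p2 I1 I2 p /andP[p1p pp2]; split; last first.
    by apply: lt_le_trans p1p; case: I1.
  have [h2 _] := I2; apply: (lt_le_trans h2).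
  rewrite /A2 ler_pM2l// lerB// specific_cost_nonincreasing//.
  by rewrite (lt_le_trans (Ipos _ I1)).
move=> /(_ hI) h.
have {}h := h _.
have mI : measurable I by exact: is_interval_measurable.
rewrite [X in (_ * X <= _)%E](_ : _ = mu I); last first.
  rewrite -[I in RHS]setIT -integral_indic//; apply: eq_integral => y _.
  by rewrite !indicE -natrM mulnb -in_setI.
rewrite [leRHS](_ : _ = \int[mu]_(y in [set y | I `|f y|%R]) (`|g y|)%:E)%E; last first.
  rewrite [RHS]integral_mkcond; apply: eq_integral => y _; rewrite patchE !indicE -mulrA.
  case: ifPn; rewrite ?notin_setE ?inE.
    by move=> /= [h1 h2]; rewrite !mem_set// !mulr1.
  move=> /= h1; have [h2|h2] := pselect (r ^+ 2 < A2 `|f y|); last first.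
    by rewrite memNset// mul0r mulr0.
  by rewrite [X in _ * X](_ : _ = 0) ?mulr0// mulrC memNset ?mul0r// => h3; apply: h1.
(* At heights [p >= M] the specific cost is at most [l], so [A2 p] is not positive and [p] is
   outside [I]. *)
apply: h => p Ip; rewrite (Ipos _ Ip)/= ltNge; apply/negP => Mp.
have [h1 _] := Ip; have := specific_cost_nonincreasing adm M0 Mp; rewrite -/l => h2.
have := sqr_ge0 r; move: h1; rewrite /A2; lra.
Qed.

(** With [l] the specific cost at the supremum [M], the difference of specific cost and [l] is
    nonnegative on the range of [|f|], and the excess vanishes above [M]; hence the heights crossed
    by [|f|] already carry the whole excess integral. The mass enters as an inequality, which
    absorbs changes of sign. *)
Lemma energy_lower_bound (R : realType) (tau f g : R -> R) (w : R) :
  admissible_cost tau -> continuous f -> locally_integrable setT g ->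
  (forall a b, a <= b -> f b - f a = \int[mu]_(x in `]a, b]) g x) ->
  (\int[mu]_y (`|f y|)%:E < +oo)%E -> 0 < w ->
  (w%:E <= \int[mu]_y (`|f y|)%:E)%E ->
  ((tau w)%:E <=
   \int[mu]_y (2^-1 * g y ^+ 2 + `|f y| * specific_cost tau `|f y|)%:E)%E.
Proof.
move=> adm cf lg fE fi w0 wf.
have mz := measurable_specific_cost adm.
have mf : measurable_fun setT f by exact: continuous_measurable_fun.
have mg : measurable_fun setT g by case: lg.
have mnf : measurable_fun setT (fun y => `|f y|) by exact: measurableT_comp.
have mg2 : measurable_fun setT (fun y => 2^-1 * g y ^+ 2).
  by apply: measurable_funM => //; exact: measurable_funX.
have mc : measurable_fun setT (fun y => `|f y| * specific_cost tau `|f y|).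
  by apply: measurable_funM => //; exact: measurableT_comp.
set E := (leRHS); have [->|Eoo] := eqVneq E +oo%E; first by rewrite leey.
have g20 y : 0 <= 2^-1 * g y ^+ 2 by rewrite mulr_ge0 ?sqr_ge0 ?invr_ge0.
have c0 y : 0 <= `|f y| * specific_cost tau `|f y|.
  by rewrite mulr_ge0// specific_cost_ge0.
have E0 : (0 <= E)%E by apply: integral_ge0 => y _; rewrite lee_fin addr_ge0.
have Ef : E \is a fin_num by rewrite ge0_fin_numE// ltey.
have nf : (\int[mu]_y (`|f y|)%:E)%E \is a fin_num.
  by rewrite ge0_fin_numE//; exact: integral_ge0.
have bnd x : `|f x| <= fine (\int[mu]_y (`|f y|)%:E)%E + (2^-1 + fine E).
  apply: (integral_gradient_bounded x cf lg fE); rewrite fineK//.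
  apply: ge0_le_integral => //.
  - by move=> y _; rewrite lee_fin.
  - exact/measurable_EFinP.
  - by apply/measurable_EFinP; exact: measurable_funD.
  - by move=> y _; rewrite lee_fin lerDl.
pose S := [set `|f x| | x in setT].
have hs : has_sup S.
  split; first by exists `|f 0|, 0.
  by exists (fine (\int[mu]_y (`|f y|)%:E)%E + (2^-1 + fine E)) => _ [x _ <-].
pose M := sup S.
have fM x : `|f x| <= M by apply: ub_le_sup; [case: hs|exists x].
have M0 : 0 < M.
  rewrite ltNge; apply/negP => M0.
  have : (\int[mu]_y (`|f y|)%:E = 0)%E.
    apply: integral0_eq => y _; congr EFin; apply: le_anti; rewrite normr_ge0 andbT.
    exact: le_trans (fM _) M0.
  by move=> h; move: wf; rewrite h lee_fin leNgt w0.
have supM b : b < M -> exists x, b < `|f x|.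
  by move=> bM; have [_ [x _ <-] bx] := sup_gt hs.1 bM; exists x.
have l0 := specific_cost_ge0 M adm.
have key := coarea_excess adm cf lg fE fi M0 supM.
set l := specific_cost tau M in l0 key.
have mex := measurable_excess l adm.
have mgex : measurable_fun setT (fun y => `|g y| * excess tau l `|f y|).
  by apply: measurable_funM => //; exact: measurableT_comp.
have gex0 y : 0 <= `|g y| * excess tau l `|f y| by rewrite mulr_ge0 ?excess_ge0.
apply: (le_trans (cost_le_excess adm l0 (ltW w0))).
apply: (@le_trans _ _ (\int[mu]_y (l * `|f y|)%:E +
    \int[mu]_y (`|g y| * excess tau l `|f y|)%:E)%E).
  apply: leeD => //.
  under eq_integral do rewrite EFinM.
  rewrite ge0_integralZl//.
  - by rewrite EFinM lee_wpmul2l ?lee_fin.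
  - exact/measurable_EFinP.
rewrite -ge0_integralD//; first last.
- exact/measurable_EFinP.
- by move=> y _; rewrite lee_fin.
- by apply/measurable_EFinP; exact: measurable_funM.
- by move=> y _; rewrite lee_fin mulr_ge0.
apply: ge0_le_integral => //.
- by move=> y _; rewrite -EFinD lee_fin addr_ge0// mulr_ge0.
- by apply/measurable_EFinP; apply: measurable_funD => //; exact: measurable_funM.
- by apply/measurable_EFinP; exact: measurable_funD.
move=> y _; rewrite -EFinD lee_fin.
have [fy0|fy0] := leP `|f y| 0.
  have -> : `|f y| = 0 by apply: le_anti; rewrite fy0 normr_ge0.
  by rewrite /excess sqrtr0 !mul0r !mulr0 !addr0.
have zl : 0 <= specific_cost tau `|f y| - l.
  by rewrite subr_ge0 specific_cost_nonincreasing.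
have -> : g y ^+ 2 = `|g y| ^+ 2 by rewrite real_normK ?num_real.
have ex2 : excess tau l `|f y| ^+ 2 = `|f y| * (2 * (specific_cost tau `|f y| - l)).
  by rewrite /excess exprMn !sqr_sqrtr// mulr_ge0.
(* Young's inequality: half the square of [|g|] plus half the square of the excess bounds their
   product. *)
have h := sqr_ge0 (`|g y| - excess tau l `|f y|).
rewrite !expr2 in ex2 h *; lra.
Qed.

(** * Optimal profiles *)

Lemma measure_eq_rays (R : realType) (m1 m2 : {measure set R -> \bar R}) :
  (forall x : R, (m1 `]x, +oo[%classic < +oo)%E) ->
  (forall x : R, m1 `]x, +oo[%classic = m2 `]x, +oo[%classic) ->
  forall A, measurable A -> m1 A = m2 A.
Proof.
move=> fin eq.
apply: (@measure_unique _ R R (@RGenOInfty.G R) (fun k => `](- k%:R), +oo[%classic)).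
- exact: RGenOInfty.measurableE.
- move=> _ _ [x ->] [y ->]; exists (Num.max x y).
  by apply/seteqP; split => z /=; rewrite !in_itv/= !andbT gt_max; [case=> -> ->|move=> /andP[]].
- by move=> k; exists (- k%:R).
- apply/seteqP; split => // x _; exists (Num.Def.truncn `|x|).+1 => //=.
  rewrite in_itv/= andbT ltrNl.
  have /andP[_] := truncn_itv (normr_ge0 x); apply: le_lt_trans.
  by rewrite -normrN ler_norm.
- by move=> _ [x ->]; exact: eq.
- by move=> k; exact: fin.
Qed.

(** The image under [chi] of the measure with density [k1] and the measure with density [k2] agree
    on rays, hence on all Borel sets. Writing [F] as the root of its square makes the layer cake
    applicable. *)
Lemma ge0_density_pushforward (R : realType) (k1 k2 chi F : R -> R) :
  measurable_fun setT k1 -> measurable_fun setT k2 -> measurable_fun setT chi ->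
  measurable_fun setT F ->
  (forall y, 0 <= k1 y) -> (forall y, 0 <= k2 y) -> (forall y, 0 <= F y) ->
  (\int[mu]_y (k1 y)%:E < +oo)%E ->
  (forall x : R, \int[mu]_(y in [set y | (x < chi y)%R]) (k1 y)%:E =
     \int[mu]_(y in `]x, +oo[) (k2 y)%:E)%E ->
  (\int[mu]_y (k1 y * F (chi y))%:E = \int[mu]_y (k2 y * F y)%:E)%E.
Proof.
move=> mk1 mk2 mchi mF k10 k20 F0 fin eq.
have ek10 y : (0 <= (k1 y)%:E)%E by rewrite lee_fin.
have ek20 y : (0 <= (k2 y)%:E)%E by rewrite lee_fin.
have emk1 : measurable_fun setT (EFin \o k1) by exact/measurable_EFinP.
have emk2 : measurable_fun setT (EFin \o k2) by exact/measurable_EFinP.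
pose nu1f (A : set R) := (\int[mu]_(y in A) (k1 y)%:E)%E.
pose nu2f (A : set R) := (\int[mu]_(y in A) (k2 y)%:E)%E.
have nu10 : nu1f set0 = 0%E by exact: integral_set0.
have nu20 : nu2f set0 = 0%E by exact: integral_set0.
have nu1p A : (0 <= nu1f A)%E by exact: integral_ge0.
have nu2p A : (0 <= nu2f A)%E by exact: integral_ge0.
have nu1s : semi_sigma_additive nu1f.
  exact: (@semi_sigma_additive_nng_induced _ _ R mu (EFin \o k1) emk1 ek10).
have nu2s : semi_sigma_additive nu2f.
  exact: (@semi_sigma_additive_nng_induced _ _ R mu (EFin \o k2) emk2 ek20).
pose nu1 : {measure set R -> \bar R} :=
  HB.pack nu1f (isMeasure.Build _ _ _ nu1f nu10 nu1p nu1s).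
pose nu2 : {measure set R -> \bar R} :=
  HB.pack nu2f (isMeasure.Build _ _ _ nu2f nu20 nu2p nu2s).
have mpre x : measurable (chi @^-1` `]x, +oo[).
  by rewrite -[X in measurable X]setTI; exact: mchi.
pose chim : {mfun R >-> R} := HB.pack chi (isMeasurableFun.Build _ _ _ _ chi mchi).
have E A : measurable A -> pushforward nu1 chim A = nu2 A.
  apply: measure_eq_rays => x.
    apply: le_lt_trans fin; apply: ge0_subset_integral => //.
    exact: mpre.
  rewrite -[RHS]/(\int[mu]_(y in `]x, +oo[) (k2 y)%:E)%E -eq.
  rewrite -[LHS]/(\int[mu]_(y in chi @^-1` `]x, +oo[) (k1 y)%:E)%E.
  congr (integral _ _ _).
  by apply/seteqP; split => y /=; rewrite in_itv/= andbT.
have mF2 : measurable_fun setT (fun y => F y ^+ 2) by exact: measurable_funX.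
have mFc2 : measurable_fun setT (fun y => F (chi y) ^+ 2).
  by apply: measurable_funX; exact: measurableT_comp.
have [_ e1] := layer_cake_mul_sqrt mk1 mFc2 k10.
have [_ e2] := layer_cake_mul_sqrt mk2 mF2 k20.
have sqrtF y : Num.sqrt (F y ^+ 2) = F y by rewrite sqrtr_sqr ger0_norm.
have : (2%:E * \int[mu]_y (k1 y * F (chi y))%:E =
    2%:E * \int[mu]_y (k2 y * F y)%:E)%E.
  under eq_integral do rewrite -sqrtF.
  under [X in (_ = _ * X)%E]eq_integral do rewrite -sqrtF.
  rewrite -e1 -e2; apply: eq_integral => r _.
  have h := E [set x | r ^+ 2 < F x ^+ 2] (measurable_sqr_lt r mF2).
  transitivity (nu1f (chi @^-1` [set x | r ^+ 2 < F x ^+ 2])).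
    rewrite /nu1f [RHS]integral_mkcond; apply: eq_integral => y _.
    rewrite patchE indicE; case: ifPn => yA.
      by rewrite mulr1.
    by rewrite mulr0.
  rewrite -[LHS]/(pushforward nu1 chim _) h.
  rewrite -[LHS]/(\int[mu]_(y in [set x | r ^+ 2 < F x ^+ 2]%R) (k2 y)%:E)%E.
  rewrite [LHS]integral_mkcond; apply: eq_integral => y _.
  by rewrite patchE indicE; case: ifPn => yA; rewrite ?mulr1 ?mulr0.
move=> h.
have := congr1 (fun x => ((2^-1)%:E * x)%E) h.
by rewrite !muleA -!EFinM mulVf// !mul1e.
Qed.

Lemma measurable_fun_inv_pos (R : realType) (s : R -> R) :
  measurable_fun setT s -> (forall p, 0 < s p) ->
  measurable_fun setT (fun p => (s p)^-1).
Proof.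
move=> ms s0; rewrite (_ : (fun p => (s p)^-1) = (@powR R)^~ (-1) \o s).
  by apply: measurableT_comp => //; exact: measurable_powR.
by apply/funext => p /=; rewrite powR_inv1// ltW.
Qed.

(** An integrated solution of rho' = -s(rho) for a speed that is only measurable: [D a] is the time
    at which height [a] is reached, and [rho] is the generalised inverse of [D]. The bound [e <= s]
    makes [D] Lipschitz and the travel time [S] finite. *)
Lemma speed_profile (R : realType) (s : R -> R) (M L e : R) :
  measurable_fun setT s -> 0 < e -> (forall p, e <= s p) -> 0 < M -> 0 <= L ->
  exists (S : R) (rho : R -> R),
  [/\ [/\ 0 <= S, {homo rho : x y /~ x <= y}, (forall y, 0 <= rho y <= M),
        (forall y, y <= L -> rho y = M) & (forall y, L + S <= y -> rho y = 0)],
    (forall F : R -> R, measurable_fun setT F -> (forall p, 0 <= F p)%R ->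
      \int[mu]_y (\1_(`]L, (L + S)%R]) y * F (rho y))%:E =
      \int[mu]_p (\1_(`]0%R, M]) p / s p * F p)%:E)%E &
    (forall y, \int[mu]_(x in `]y, +oo[) (\1_(`]L, (L + S)%R]) x * s (rho x))%:E =
      (rho y)%:E)%E].
Proof.
move=> ms e0 es M0 L0.
have s0 p : 0 < s p by exact: lt_le_trans (es p).
have sV0 p : 0 <= (s p)^-1 by rewrite invr_ge0 ltW.
have msV := measurable_fun_inv_pos ms s0.
have emsV A : measurable_fun A (fun p => ((s p)^-1)%:E).
  by apply: measurable_funTS; exact/measurable_EFinP.
pose I a b := (\int[mu]_(p in `]a, b]) ((s p)^-1)%:E)%E.
have I0 a b : (0 <= I a b)%E by apply: integral_ge0 => p _; rewrite lee_fin.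
have Iub a b : a <= b -> (I a b <= ((b - a) / e)%:E)%E.
  move=> ab; apply: (@le_trans _ _ (\int[mu]_(p in `]a, b]) (e^-1)%:E)%E).
    apply: ge0_le_integral => //.
    - by move=> p _; rewrite lee_fin.
    - exact: emsV.
    - by move=> p _; rewrite lee_fin lef_pV2 ?posrE.
  rewrite integral_cst//= lebesgue_measure_itv/= lte_fin; case: ifPn => _.
    by rewrite -EFinD -EFinM lee_fin mulrC.
  by rewrite mule0 lee_fin divr_ge0 ?subr_ge0// ltW.
have If a b : I a b \is a fin_num.
  have [ab|ba] := leP a b.
    by rewrite ge0_fin_numE// (le_lt_trans (Iub _ _ ab))// ltry.
  by rewrite /I set_itv_ge ?integral_set0// bnd_simp -leNgt ltW.
have Iadd a b c : a <= b -> b <= c -> (I a c = I a b + I b c)%E.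
  move=> ab bc; rewrite /I -ge0_integral_setU//=.
  - by congr (integral _ _ _); rewrite -itv_bndbnd_setU.
  - exact: emsV.
  - by move=> p _; rewrite lee_fin.
  - apply/disj_setPS => v [/=]; rewrite !in_itv/= => /andP[_ vy] /andP[yv _].
    by move: (le_lt_trans vy yv); rewrite ltxx.
pose D a := L + fine (I a M).
have DM : D M = L by rewrite /D /I set_itvoc0 ?integral_set0 ?addr0.
have Dlip a b : a <= b -> b <= M -> D b <= D a <= D b + (b - a) / e.
  move=> ab bM; have h0 := fine_ge0 (I0 a b).
  have h1 := Iub _ _ ab; rewrite -(fineK (If a b)) lee_fin in h1.
  rewrite /D (Iadd a b M)// (fineD (If a b) (If b M)).
  move: ((b - a) / e) (fine (I a b)) (fine (I b M)) h0 h1 => q u v h0 h1.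
  by apply/andP; split; lra.
pose S := fine (I 0 M); have S0 : 0 <= S by exact: fine_ge0.
have D0 : D 0 = L + S by [].
(* Replacing [y] by [max y L] keeps the profile on its plateau to the left of [L]. *)
pose A y := [set p : R | 0 <= p <= M /\ D p <= Num.max y L].
have AM y : A y M by split; [rewrite (ltW M0) lexx|rewrite DM le_max lexx orbT].
have lbA y : has_lbound (A y) by exists 0 => p [/andP[]].
pose rho y := inf (A y).
have rho_itv y : 0 <= rho y <= M.
  apply/andP; split; last exact: ge_inf.
  by apply: lb_le_inf; [exists M|move=> p [/andP[]]].
have Drho y : D (rho y) <= Num.max y L.
  apply/ler_addgt0Pr => d d0.
  have de0 : 0 < d * e by rewrite mulr_gt0.
  have [a Aa arho] : exists2 a, A y a & a < inf (A y) + d * e.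
    by apply: inf_adherent => //; split => //; exists M.
  have ra : rho y <= a by exact: ge_inf.
  have [/andP[_ aM] Da] := Aa.
  have /andP[_ h] := Dlip _ _ ra aM.
  apply: (le_trans h); apply: lerD => //; rewrite ler_pdivrMr//.
  by rewrite lerBlDl ltW.
have galois y p : 0 <= p <= M -> (rho y <= p) = (D p <= Num.max y L).
  move=> /andP[p0 pM]; apply/idP/idP => [h|h].
    by apply: le_trans (Drho y); have /andP[] := Dlip _ _ h pM.
  by apply: ge_inf => //; split => //; rewrite p0.
have rho_ni : {homo rho : x y /~ x <= y}.
  move=> x y yx; rewrite galois//; apply: (le_trans (Drho y)).
  by rewrite ge_max le_max yx/= le_max lexx orbT.
have mrho : measurable_fun setT rho.
  by apply: nonincreasing_measurable => // x y xy; exact: rho_ni.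
have rho0 y : L + S <= y -> rho y = 0.
  move=> h; apply: le_anti; have /andP[-> _] := rho_itv y; rewrite andbT.
  by rewrite galois ?lexx ?(ltW M0)// D0 le_max h.
pose k1 := \1_(`]L, (L + S)]) : R -> R.
pose k2 p := \1_(`]0, M]) p / s p : R.
have mk1 : measurable_fun setT k1 by exact: measurable_indic.
have mk2 : measurable_fun setT k2.
  by apply: measurable_funM => //; exact: measurable_indic.
have k20 p : 0 <= k2 p by rewrite mulr_ge0.
have ik1 B : measurable B -> (\int[mu]_(y in B) (k1 y)%:E = mu (`]L, (L + S)%R] `&` B))%E.
  by move=> mB; rewrite integral_indic.
have ik2 x : (\int[mu]_(p in `]x, +oo[) (k2 p)%:E = I (Num.max x 0%R) M)%E.
  rewrite /I integral_mkcond [RHS]integral_mkcond; apply: eq_integral => p _.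
  rewrite !patchE /k2 indicE; case: ifPn => h1; case: ifPn => h2.
  - rewrite mem_set ?mul1r//; move: h2; rewrite inE/= !in_itv/= gt_max.
    by move=> /andP[/andP[_ ->] ->].
  - rewrite memNset ?mul0r//= in_itv/= => /andP[p0 pM].
    move: h1 h2; rewrite inE notin_setE/= !in_itv/= andbT gt_max => xp; apply.
    by rewrite xp p0.
  - exfalso; move: h1 h2; rewrite inE notin_setE/= !in_itv/= andbT gt_max.
    by move=> xp /andP[/andP[h _] _].
  - by [].
have push (F : R -> R) : measurable_fun setT F -> (forall p, 0 <= F p) ->
    (\int[mu]_y (k1 y * F (rho y))%:E = \int[mu]_p (k2 p * F p)%:E)%E.
  move=> mF F0; apply: ge0_density_pushforward => //.
    rewrite ik1// setIT lebesgue_measure_itv/=; case: ifPn => // _.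
    by rewrite -EFinB ltry.
  move=> x; rewrite ik2 ik1; last first.
    rewrite (_ : mkset _ = setT `&` rho @^-1` `]x, +oo[).
      by apply: mrho => //; exact: measurable_itv.
    by apply/seteqP; split => y /=; rewrite in_itv/= andbT// => -[].
  have [xM|Mx] := ltP M x.
    rewrite [X in I X _]max_l ?(ltW (lt_trans M0 xM))// /I [in RHS]set_itv_ge; last first.
      by rewrite bnd_simp -leNgt ltW.
    rewrite integral_set0 (_ : _ `&` _ = set0) ?measure0//.
    apply/seteqP; split => y //= [_ xy]; have /andP[_ h] := rho_itv y.
    by move: (lt_le_trans xy (le_trans h (ltW xM))); rewrite ltxx.
  have [x0|x0] := ltP x 0.
    rewrite (_ : _ `&` _ = `]L, L + S]%classic); last first.
      apply/seteqP; split => y /=; first by case.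
      move=> yi; split => //; have /andP[h _] := rho_itv y; exact: lt_le_trans h.
    rewrite lebesgue_measure_itv/= lte_fin -[RHS](fineK (If _ _)) -/S.
    case: ifPn => [_|]; first by rewrite -EFinB addrAC subrr add0r.
    rewrite -leNgt gerDl => S0'; congr EFin; apply: le_anti.
    by rewrite S0 S0'.
  rewrite -[RHS](fineK (If _ _)).
  rewrite (_ : _ `&` _ = `]L, D x[%classic); last first.
    apply/seteqP; split => y /=; rewrite !in_itv/=.
      move=> [/andP[Ly yS] xy]; rewrite Ly/= ltNge; apply/negP => Dy.
      move: xy; rewrite ltNge => /negP; apply; rewrite galois ?x0//.
      by rewrite le_max Dy.
    move=> /andP[Ly yD]; split.
      rewrite Ly/= ltW// (lt_le_trans yD)// -D0.
      by have /andP[] := Dlip _ _ x0 Mx.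
    rewrite ltNge galois ?x0// -ltNge gt_max yD/=.
    exact: lt_trans yD.
  rewrite lebesgue_measure_itv/= lte_fin; case: ifPn => [_|].
    by rewrite -EFinB /D addrAC subrr add0r.
  rewrite -leNgt /D gerDl => h; congr EFin; apply: le_anti.
  by rewrite h fine_ge0.
(* The test function [s] times the indicator of heights up to [c] cancels the density [1 / s], and
   only the length of []0, c]] remains. *)
have pushs (c : R) : 0 <= c <= M ->
    (\int[mu]_y (k1 y * (s (rho y) * \1_(`]-oo, c]) (rho y)))%:E = c%:E)%E.
  move=> /andP[c0 cM].
  rewrite (push (fun p => s p * \1_(`]-oo, c]) p)); first last.
  - by move=> p; rewrite mulr_ge0// ltW.
  - by apply: measurable_funM => //; exact: measurable_indic.
  transitivity (\int[mu]_p (\1_(`]0%R, c]) p)%:E)%E; last first.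
    rewrite integral_indic//= setIT lebesgue_measure_itv/= lte_fin.
    case: ifPn => [_|]; first by rewrite -EFinB subr0.
    by rewrite -leNgt => c0'; congr EFin; apply: le_anti; rewrite c0 c0'.
  have cE : `]0, c]%classic = `]0, M]%classic `&` `]-oo, c]%classic :> set R.
    apply/seteqP; split => x /=; rewrite !in_itv/=.
      by move=> /andP[-> xc]; rewrite xc (le_trans xc).
    by move=> [/andP[-> _] ->].
  apply: eq_integral => p _; congr EFin; rewrite /k2 mulrA divfK ?gt_eqF//.
  by rewrite cE !indicE -natrM mulnb -in_setI.
(* On []L, L + S]] the profile is below [rho L] as well as below [M], so both instances of [pushs]
   have the same integrand. *)
have rhoLM : rho L = M.
  apply/EFin_inj; rewrite -(pushs (rho L))// -(pushs M) ?(ltW M0) ?lexx//.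
  apply: eq_integral => y _; congr EFin.
  rewrite /k1 !indicE; have [h|h] := boolP (y \in `]L, (L + S)]%classic); last by rewrite !mul0r.
  rewrite !mul1r; congr (_ * _); rewrite !mem_set//=; rewrite in_itv/=.
    by have /andP[] := rho_itv y.
  by rewrite rho_ni//; move: h; rewrite inE/= in_itv/= => /andP[/ltW].
exists S, rho; split => //.
- split => // y yL; rewrite -rhoLM /rho /A; congr inf.
  by rewrite (max_r yL) maxxx.
- move=> y; rewrite -[RHS](pushs (rho y))// integral_mkcond.
  pose yy := D (rho y).
  (* As [D] has no jumps, [rho] has no flat pieces between [L] and [L + S]: the time at which the
     height [rho y] is reached is [y] clamped to that interval. So within it the ray beyond [y] and
     the set where [rho] is at most [rho y] differ at most at [yy]. *)
  have yyE : yy = Num.min (Num.max y L) (L + S).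
    apply: le_anti; rewrite le_min Drho/= -D0; have /andP[r0 rM] := rho_itv y.
    have /andP[-> _]/= := Dlip _ _ r0 rM.
    rewrite ge_min; have [r00|rn0] := eqVneq (rho y) 0.
      by rewrite /yy r00 lexx orbT.
    have rp : 0 < rho y by rewrite lt_neqAle eq_sym rn0.
    rewrite leNgt; apply/orP; left; apply/negP => h.
    have hd : 0 < (Num.max y L - yy) * e by rewrite mulr_gt0// subr_gt0.
    pose d := Num.min (rho y) ((Num.max y L - yy) * e).
    have d0 : 0 < d by rewrite lt_min rp hd.
    have dr : rho y - d <= rho y by rewrite gerDl oppr_le0 ltW.
    have d1 : 0 <= rho y - d by rewrite subr_ge0 ge_min lexx.
    have /andP[_ h2] := Dlip _ _ dr rM.
    have : rho y <= rho y - d.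
      rewrite galois; last by rewrite d1 (le_trans dr).
      apply: (le_trans h2); rewrite opprB addrCA subrr addr0 -lerBrDl ler_pdivrMr//.
      by rewrite ge_min lexx orbT.
    by rewrite lerDl oppr_ge0 leNgt d0.
  apply: (@ae_eq_integral _ _ R mu setT) => //.
  + apply/(measurable_restrictT _ _).1 => //; apply: measurable_funTS.
    apply/measurable_EFinP; apply: measurable_funM => //; exact: measurableT_comp.
  + apply/measurable_EFinP; apply: measurable_funM => //.
    apply: measurable_funM; first exact: measurableT_comp.
    by apply: measurableT_comp => //; exact: measurable_indic.
  + exists [set yy]; split => //; first exact: lebesgue_measure_set1.
    move=> x /= h; apply: contrapT => xyy; apply: h => _.
    rewrite patchE /k1 !indicE; case: ifPn => hx.
      have [hi|hi] := boolP (x \in `]L, (L + S)]%classic); last by rewrite !mul0r.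
      rewrite !mul1r mem_set ?mulr1//= in_itv/=; apply: rho_ni.
      by move: hx; rewrite inE/= in_itv/= andbT => /ltW.
    have [hi|hi] := boolP (x \in `]L, (L + S)]%classic); last by rewrite !mul0r.
    rewrite memNset ?mulr0//= in_itv/= galois// -/yy.
    move: hi hx; rewrite inE notin_setE/= !in_itv/= andbT => /andP[Lx xS] /negP.
    rewrite -leNgt => xy; rewrite (max_l (ltW Lx)) => yyx; apply: xyy.
    apply: le_anti; rewrite yyx andbT yyE le_min xS andbT le_max xy.
    by [].
Qed.

(** * Even reflection and the energy of a profile *)

Lemma ge0_integral_opp (R : realType) (f : R -> \bar R) :
  measurable_fun setT f -> (forall x, (0 <= f x)%E) ->
  (\int[mu]_x f (- x)%R = \int[mu]_x f x)%E.
Proof.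
move=> mf f0; symmetry.
transitivity (\int[pushforward mu (-%R : R -> measurableTypeR R)]_x f x)%E.
  by apply: eq_measure_integral => A mA _; exact/esym/lebesgue_measureN.
by rewrite ge0_integral_pushforward.
Qed.

Lemma integral_opp (R : realType) (f : R -> \bar R) :
  measurable_fun setT f -> (\int[mu]_x f (- x)%R = \int[mu]_x f x)%E.
Proof.
move=> mf; rewrite integralE [RHS]integralE; congr (_ - _)%E.
  rewrite -(ge0_integral_opp (measurable_funepos mf) (funepos_ge0 f)).
  by apply: eq_integral => x _; rewrite !funeposE.
rewrite -(ge0_integral_opp (measurable_funeneg mf) (funeneg_ge0 f)).
by apply: eq_integral => x _; rewrite !funenegE.
Qed.

Lemma ge0_integral_even (R : realType) (G : R -> \bar R) :
  measurable_fun setT G -> (forall x, (0 <= G x)%E) ->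
  (\int[mu]_y G `|y|%R = 2%:E * \int[mu]_(y in `]0%R, +oo[) G y)%E.
Proof.
move=> mG G0.
have mGn : measurable_fun setT (fun y : R => G `|y|) by exact: measurableT_comp.
have -> : [set: R] = `]-oo, 0] `|` `]0, +oo[ :> set R.
  by apply/seteqP; split => x //= _; rewrite !in_itv/= andbT; case: leP => _; [left|right].
rewrite ge0_integral_setU//; first last.
- apply/disj_setPS => x [/=]; rewrite !in_itv/= andbT => x0 x1.
  by move: (le_lt_trans x0 x1); rewrite ltxx.
- exact: measurable_funTS.
rewrite (_ : 2%:E = 1 + 1)%E// ge0_muleDl//.
rewrite !mul1e; congr (_ + _)%E.
  rewrite integral_itv_obnd_cbnd; last exact: measurable_funTS.
  rewrite ge0_integration_by_substitution0//; apply: eq_integral => y.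
  by rewrite inE/= in_itv/= => y0; rewrite ler0_norm.
by apply: eq_integral => y; rewrite inE/= in_itv/= andbT => y0; rewrite gtr0_norm.
Qed.

Lemma bounded_compact_support (R : realType) (f : R -> R) (M : R) :
  continuous f -> (forall x, M < `|x| -> f x = 0) ->
  exists B, forall x, `|f x| <= B.
Proof.
move=> cf f0.
have cn : {within `[- `|M|, `|M|], continuous (fun x => `|f x|)}.
  apply: continuous_subspaceT => x; apply: continuous_comp; first exact: cf.
  exact: norm_continuous.
have MM : - `|M| <= `|M| by rewrite (@le_trans _ _ 0)// oppr_le0.
have [c _ cm] := EVT_max MM cn.
exists `|f c| => x; have [xI|] := boolP (x \in `[- `|M|, `|M|]); first exact: cm.
rewrite in_itv/= -ler_norml -ltNge => h.
by rewrite f0 ?normr0// (le_lt_trans (ler_norm M)).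
Qed.

Lemma integrable_compact_support (R : realType) (f : R -> R) (M : R) :
  continuous f -> (forall x, M < `|x| -> f x = 0) ->
  mu.-integrable setT (EFin \o f).
Proof.
move=> cf f0.
have fE : EFin \o f = (EFin \o f) \_ `[- `|M|, `|M|].
  apply/funext => x; rewrite patchE; case: ifPn => //.
  rewrite notin_setE/= in_itv/= -ler_norml => /negP; rewrite -ltNge => h.
  by rewrite f0// (le_lt_trans (ler_norm M)).
rewrite fE; apply/(integrable_mkcond _ _).1 => //.
apply: continuous_compact_integrable; first exact: segment_compact.
exact: continuous_subspaceT.
Qed.

Lemma derive1_compact_support (R : realType) (f : R -> R) (M : R) :
  (forall x, M < `|x| -> f x = 0) -> forall x, M < `|x| -> derive1 f x = 0.
Proof.
move=> f0 x Mx; rewrite derive1E (near_eq_derive (g := cst (0 : R))) ?derive_cst//.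
near=> y; apply: f0; near: y.
by apply: (cvgr_gt `|x|) => //; exact: norm_continuous.
Unshelve. all: by end_near. Qed.

(* The layers [-x, x] of an even profile carry the density k, and integrating a
   derivative over such a layer leaves its two end points. *)
Lemma even_profile_weak_derivative (R : realType) (k rho : R -> R) :
  measurable_fun setT k -> (forall x, 0 <= k x) -> (forall x, x <= 0 -> k x = 0) ->
  (\int[mu]_x (k x)%:E < +oo)%E ->
  (forall y, \int[mu]_(x in `]y, +oo[) (k x)%:E = (rho y)%:E)%E ->
  mu.-integrable setT (EFin \o (fun y => rho `|y|)) ->
  weak_derivative (fun y => rho `|y|) (fun x => k (- x) - k x).
Proof.
move=> mk k0 kneg kfin rhoE irho.
have ik : mu.-integrable setT (EFin \o k).
  apply/integrableP; split; first exact/measurable_EFinP.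
  by apply: le_lt_trans kfin; under eq_integral do rewrite /= ger0_norm//.
have mkN : measurable_fun setT (fun x : R => k (- x)) by exact: measurableT_comp.
have ikN : mu.-integrable setT (EFin \o (fun x => k (- x))).
  apply/integrableP; split; first exact/measurable_EFinP.
  under eq_integral do rewrite /= ger0_norm//.
  by rewrite (ge0_integral_opp (f := EFin \o k))//; exact/measurable_EFinP.
have ig : mu.-integrable setT (EFin \o (fun x => k (- x) - k x)).
  rewrite (_ : _ \o _ = ((EFin \o (fun x => k (- x)%R)) \- (EFin \o k))%E)//.
  exact: integrableB.
split.
- by apply: open_integrable_locally => //; exact: openT.
- by apply: open_integrable_locally => //; exact: openT.
move=> eta [sm [M suppM]].
have deta x : derivable eta x 1 by have := sm 0%N x; rewrite derive1n0.
have ddeta x : derivable (derive1 eta) x 1 by have := sm 1%N x; rewrite derive1n1.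
have ceta : continuous eta.
  by move=> x; apply/differentiable_continuous/derivable1_diffP.
have cdeta : continuous (derive1 eta).
  by move=> x; apply/differentiable_continuous/derivable1_diffP.
have suppM' := derive1_compact_support suppM.
have [B etaB] := bounded_compact_support ceta suppM.
have meta : measurable_fun setT eta by exact: continuous_measurable_fun.
have mdeta : measurable_fun setT (derive1 eta) by exact: continuous_measurable_fun.
have ideta := integrable_compact_support cdeta suppM'.
have iketa : mu.-integrable setT (fun x => (k x * eta x)%:E).
  exact: (integrable_mul_bounded measurableT ik meta (fun x _ => etaB x)).
have metaN : measurable_fun setT (fun x : R => eta (- x)) by exact: measurableT_comp.
have iketaN : mu.-integrable setT (fun x => (k x * eta (- x))%:E).
  exact: (integrable_mul_bounded measurableT ik metaN (fun x _ => etaB (- x))).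
have ikNeta : mu.-integrable setT (fun x => (k (- x) * eta x)%:E).
  exact: (integrable_mul_bounded measurableT ikN meta (fun x _ => etaB x)).
have ftc (x : R) : 0 < x ->
    (\int[mu]_(y in `[(- x)%R, x]) (derive1 eta y)%:E = (eta x - eta (- x))%:E)%E.
  move=> x0; have xx : - x < x by lra.
  rewrite (@continuous_FTC2 R (derive1 eta) eta (- x) x xx).
  - by [].
  - by apply: continuous_subspaceT.
  - split; first by move=> y _; exact: deta.
    + by apply: cvg_at_right_filter; exact: ceta.
    + by apply: cvg_at_left_filter; exact: ceta.
  - by [].
(* The value [rho |y|] is the integral of [k x] over [x > |y|]. Fubini's theorem on this region is
   justified by the dominating product [G] below. *)
pose A := [set x : R * R | `|x.2| < x.1].
have mA : measurable A.
  rewrite (_ : A = setT `&` (fun x : R * R => x.1 - `|x.2|) @^-1` `]0, +oo[).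
    have mf : measurable_fun setT (fun x : R * R => x.1 - `|x.2|).
      apply: measurable_funB; first exact: measurable_fst.
      by apply: measurableT_comp => //; exact: measurable_snd.
    by apply: mf => //; exact: measurable_itv.
  by apply/seteqP; split => x /=; rewrite in_itv/= andbT subr_gt0// => -[].
pose F (x : R * R) := (k x.1 * \1_A x * derive1 eta x.2)%:E.
have mF : measurable_fun setT F.
  apply/measurable_EFinP; apply: measurable_funM.
    apply: measurable_funM; first by apply: measurableT_comp => //; exact: measurable_fst.
    exact: measurable_indic.
  by apply: measurableT_comp => //; exact: measurable_snd.
pose G (x : R * R) := (k x.1 * `|derive1 eta x.2|)%:E.
have mG : measurable_fun setT G.
  apply/measurable_EFinP; apply: measurable_funM.
    by apply: measurableT_comp => //; exact: measurable_fst.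
  by do 2 apply: measurableT_comp => //; exact: measurable_snd.
have G0 z : (0 <= G z)%E by rewrite lee_fin mulr_ge0.
have FG z : (`|F z| <= G z)%E.
  rewrite /F /G abse_EFin lee_fin !normrM ger0_norm// ler_wpM2r//.
  by rewrite -[leRHS]mulr1 ler_wpM2l// indicE; case: (_ \in _); rewrite ?normr1 ?normr0.
have mFa : measurable_fun setT (fun z => `|F z|%E) by exact: measurableT_comp.
have iF : (lebesgue_measure \x lebesgue_measure)%E.-integrable setT F.
  apply/integrable12ltyP => //.
  apply: (@le_lt_trans _ _ (\int[mu]_x \int[mu]_y G (x, y))%E).
    apply: ge0_le_integral => //.
    - by move=> x _; exact: integral_ge0.
    - exact: (measurable_fun_lebesgue_integral mFa).
    - exact: (measurable_fun_lebesgue_integral mG).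
    - move=> x _; apply: ge0_le_integral => //.
      + exact: (measurableT_comp mFa (pair1_measurable x)).
      + exact: (measurableT_comp mG (pair1_measurable x)).
  pose N := (\int[mu]_y (`|derive1 eta y|)%:E)%E.
  have N0 : (0 <= N)%E by exact: integral_ge0.
  have Nfin : N \is a fin_num.
    by rewrite ge0_fin_numE//; move/integrableP : ideta => [].
  rewrite (_ : (\int[mu]_x \int[mu]_y G (x, y))%E = (\int[mu]_x (N * (k x)%:E))%E).
    rewrite ge0_integralZl//; first last.
    - by move=> x _; rewrite lee_fin.
    - exact/measurable_EFinP.
    by rewrite lte_mul_pinfty.
  apply: eq_integral => x _; rewrite muleC -ge0_integralZl//; last by rewrite lee_fin.
  by apply/measurable_EFinP; exact: measurableT_comp.
have key : (\int[mu]_y (rho `|y| * derive1 eta y)%:E =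
    \int[mu]_x (k x * (eta x - eta (- x)))%:E)%E.
  transitivity (\int[mu]_y \int[mu]_x F (x, y))%E.
    apply: eq_integral => y _.
    rewrite mulrC EFinM -rhoE integral_mkcond -integralZl//; last first.
      apply/(integrable_mkcond _ _).1 => //.
      by apply: (@integrableS _ _ _ mu setT) => //; exact: ik.
    apply: eq_integral => x _; rewrite /F /= patchE indicE.
    case: ifPn => h.
      rewrite mem_set ?mulr1 ?EFinM 1?muleC//.
      by move: h; rewrite inE/= in_itv/= andbT.
    rewrite mule0 memNset ?mulr0 ?mul0r// => h2.
    by move: h; rewrite notin_setE/= in_itv/= andbT; apply.
  rewrite -(Fubini iF); apply: eq_integral => x _.
  have [x0|x0] := leP x 0.
    by rewrite kneg// mul0r; apply: integral0_eq => y _; rewrite /F/= kneg// !mul0r.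
  transitivity (\int[mu]_(y in `[(- x)%R, x]) ((k x)%:E * (derive1 eta y)%:E))%E.
    rewrite -integral_itv_obnd_cbnd; last first.
      by apply: measurable_funeM; apply/measurable_EFinP; exact: measurable_funTS.
    rewrite -integral_itv_bndo_bndc; last first.
      by apply: measurable_funeM; apply/measurable_EFinP; exact: measurable_funTS.
    rewrite [RHS]integral_mkcond; apply: eq_integral => y _; rewrite /F/= patchE indicE.
    case: ifPn => h.
      rewrite mem_set ?mulr1//.
      by move: h; rewrite inE/= in_itv/= -ltr_norml.
    rewrite memNset ?mulr0 ?mul0r// => h2.
    by move: h; rewrite notin_setE/= in_itv/= -ltr_norml; apply.
  rewrite integralZl//; last by apply: (@integrableS _ _ _ mu setT).
  by rewrite ftc// -EFinM.
rewrite key.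
transitivity (\int[mu]_x (k x * eta x)%:E - \int[mu]_x (k x * eta (- x))%:E)%E.
  by rewrite -integralB//; apply: eq_integral => x _; rewrite /= -EFinB mulrBr.
rewrite -(@integral_opp R (fun x => (k x * eta (- x))%:E)); last first.
  by apply/measurable_EFinP; exact: measurable_funM.
under [X in (_ - X)%E]eq_integral do rewrite opprK.
have -> : (\int[mu]_x ((k (- x) - k x) * eta x)%:E =
    \int[mu]_x (k (- x) * eta x)%:E - \int[mu]_x (k x * eta x)%:E)%E.
  by rewrite -integralB//; apply: eq_integral => x _; rewrite /= -EFinB mulrBl.
have f1 := integrable_fin_num measurableT iketa.
have f2 := integrable_fin_num measurableT ikNeta.
by rewrite -(fineK f1) -(fineK f2) -!EFinB -EFinN opprB.
Qed.

Lemma even_profile_integral (R : realType) (rho F k2 : R -> R) (L S M : R) :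
  0 <= L -> 0 <= S -> measurable_fun setT rho ->
  (forall y, y <= L -> rho y = M) -> (forall y, L + S <= y -> rho y = 0) ->
  measurable_fun setT F -> (forall p, 0 <= F p) -> F 0 = 0 ->
  (\int[mu]_y (\1_(`]L, (L + S)%R]) y * F (rho y))%:E =
   \int[mu]_p (k2 p * F p)%:E)%E ->
  (\int[mu]_y (F (rho `|y|))%:E =
   2%:E * ((L * F M)%:E + \int[mu]_p (k2 p * F p)%:E))%E.
Proof.
move=> L0 S0 mrho rhoL rhoS mF F0 F00 push.
have mFr : measurable_fun setT (fun y => (F (rho y))%:E).
  by apply/measurable_EFinP; exact: measurableT_comp.
have Fr0 y : (0 <= (F (rho y))%:E)%E by rewrite lee_fin.
rewrite (@ge0_integral_even R (fun y => (F (rho y))%:E))//; congr (_ * _)%E.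
have -> : `]0, +oo[%classic = `]0, L]%classic `|` `]L, +oo[%classic :> set R.
  by rewrite -itv_bndbnd_setU// bnd_simp.
rewrite ge0_integral_setU//; first last.
- apply/disj_setPS => v [/=]; rewrite !in_itv/= andbT => /andP[_ vy] yv.
  by move: (le_lt_trans vy yv); rewrite ltxx.
- exact: measurable_funTS.
congr (_ + _)%E.
  transitivity (\int[mu]_(y in `]0%R, L]) (F M)%:E)%E.
    by apply: eq_integral => y; rewrite inE/= in_itv/= => /andP[_ yL]; rewrite rhoL.
  rewrite integral_cst//= lebesgue_measure_itv/= lte_fin; case: ifPn => [_|].
    by rewrite -EFinB subr0 -EFinM mulrC.
  rewrite -leNgt => L0'; have -> : L = 0 by apply: le_anti; rewrite L0' L0.
  by rewrite mule0 mul0r.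
rewrite -push integral_mkcond; apply: eq_integral => y _; rewrite patchE indicE.
case: ifPn; rewrite ?notin_setE ?inE/= in_itv/= andbT => hy.
  have [yS|Sy] := leP y (L + S).
    by rewrite mem_set ?mul1r//= in_itv/= hy.
  by rewrite rhoS ?ltW// F00 mulr0.
by rewrite memNset ?mul0r//= in_itv/= => /andP[h _]; exact: hy.
Qed.

(** On each flank dy = dp / s, so the kinetic term s^2 / 2 dy becomes s / 2 dp, and the two flanks
    add up to the integral of [s]. Mass and potential are doubled as well, with [L] the half width
    of the plateau. *)
Lemma profile_energy (R : realType) (s c : R -> R) (M L e : R) :
  measurable_fun setT s -> 0 < e -> (forall p, e <= s p) -> 0 < M -> 0 <= L ->
  measurable_fun setT c -> (forall p, 0 <= c p) -> c 0 = 0 ->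
  exists psi g : R -> R, [/\ weak_derivative psi g,
    mu.-integrable setT (EFin \o psi),
    (\int[mu]_y (psi y)%:E =
      2%:E * ((L * M)%:E + \int[mu]_(p in `]0%R, M]) (p / s p)%:E))%E &
    (\int[mu]_y (2^-1 * g y ^+ 2 + c `|psi y|)%:E =
      \int[mu]_(p in `]0%R, M]) (s p)%:E +
      2%:E * ((L * c M)%:E + \int[mu]_(p in `]0%R, M]) (c p / s p)%:E))%E].
Proof.
move=> ms e0 es M0 L0 mc c0 c00.
have s0 p : 0 < s p by exact: lt_le_trans (es p).
have [S [rho [[S0 rho_ni rho_itv rhoL rhoS] push rhoE]]] := speed_profile ms e0 es M0 L0.
have mrho : measurable_fun setT rho.
  by apply: nonincreasing_measurable => // x y xy; exact: rho_ni.
pose k2 p := \1_(`]0, M]) p / s p : R.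
have k2E (F : R -> R) : (\int[mu]_p (k2 p * F p)%:E =
    \int[mu]_(p in `]0%R, M]) (F p / s p)%:E)%E.
  rewrite [RHS]integral_mkcond; apply: eq_integral => p _; rewrite patchE /k2 indicE.
  by case: ifPn => _; rewrite ?mul0r// mul1r mulrC.
pose k x := \1_(`]L, L + S]) x * s (rho x).
have mk : measurable_fun setT k.
  apply: measurable_funM; first exact: measurable_indic.
  exact: measurableT_comp.
have k0 x : 0 <= k x by rewrite mulr_ge0// ltW.
have kneg x : x <= 0 -> k x = 0.
  move=> x0; rewrite /k indicE memNset ?mul0r//= in_itv/= => /andP[Lx _].
  by move: (lt_le_trans (le_lt_trans L0 Lx) x0); rewrite ltxx.
have kfin : (\int[mu]_x (k x)%:E < +oo)%E.
  rewrite (_ : (\int[mu]_x (k x)%:E)%E = (rho 0)%:E) ?ltry// -rhoE.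
  rewrite [RHS]integral_mkcond; apply: eq_integral => x _; rewrite patchE.
  case: ifPn => //; rewrite notin_setE/= in_itv/= andbT => /negP; rewrite -leNgt => x0.
  by rewrite kneg.
have mass : (\int[mu]_y (`|rho `|y| |)%:E =
    2%:E * ((L * M)%:E + \int[mu]_(p in `]0%R, M]) (p / s p)%:E))%E.
  rewrite (@even_profile_integral R rho (fun p => `|p|) k2 L S M)//; first last.
  - exact: push.
  - by rewrite normr0.
  rewrite gtr0_norm// k2E; congr (_ * (_ + _))%E; apply: eq_integral => p.
  by rewrite inE/= in_itv/= => /andP[p0 _]; rewrite gtr0_norm.
have rhon (y : R) : `|rho `|y| | = rho `|y| by rewrite ger0_norm//; have /andP[] := rho_itv `|y|.
have mpsi : measurable_fun setT (fun y : R => rho `|y|) by exact: measurableT_comp.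
have ipsi : mu.-integrable setT (EFin \o (fun y : R => rho `|y|)).
  apply/integrableP; split; first exact/measurable_EFinP.
  rewrite [X in (X < _)%E](_ : _ = (\int[mu]_y (`|rho `|y| |)%:E)%E)//.
  rewrite mass lte_mul_pinfty//.
  rewrite lte_add_pinfty ?ltry//.
  apply: (@le_lt_trans _ _ (\int[mu]_(p in `]0%R, M]) (M / e)%:E)%E).
    apply: ge0_le_integral => //.
    - move=> p /=; rewrite in_itv/= => /andP[p0 _].
      by rewrite lee_fin divr_ge0// ltW.
    - apply/measurable_EFinP; apply: measurable_funM => //; apply: measurable_funTS.
      exact: measurable_fun_inv_pos.
    - move=> p /=; rewrite in_itv/= => /andP[p0 pM].
      by rewrite lee_fin ler_pM ?invr_ge0 ?(ltW p0) ?(ltW (s0 p))// lef_pV2 ?posrE.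
  by rewrite integral_cst//= lebesgue_measure_itv/= lte_fin M0 -EFinB -EFinM ltry.
exists (fun y => rho `|y|), (fun x => k (- x) - k x); split => //.
- exact: even_profile_weak_derivative.
- by rewrite -mass; apply: eq_integral => y _; rewrite rhon.
have mk2' : measurable_fun setT (fun x => (k x ^+ 2)%:E).
  by apply/measurable_EFinP; exact: measurable_funX.
have mkN : measurable_fun setT (fun x : R => k (- x)) by exact: measurableT_comp.
(* The two flanks lie on opposite sides of 0, so there is no mixed term. *)
have sq y : 2^-1 * (k (- y) - k y) ^+ 2 = 2^-1 * (k (- y) ^+ 2 + k y ^+ 2).
  have [y0|y0] := leP y 0; first by rewrite (kneg y)// subr0 expr0n addr0.
  by rewrite (kneg (- y)) ?oppr_le0 ?ltW// sub0r sqrrN expr0n add0r.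
have mg2 : measurable_fun setT (fun y : R => 2^-1 * (k (- y) - k y) ^+ 2).
  by apply: measurable_funM => //; apply: measurable_funX; exact: measurable_funB.
under eq_integral do rewrite EFinD.
rewrite ge0_integralD//; first last.
- by apply/measurable_EFinP; do 2 apply: measurableT_comp => //.
- by move=> y _; rewrite lee_fin.
- exact/measurable_EFinP.
- by move=> y _; rewrite lee_fin mulr_ge0 ?invr_ge0 ?sqr_ge0.
congr (_ + _)%E; last first.
  under eq_integral do rewrite rhon.
  rewrite (@even_profile_integral R rho c k2 L S M)//; last exact: push.
  by rewrite k2E.
have kk : (\int[mu]_x (k x ^+ 2)%:E = \int[mu]_(p in `]0%R, M]) (s p)%:E)%E.
  transitivity (\int[mu]_x (\1_(`]L, (L + S)%R]) x * s (rho x) ^+ 2)%:E)%E.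
    apply: eq_integral => x _; rewrite /k exprMn; congr (_ * _)%:E.
    by rewrite indicE; case: (_ \in _); rewrite ?expr1n ?expr0n.
  rewrite (push (fun p => s p ^+ 2)); first last.
  - by move=> p; exact: sqr_ge0.
  - exact: measurable_funX.
  rewrite k2E; apply: eq_integral => p _.
  by rewrite expr2 mulfK ?gt_eqF.
under eq_integral do rewrite sq EFinM.
rewrite ge0_integralZl//; first last.
- by move=> y _; rewrite lee_fin addr_ge0 ?sqr_ge0.
- by apply/measurable_EFinP; apply: measurable_funD; exact: measurable_funX.
under eq_integral do rewrite EFinD.
rewrite ge0_integralD//; first last.
- by move=> y _; rewrite lee_fin sqr_ge0.
- by apply/measurable_EFinP; exact: measurable_funX.
- by move=> y _; rewrite lee_fin sqr_ge0.
rewrite (@ge0_integral_opp R (fun x => (k x ^+ 2)%:E))//; last first.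
  by move=> x; rewrite lee_fin sqr_ge0.
rewrite kk.
have : (0 <= \int[mu]_(p in `]0%R, M]) (s p)%:E)%E.
  by apply: integral_ge0 => p _; rewrite lee_fin ltW.
case: (\int[mu]_(p in `]0%R, M]) (s p)%:E)%E => [r| |//] _.
  by rewrite -EFinD -EFinM; congr EFin; lra.
by rewrite addye// gt0_muley// lte_fin invr_gt0.
Qed.

(** * Almost optimal profiles of prescribed mass *)

Lemma excess_sqr_ge (R : realType) (tau : R -> R) (l p : R) : 0 < p ->
  2 * p * (specific_cost tau p - l) <= excess tau l p ^+ 2.
Proof.
move=> p0; rewrite /excess exprMn (sqr_sqrtr (ltW p0)) -mulrA mulrCA ler_pM2l//.
have [h|h] := leP 0 (2 * (specific_cost tau p - l)); first by rewrite sqr_sqrtr.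
by rewrite (le_trans (ltW h))// sqr_ge0.
Qed.

(* Concavity of the square root: its chord slope dominates the tangent slope. *)
Lemma excess_decrease (R : realType) (tau : R -> R) (l d e p : R) :
  0 <= d -> 0 < e -> 0 < p -> l + d < specific_cost tau p ->
  d * (p / (excess tau l p + e)) + excess tau (l + d) p <= excess tau l p.
Proof.
move=> d0 e0 p0 lz; set z := specific_cost tau p in lz *.
have z1 : 0 <= 2 * (z - l) by lra.
have z2 : 0 <= 2 * (z - (l + d)) by lra.
have v1 : excess tau l p ^+ 2 = p * (2 * (z - l)).
  by rewrite /excess exprMn !sqr_sqrtr// ltW.
have v2 : excess tau (l + d) p ^+ 2 = p * (2 * (z - (l + d))).
  by rewrite /excess exprMn !sqr_sqrtr// ltW.
have a0 := excess_ge0 tau l p; have b0 := excess_ge0 tau (l + d) p.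
move: (excess tau l p) (excess tau (l + d) p) v1 v2 a0 b0 => a b v1 v2 a0 b0.
have ae : 0 < a + e by lra.
have ba : b <= a.
  by rewrite -(@ler_pXn2r _ 2)// ?nnegrE// v1 v2 ler_pM2l//; lra.
rewrite -lerBrDr mulrA ler_pdivrMr//.
have : 2 * (d * p) = (a - b) * (a + b).
  by rewrite -subr_sqr v1 v2; ring.
have h : (a - b) * (a + b) <= (a - b) * (2 * (a + e)).
  by rewrite ler_wpM2l ?subr_ge0//; lra.
move=> E; move: h; rewrite -E [X in _ <= X -> _]mulrCA ler_pM2l//.
Qed.

(** The flanks must not already exceed the mass [w]. Let m be their half mass and H, H' the excess
    integrals for [l] and [l + d]. Integrating [excess_decrease] gives d m + H' <= H, while l w + 2
    H <= tau w <= (l + d) w + 2 H'. Subtracting, 2 d m <= d w. *)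
Lemma plateau_choice (R : realType) (tau : R -> R) (w d eta : R) :
  admissible_cost tau -> 0 < w -> 0 < d -> 0 < eta ->
  let l := left_slope tau w in
  exists M e, [/\ 0 < M, 0 < e, specific_cost tau M <= l + d, e * M <= eta &
    (2%:E * \int[mu]_(p in `]0%R, M]) (p / (excess tau l p + e))%:E <= w%:E)%E].
Proof.
move=> adm w0 d0 eta0 l; set z := specific_cost tau.
have l0 : 0 <= l by exact: left_slope_ge0.
have ld0 : 0 <= l + d by lra.
have mv a : measurable_fun setT (excess tau a) by exact: measurable_excess.
have v0 a p : 0 <= excess tau a p by exact: excess_ge0.
have hB := cost_ge_excess adm w0; rewrite -/l in hB.
have hA := cost_le_excess adm ld0 (ltW w0).
set H := (\int[mu]_p (excess tau l p)%:E)%E in hB.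
set H' := (\int[mu]_p (excess tau (l + d) p)%:E)%E in hA.
have H0 : (0 <= H)%E by apply: integral_ge0 => p _; rewrite lee_fin.
have H0' : (0 <= H')%E by apply: integral_ge0 => p _; rewrite lee_fin.
have Hf : H \is a fin_num.
  rewrite ge0_fin_numE// ltey; apply/eqP => Hoo.
  by move: hB; rewrite Hoo gt0_muley// addey.
have msd (e : R) (A : set R) : 0 < e -> measurable A ->
    measurable_fun A (fun p : R => (p / (excess tau l p + e))%:E).
  move=> e0 mA; apply/measurable_EFinP; apply: measurable_funM; first exact: measurable_funTS.
  apply: measurable_funTS; apply: measurable_fun_inv_pos; first exact: measurable_funD.
  by move=> p; rewrite ltr_wpDl.
have [[p1 [p10 p1z]]|none] := pselect (exists p, 0 < p /\ l + d < z p); last first.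
  (* If the specific cost never exceeds [l + d], any low plateau will do: with [e = 1] and [M <= 1]
     the integrand is at most 1, so the flanks carry at most [2 M <= w]. *)
  pose M := Num.min 1 (Num.min (w / 2) eta).
  have M0 : 0 < M by rewrite !lt_min ltr01 divr_gt0.
  have [M1 Mw Me] : [/\ M <= 1, M <= w / 2 & M <= eta].
    by rewrite /M; split; rewrite !ge_min lexx ?orbT.
  exists M, 1; split => //.
  - by rewrite leNgt; apply/negP => h; apply: none; exists M.
  - by rewrite mul1r.
  apply: (@le_trans _ _ (2%:E * \int[mu]_(p in `]0%R, M]) 1%:E)%E).
    rewrite lee_pmul2l//; apply: ge0_le_integral => //.
    - move=> p /=; rewrite in_itv/= => /andP[p0 _].
      by rewrite lee_fin divr_ge0 ?addr_ge0 ?(ltW p0).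
    - exact: msd.
    - move=> p /=; rewrite in_itv/= => /andP[p0 pM].
      by rewrite lee_fin ler_pdivrMr ?ltr_wpDl// mul1r (le_trans (le_trans pM M1))// lerDr.
  rewrite integral_cst//= lebesgue_measure_itv/= lte_fin M0 -EFinB subr0 mul1e.
  by rewrite -EFinM lee_fin; lra.
pose T := [set p | 0 < p /\ l + d < z p].
have T0 : T !=set0 by exists p1.
(* On []1, p]] with [p] in [T] the excess is at least [q], so [(p - 1) * q] is at most the finite
   excess integral; this bounds [T]. *)
pose q := Num.sqrt (2 * d); have q0 : 0 < q by rewrite sqrtr_gt0 mulr_gt0.
have Tub : has_ubound T.
  exists (1 + fine H / q) => p [p0 pz].
  have hq : 0 <= fine H / q by rewrite divr_ge0 ?fine_ge0// ltW.
  have [p_le1|p_gt1] := leP p 1; first lra.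
  rewrite -lerBlDl ler_pdivlMr// -lee_fin fineK//.
  apply: (@le_trans _ _ (\int[mu]_(x in `]1%R, p]) q%:E)%E).
    rewrite integral_cst//= lebesgue_measure_itv/= lte_fin p_gt1 -EFinB -EFinM.
    by rewrite mulrC.
  apply: (@le_trans _ _ (\int[mu]_(x in `]1%R, p]) (excess tau l x)%:E)%E).
    apply: ge0_le_integral => //.
    - by move=> x _; rewrite lee_fin ltW.
    - by apply/measurable_EFinP; apply: measurable_funTS; exact: mv.
    - move=> x /=; rewrite in_itv/= => /andP[x1 xp]; rewrite lee_fin /excess.
      have x0 : 0 < x by lra.
      have zx : l + d < z x by apply: lt_le_trans pz _; exact: specific_cost_nonincreasing.
      rewrite -[leLHS]mul1r; apply: ler_pM => //; first exact: ltW.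
        by rewrite -[leLHS]sqrtr1; apply: ler_wsqrtr; exact: ltW.
      by apply: ler_wsqrtr; rewrite ler_pM2l//; move: zx; rewrite /z; lra.
  apply: ge0_subset_integral => //; first by apply/measurable_EFinP; exact: mv.
  by move=> x _; rewrite lee_fin.
pose M := sup T.
have T_le p : T p -> p <= M by move=> Tp; exact: ub_le_sup.
have M0 : 0 < M by apply: (lt_le_trans p10); exact: T_le.
have belowM p : 0 < p -> p < M -> l + d < z p.
  move=> p0 pM; have [r [r0 rz] pr] := sup_gt T0 pM.
  by apply: lt_le_trans rz _; apply: specific_cost_nonincreasing => //; exact: ltW.
(* Otherwise lower semicontinuity would put points above the supremum into [T]. *)
have zM : z M <= l + d.
  rewrite leNgt; apply/negP => h.
  have [r /= r0 hr] := specific_cost_lsc adm M0 h.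
  have : T (M + r / 2).
    split; first by rewrite addr_gt0// divr_gt0.
    apply: hr; last by rewrite addr_gt0// divr_gt0.
    by rewrite /= opprD addrA subrr sub0r normrN gtr0_norm ?divr_gt0//; lra.
  by move/T_le; rewrite gerDl leNgt divr_gt0.
pose e := eta / M; have e0 : 0 < e by rewrite divr_gt0.
exists M, e; split => //; first by rewrite divfK// gt_eqF.
set m := (\int[mu]_(p in `]0%R, M]) _)%E.
have m0 : (0 <= m)%E.
  apply: integral_ge0 => p /=; rewrite in_itv/= => /andP[p0 _].
  by rewrite lee_fin divr_ge0 ?addr_ge0 ?(ltW p0) ?(ltW e0).
(* The end point is dropped because the strict inequality of [excess_decrease] holds only below
   [M]. *)
have mE : m = (\int[mu]_(p in `]0%R, M[) (p / (excess tau l p + e))%:E)%E.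
  by rewrite integral_itv_bndo_bndc//; exact: msd.
have step : (d%:E * m + H' <= H)%E.
  rewrite mE integral_mkcond -ge0_integralZl//; first last.
  - by rewrite lee_fin ltW.
  - move=> p _; rewrite patchE; case: ifPn => //; rewrite inE/= in_itv/= => /andP[p0 _].
    by rewrite lee_fin divr_ge0 ?addr_ge0 ?(ltW p0) ?(ltW e0).
  - by apply/(measurable_restrictT _ _).1 => //; exact: msd.
  have mr : measurable_fun setT ((fun p : R => (p / (excess tau l p + e))%:E) \_ `]0, M[).
    by apply/(measurable_restrictT _ _).1 => //; exact: msd.
  have r0 p : (0 <= ((fun p : R => (p / (excess tau l p + e))%:E) \_ `]0%R, M[) p)%E.
    rewrite patchE; case: ifPn => //; rewrite inE/= in_itv/= => /andP[p0 _].
    by rewrite lee_fin divr_ge0 ?addr_ge0 ?(ltW p0) ?(ltW e0).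
  rewrite -ge0_integralD//; first last.
  - by apply/measurable_EFinP; exact: mv.
  - by move=> p _; rewrite lee_fin.
  - by apply: measurable_funeM; exact: mr.
  - by move=> p _; rewrite mule_ge0// lee_fin ltW.
  apply: ge0_le_integral => //.
  - by move=> p _; rewrite adde_ge0 ?lee_fin// mule_ge0// lee_fin ltW.
  - apply: emeasurable_funD; first by apply: measurable_funeM; exact: mr.
    by apply/measurable_EFinP; exact: mv.
  - by apply/measurable_EFinP; exact: mv.
  - move=> p _; rewrite patchE; case: ifPn.
      rewrite inE/= in_itv/= => /andP[p0 pM].
      rewrite -EFinM -EFinD lee_fin; apply: excess_decrease => //; first exact: ltW.
      exact: belowM.
    move=> _; rewrite mule0 add0e lee_fin /excess ler_wpM2l// ler_wsqrtr//.
    by rewrite ler_pM2l//; lra.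
have H'f : H' \is a fin_num.
  rewrite ge0_fin_numE//; apply: (@le_lt_trans _ _ H); last by rewrite -ge0_fin_numE.
  by apply: le_trans step; rewrite leeDr// mule_ge0// lee_fin ltW.
have mf : m \is a fin_num.
  rewrite ge0_fin_numE// ltey; apply/eqP => moo.
  have /andP[H'N _] : (H' != -oo%E) && (H' != +oo%E) by rewrite -fin_numE.
  by move: step; rewrite moo gt0_muley ?lte_fin// addye// leye_eq => /eqP Hoo; rewrite Hoo in Hf.
move: step hA hB; rewrite -(fineK mf) -(fineK Hf) -(fineK H'f).
rewrite -!EFinM -!EFinD !lee_fin => h1 h2 h3.
rewrite -(ler_pM2l d0); lra.
Qed.

(** With half mass m of the flanks, they cost at most 2 H + e M + 2 l m and the plateau at most (w -
    2 m)(l + d). Together this is at most l w + 2 H + e M + d w, where l w + 2 H <= tau w, and e M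
    and d w each take half of [eta]. *)
Lemma energy_upper_bound (R : realType) (tau : R -> R) (w eta : R) :
  admissible_cost tau -> 0 < w -> 0 < eta ->
  exists psi g : R -> R, [/\ weak_derivative psi g,
    mu.-integrable setT (EFin \o psi), (\int[mu]_y (psi y)%:E = w%:E)%E &
    (\int[mu]_y (2^-1 * g y ^+ 2 + `|psi y| * specific_cost tau `|psi y|)%:E <=
      (tau w + eta)%:E)%E].
Proof.
move=> adm w0 eta0; set l := left_slope tau w; set z := specific_cost tau.
have l0 : 0 <= l by exact: left_slope_ge0.
pose d := eta / 2 / w; have d0 : 0 < d by rewrite !divr_gt0.
have dw : d * w = eta / 2 by rewrite divfK// gt_eqF.
have eta20 : 0 < eta / 2 by rewrite divr_gt0.
have [M [e [M0 e0 zM eM mass]]] := plateau_choice adm w0 d0 eta20.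
rewrite -/l -/z in zM mass.
pose v := excess tau l; pose s p := v p + e.
have v0 p : 0 <= v p by exact: excess_ge0.
have mv : measurable_fun setT v by exact: measurable_excess.
have ms : measurable_fun setT s by exact: measurable_funD.
have es p : e <= s p by rewrite lerDr.
have s0 p : 0 < s p by exact: lt_le_trans (es p).
have msV := measurable_fun_inv_pos ms s0.
pose c p := p * z p.
have mz : measurable_fun setT z by exact: measurable_specific_cost.
have mc : measurable_fun setT c by exact: measurable_funM.
have c0 p : 0 <= c p.
  have [p0|p0] := leP p 0; first by rewrite /c /z specific_cost_npos// mulr0.
  by rewrite mulr_ge0 ?(ltW p0)// specific_cost_ge0.
have c00 : c 0 = 0 by rewrite /c mul0r.
set m := (\int[mu]_(p in `]0%R, M]) _)%E in mass.
have m0 : (0 <= m)%E.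
  apply: integral_ge0 => p /=; rewrite in_itv/= => /andP[p0 _].
  by rewrite lee_fin divr_ge0 ?(ltW p0)// (ltW (s0 p)).
have mf : m \is a fin_num.
  rewrite ge0_fin_numE// ltey; apply/eqP => moo.
  by move: mass; rewrite moo gt0_muley.
have mass' : 2 * fine m <= w by rewrite -lee_fin EFinM fineK.
(* Half the mass missing to [w], spread at height [M]; [plateau_choice] makes it nonnegative. *)
pose L := (w / 2 - fine m) / M.
have L0 : 0 <= L by rewrite divr_ge0 ?(ltW M0)//; lra.
have LM : L * M = w / 2 - fine m by rewrite divfK// gt_eqF.
have [psi [g [wd ipsi psiw en]]] := profile_energy ms e0 es M0 L0 mc c0 c00.
exists psi, g; split => //.
  rewrite psiw -/m -(fineK mf) -EFinD -EFinM LM; congr EFin; lra.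
rewrite [leLHS]en.
have hB := cost_ge_excess adm w0; rewrite -/l -/v in hB.
set H := (\int[mu]_p (v p)%:E)%E in hB.
have H0 : (0 <= H)%E by apply: integral_ge0 => p _; rewrite lee_fin.
have Hf : H \is a fin_num.
  rewrite ge0_fin_numE// ltey; apply/eqP => Hoo.
  by move: hB; rewrite Hoo gt0_muley// addey.
have mcs (A : set R) : measurable_fun A (fun p : R => (c p / s p)%:E).
  by apply: measurable_funTS; apply/measurable_EFinP; exact: measurable_funM.
have mps (A : set R) : measurable_fun A (fun p : R => (p / s p)%:E).
  by apply: measurable_funTS; apply/measurable_EFinP; exact: measurable_funM.
have cs0 p : (0 <= (c p / s p)%:E)%E by rewrite lee_fin divr_ge0// ltW.
(* From [2 p (z p - l) <= v p ^+ 2 <= v p * s p] follows [2 c p / s p <= v p + 2 l p / s p]; adding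
   [s p = v p + e] gives the integrand used below. *)
have bulk : (\int[mu]_(p in `]0%R, M]) (s p)%:E +
    2%:E * \int[mu]_(p in `]0%R, M]) (c p / s p)%:E <=
    (2 * fine H + e * M + 2 * l * fine m)%:E)%E.
  rewrite -ge0_integralZl//; last exact: mcs.
  rewrite -ge0_integralD//; first last.
  - by apply: measurable_funeM; exact: mcs.
  - by move=> p _; rewrite mule_ge0.
  - by apply/measurable_EFinP; apply: measurable_funTS; exact: ms.
  - by move=> p _; rewrite lee_fin ltW.
  apply: (@le_trans _ _ (\int[mu]_(p in `]0%R, M])
      ((2%:E * (v p)%:E + e%:E) + (2 * l)%:E * (p / s p)%:E))%E).
    apply: ge0_le_integral => //.
    - by move=> p _; rewrite adde_ge0 ?mule_ge0// lee_fin ltW.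
    - apply: emeasurable_funD; last by apply: measurable_funeM; exact: mcs.
      by apply/measurable_EFinP; apply: measurable_funTS; exact: ms.
    - apply: emeasurable_funD; last by apply: measurable_funeM; exact: mps.
      apply: emeasurable_funD => //; apply: measurable_funeM.
      by apply/measurable_EFinP; apply: measurable_funTS; exact: mv.
    - move=> p /=; rewrite in_itv/= => /andP[p0 _].
      rewrite -!EFinM -!EFinD lee_fin.
      have h := excess_sqr_ge tau l p0; rewrite -/v -/z in h.
      have h' : 2 * p * (z p - l) / s p <= v p.
        by rewrite ler_pdivrMr// (le_trans h)// expr2 ler_wpM2l// lerDl ltW.
      have -> : 2 * (c p / s p) = 2 * p * (z p - l) / s p + 2 * l * (p / s p).
        by rewrite /c; ring.
      have sE : s p = v p + e by [].
      by move: h'; set u := _ / s p; set t := 2 * l * _; lra.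
  rewrite ge0_integralD//; first last.
  - by apply: measurable_funeM; exact: mps.
  - move=> p /=; rewrite in_itv/= => /andP[p0 _].
    by rewrite -EFinM lee_fin mulr_ge0 ?divr_ge0 ?mulr_ge0 ?(ltW p0) ?(ltW (s0 p)).
  - apply: emeasurable_funD => //; apply: measurable_funeM.
    by apply/measurable_EFinP; apply: measurable_funTS; exact: mv.
  - by move=> p _; rewrite adde_ge0 ?mule_ge0 ?lee_fin// ltW.
  rewrite [leRHS]EFinD; apply: leeD; last first.
    rewrite ge0_integralZl//; first last.
    - by rewrite lee_fin mulr_ge0.
    - move=> p /=; rewrite in_itv/= => /andP[p0 _].
      by rewrite lee_fin divr_ge0 ?(ltW p0)// ltW.
    - exact: mps.
    by rewrite [leRHS]EFinM fineK.
  rewrite ge0_integralD//; first last.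
  - by move=> p _; rewrite lee_fin ltW.
  - by apply: measurable_funeM; apply/measurable_EFinP; apply: measurable_funTS; exact: mv.
  - by move=> p _; rewrite mule_ge0// lee_fin.
  rewrite [leRHS]EFinD; apply: leeD; last first.
    rewrite integral_cst//= lebesgue_measure_itv/= lte_fin M0 -EFinB subr0.
    by rewrite -EFinM.
  rewrite ge0_integralZl//; first last.
  - by move=> p _; rewrite lee_fin.
  - by apply/measurable_EFinP; apply: measurable_funTS; exact: mv.
  rewrite [leRHS]EFinM fineK// lee_pmul2l//; apply: ge0_subset_integral => //.
    by apply/measurable_EFinP; exact: mv.
  by move=> p _; rewrite lee_fin.
have Lc0 : (0 <= (L * c M)%:E)%E by rewrite lee_fin (mulr_ge0 L0 (c0 M)).
rewrite (ge0_muleDr _ Lc0); last by apply: integral_ge0.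
rewrite addeCA; apply: (@le_trans _ _ (2%:E * (L * c M)%:E +
   (2 * fine H + e * M + 2 * l * fine m)%:E)%E); first exact: leeD.
move: hB; rewrite -(fineK Hf) -!EFinM -!EFinD !lee_fin => hB.
have cM : L * c M <= L * M * (l + d) by rewrite /c mulrA ler_wpM2l// mulr_ge0// ltW.
have m00 : 0 <= fine m by exact: fine_ge0.
rewrite LM in cM.
nra.
Qed.

(** Mass and energy integrands are unchanged almost everywhere by passing to the continuous
    representative, and [w] is at most the integral of [|psi|]. *)
Lemma energy_ge_cost (R : realType) (tau psi g : R -> R) (w : R) :
  admissible_cost tau -> 0 <= w -> weak_derivative psi g ->
  mu.-integrable setT (EFin \o psi) -> (\int[mu]_y (psi y)%:E = w%:E)%E ->
  ((tau w)%:E <=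
   \int[mu]_y (2^-1 * g y ^+ 2 + `|psi y| * specific_cost tau `|psi y|)%:E)%E.
Proof.
move=> adm w0 wd ipsi psiw.
have c0 (p : R) : 0 <= `|p| * specific_cost tau `|p|.
  by rewrite mulr_ge0// specific_cost_ge0.
have g0 (p : R) : 0 <= 2^-1 * g p ^+ 2 by rewrite mulr_ge0 ?invr_ge0 ?sqr_ge0.
move: w0; rewrite le_eqVlt => /predU1P[w00|w0].
  have [t0 _ _ _ _] := adm; rewrite -w00 t0.
  by apply: integral_ge0 => y _; rewrite lee_fin addr_ge0.
have [lpsi lg _] := wd.
have [f [psif fE cf']] := weak_derivative_continuous_representative wd.
have cf : continuous f.
  move=> x; have xx : x - 1 < x + 1 by lra.
  apply: (within_continuous_continuous xx); first exact: cf' (ltW xx).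
  by rewrite in_itv/=; apply/andP; split; lra.
have mf : measurable_fun setT f by exact: continuous_measurable_fun.
have mpsi : measurable_fun setT psi by case: lpsi.
have mg : measurable_fun setT g by case: lg.
have mz := measurable_specific_cost adm.
have mnorm (h : R -> R) : measurable_fun setT h -> measurable_fun setT (fun y => `|h y|).
  by move=> mh; exact: measurableT_comp.
have mE (h : R -> R) : measurable_fun setT h -> measurable_fun setT
    (fun y => (2^-1 * g y ^+ 2 + `|h y| * specific_cost tau `|h y|)%:E).
  move=> mh; apply/measurable_EFinP; apply: measurable_funD.
    by apply: measurable_funM => //; exact: measurable_funX.
  by apply: measurable_funM; [exact: mnorm|apply: measurableT_comp => //; exact: mnorm].
have ae_filter := ae_filter_ringOfSetsType (@lebesgue_measure R).
have absE : (\int[mu]_y (`|psi y|)%:E = \int[mu]_y (`|f y|)%:E)%E.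
  apply: ae_eq_integral => //.
  - by apply/measurable_EFinP; exact: mnorm.
  - by apply/measurable_EFinP; exact: mnorm.
  - by move: psif; apply: filterS => x ->.
rewrite (_ : (\int[mu]_y _)%E = (\int[mu]_y
    (2^-1 * g y ^+ 2 + `|f y| * specific_cost tau `|f y|)%:E)%E); last first.
  apply: ae_eq_integral => //; [exact: mE|exact: mE|].
  by move: psif; apply: filterS => x ->.
apply: energy_lower_bound => //.
- by rewrite -absE; move/integrableP : ipsi => [].
- rewrite -absE -psiw; apply: le_integral => //; first exact: integrable_norm.
  by move=> y _; rewrite lee_fin ler_norm.
Qed.

Unset Implicit Arguments.
Theorem mainTheorem5 (R : realType) (tau : R -> R) :
  admissible_cost tau ->
  exists c : R -> R,
    [/\ (forall x, 0 <= x -> 0 <= c x),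
        (forall w, 0 <= w ->
           (tau w)%:E =
           ereal_inf [set energy c psi | psi in
             [set psi : R -> R |
                lebesgue_measure.-integrable setT (EFin \o psi) /\
                (\int[lebesgue_measure]_y (psi y)%:E = w%:E)%E]]),
        lsc_pos (fun p => c p / p) &
        nonincreasing_pos (fun p => c p / p)].
Proof.
move=> adm; exists (fun p => p * specific_cost tau p).
have cE p : 0 < p -> p * specific_cost tau p / p = specific_cost tau p.
  by move=> p0; rewrite mulrAC divff ?mul1r// gt_eqF.
split.
- by move=> x x0; rewrite mulr_ge0// specific_cost_ge0.
- move=> w w0; apply/eqP; rewrite eq_le; apply/andP; split.
    apply: le_ereal_inf_tmp => _ [psi [ipsi psiw] <-].
    apply: le_ereal_inf_tmp => _ [g wd <-].
    exact: (energy_ge_cost adm w0 wd ipsi psiw).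
  rewrite le_eqVlt in w0; case/predU1P : w0 => [w00|w0].
    (* Without mass there is no slope [left_slope tau w] to work with; the zero function attains the
       value 0. *)
    have [t0 _ _ _ _] := adm; rewrite -w00 t0.
    pose zero : R -> R := cst 0.
    have i0 : lebesgue_measure.-integrable setT (EFin \o zero).
      by apply: eq_integrable (integrable0 _ _) => //; exact: measurableT.
    have l0 : locally_integrable setT zero.
      by apply: open_integrable_locally => //; exact: openT.
    have wd0 : weak_derivative zero zero.
      split => // phi _; rewrite !integral0_eq ?oppe0// => x _; rewrite /zero/= mul0r//.
    apply: (@le_trans _ _ (energy (fun p => p * specific_cost tau p) zero)).
      apply: ereal_inf_lbound; exists zero => //; split => //.
      exact: integral0.
    apply: ereal_inf_lbound; exists zero => //; apply: integral0_eq => y _.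
    by rewrite /zero/= normr0 mul0r expr0n/= mulr0 addr0.
  apply/lee_addgt0Pr => eta eta0.
  have [psi [g [wd ipsi psiw en]]] := energy_upper_bound adm w0 eta0.
  rewrite -EFinD; apply: le_trans en.
  apply: (@le_trans _ _ (energy (fun p => p * specific_cost tau p) psi)).
    by apply: ereal_inf_lbound; exists psi.
  by apply: ereal_inf_lbound; exists g.
- move=> x x0 a; rewrite cE// => /(specific_cost_lsc adm x0).
  by apply: filterS => y h y0; rewrite cE// h.
- by move=> x y x0 xy; rewrite !cE ?(lt_le_trans x0)// specific_cost_nonincreasing.
Qed.
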